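(* (1) If $\alpha\in(0,1/2]$ and $\rho\in[0,1]$, then $\mathcal{B}_{\alpha,\rho}\subset\mathcal{EM}$. (2) If $\alpha\in(0,1]$ and $\rho=1/2$, then $\mathcal{B}_{\alpha,\rho}\subset\mathcal{ID}(\ast)$. (3) If $\rho\in[0,1]$ and $\rho\neq1/2$, then $\mathcal{B}_{1,\rho}\not\subset\mathcal{ID}(\ast)$.
   Context: For a probability measure $\mu$ on $\mathbb{R}$, $G_\mu(z)=\int\frac{\mu(dx)}{z-x}$, $F_\mu=1/G_\mu$, $\eta_\mu(z)=1-zF_\mu(1/z)$ on $\mathbb{C}^-$. For $\alpha\in(0,1]$, $\rho\in[0,1]$ the Boolean stable law $\mathbf{b}_{\alpha,\rho}$ is the probability measure with $\eta_{\mathbf{b}_{\alpha,\rho}}(z)=-(e^{i\rho\pi}z)^\alpha$, $z\in\mathbb{C}^-$ (principal power). $\mathcal{B}_{\alpha,\rho}$ is the set of scale mixtures of $\mathbf{b}_{\alpha,\rho}$, i.e. the set of laws of $XB$ where $B$ has law $\mathbf{b}_{\alpha,\rho}$ and $X\ge0$ is any nonnegative random variable classically independent of $B$. $\mathcal{EM}$ is the set of exponential mixtures: laws of $XE$, where $E$ has density $e^{-x}1_{(0,\infty)}(x)$ and $X$ is any real random variable independent of $E$. $\mathcal{ID}(\ast)$ is the set of (classically) infinitely divisible probability measures on $\mathbb{R}$. *)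

(* Defs.v *)
From HB Require Import structures.
From mathcomp Require Import all_boot all_order all_algebra.
From mathcomp Require Import all_classical all_reals all_analysis.
From mathcomp Require Import measurable_realfun.
From mathcomp Require Export complex.
Set Implicit Arguments.
Unset Strict Implicit.
Unset Printing Implicit Defensive.
Import Order.TTheory GRing.Theory Num.Theory.
Import numFieldNormedType.Exports.
Local Open Scope classical_set_scope.
Local Open Scope ring_scope.
Local Open Scope complex_scope.

Section complex_functions.
Context {R : realType}.
Implicit Types (z w : R[i]).

(* Principal argument, with values in ]-pi, pi]; the value at 0 is
   irrelevant. *)
Definition Carg z : R :=
  let t := acos (complex.Re z / Normc.normc z) in
  if 0 <= complex.Im z then t else - t.

Definition Clog z : R[i] := ln (Normc.normc z) +i* Carg z.

Definition Cexp z : R[i] :=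
  (expR (complex.Re z))%:C * (cos (complex.Im z) +i* sin (complex.Im z)).

(* Principal power, for nonzero z. *)
Definition Cpow z w : R[i] := Cexp (w * Clog z).

End complex_functions.

Section transforms.
Context {R : realType}.
Implicit Types (mu : probability (measurableTypeR R) R) (z : R[i]).

Definition Cintegral mu (f : R -> R[i]) : R[i] :=
  Rintegral mu setT (fun x => complex.Re (f x)) +i*
  Rintegral mu setT (fun x => complex.Im (f x)).

Definition cauchy_transform mu z : R[i] :=
  Cintegral mu (fun x => (z - x%:C)^-1).

Definition F_transform mu z : R[i] := (cauchy_transform mu z)^-1.

Definition eta_transform mu z : R[i] := 1 - z * F_transform mu z^-1.

(* For rho in [0, 1] and z in the open lower half-plane, e^(i rho pi) z is
   never a nonpositive real, so that the principal power is unambiguous. *)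
Definition is_boolean_stable (alpha rho : R) mu : Prop :=
  forall z, complex.Im z < 0 ->
    eta_transform mu z = - Cpow (Cexp (0 +i* (rho * pi)) * z) alpha%:C.

End transforms.

Section random_variables.
Context {R : realType} d (T : measurableType d) (P : probability T R).

(* Laws are compared on measurable sets only: measures are total functions on
   sets, unconstrained on the nonmeasurable ones. *)
Definition has_law (X : T -> R) (m : set R -> \bar R) : Prop :=
  forall A : set R, measurable A -> pushforward P X A = m A.

Definition independent_RV (X Y : {RV P >-> R}) : Prop :=
  forall A B : set R, measurable A -> measurable B ->
    P (X @^-1` A `&` Y @^-1` B) = (P (X @^-1` A) * P (Y @^-1` B))%E.

End random_variables.

Definition boolean_stable_mixtures {R : realType} (alpha rho : R) :
    set (probability (measurableTypeR R) R) :=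
  [set mu | exists b : probability (measurableTypeR R) R,
    is_boolean_stable alpha rho b /\
    exists (d : measure_display) (T : measurableType d)
           (P : probability T R) (X B : {RV P >-> R}),
    [/\ independent_RV X B, forall t, 0 <= X t,
        has_law P B b & has_law P (fun t => X t * B t) mu] ].

Definition exponential_mixtures {R : realType} :
    set (probability (measurableTypeR R) R) :=
  [set mu | exists (d : measure_display) (T : measurableType d)
                   (P : probability T R) (X E : {RV P >-> R}),
    [/\ independent_RV X E, has_law P E (exponential_prob 1)
      & has_law P (fun t => X t * E t) mu] ].

Section infinite_divisibility.
Context {R : realType}.
Implicit Types (mu nu : probability (measurableTypeR R) R).

Definition add_pair (p : measurableTypeR R * measurableTypeR R) :
  measurableTypeR R := (p.1 : R) + (p.2 : R).

Lemma measurable_add_pair : measurable_fun setT add_pair.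
Proof.
by apply: (@measurable_funD _ _ R); [exact: measurable_fst|exact: measurable_snd].
Qed.

HB.instance Definition _ :=
  isMeasurableFun.Build _ _ _ _ add_pair measurable_add_pair.

Definition convolution mu nu : probability (measurableTypeR R) R :=
  distribution (mu \x nu)%E add_pair.

Definition convolution_power nu (n : nat) : probability (measurableTypeR R) R :=
  iter n (convolution nu) (\d_(0 : measurableTypeR R)).

Definition infinitely_divisible :
    set (probability (measurableTypeR R) R) :=
  [set mu | forall n : nat, (0 < n)%N ->
    exists nu, forall A, measurable A -> convolution_power nu n A = mu A].

End infinite_divisibility.

(* Main.v *)
Require Import Defs.
From HB Require Import structures.
From mathcomp Require Import all_boot all_order all_algebra.
From mathcomp Require Import all_classical all_reals all_analysis.
From mathcomp Require Import measurable_realfun.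
From mathcomp Require Import ring lra.
Set Implicit Arguments.
Unset Strict Implicit.
Unset Printing Implicit Defensive.
Import Order.TTheory GRing.Theory Num.Theory.
Import numFieldNormedType.Exports.
Local Open Scope classical_set_scope.
Local Open Scope ring_scope.

(** Everything is done in the logarithmic coordinate [xi = ln |x|]. By Stieltjes
    inversion of the Cauchy transform, a Boolean stable law of index [a] whose
    angles are at most [pi / 2] has on each half-line the density
    [sin th / (pi * (e^(a xi) + e^(- a xi) + 2 cos th))] in this coordinate, where
    [th] is [a * rho * pi] on the positive half-line and [a * (1 - rho) * pi] on the
    negative one ([boolean_stable_density]). The function of [xi] is holomorphic in
    a strip of half-width [(pi - th) / a], and the proofs move lines of integration
    in that strip.

    Exponential mixtures. The density [1 / (pi * (e^(xi / 2) + e^(- xi / 2)))] is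
    that of a quotient of two independent Gamma variables of index [1 / 2]; the
    numerator is an arcsine variable times an exponential variable, so that the
    quotient has an independent exponential factor ([half_sech_exponential]). The
    same function is the Poisson kernel relating the two edges of a strip of width
    [pi]. Hence a Boolean stable density, continued to the line [Im xi = pi], is
    recovered by convolving the real part of its values there with this kernel
    ([poisson_formula]). For [a <= 1 / 2] this real part is nonnegative, and the
    convolution says that the law is that of a product of two independent variables,
    the second of which is the quotient of Gamma variables
    ([boolean_stable_half_sech_factor]). A mixture inherits the exponential factor
    because products of laws are associative.

    Infinite divisibility for [rho = 1 / 2]. Turning the half-line [x > 0] onto the
    imaginary half-line, which is the line [Im xi = pi / 2], transforms the
    characteristic function of [b] into a Laplace transform at [|t|] with a
    nonnegative weight ([boolean_stable_laplace]); in other words [b], and every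
    scale mixture of [b], is a scale mixture of symmetric Cauchy laws. The logarithm
    of a Laplace transform is convex, so that its roots are convex decreasing
    functions of [|t|], hence characteristic functions by Pólya's criterion
    ([infinitely_divisible_laplace]). Uniqueness of the characteristic function
    concludes.

    Failure for index one and [rho != 1 / 2]. The law [b] is a Cauchy law with a
    nonzero centre. The scales [1] and [2] can be given weights for which the
    characteristic function of the mixture vanishes at a point. That of an
    infinitely divisible law has with each zero also its half as a zero
    ([infinitely_divisible_zero]), which fails here ([boolean_stable_not_ID]). *)

(** * Integrals of bounded functions *)

Section bounded_measurable.
Context {R : realType}.

Definition bounded_mfun d (T : measurableType d) (f : T -> R) :=
  measurable_fun setT f /\ exists M, forall x, `|f x| <= M.

Lemma bounded_mfun_integrable d (T : measurableType d)
    (mu : {finite_measure set T -> \bar R}) (f : T -> R) :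
  bounded_mfun f -> mu.-integrable setT (EFin \o f).
Proof.
move=> [mf [M fM]]; apply: measurable_bounded_integrable => //.
  by rewrite -ge0_fin_numE ?measure_ge0// fin_num_measure.
exists M; split => [|N MN x _]; first exact: num_real.
exact: le_trans (fM x) (ltW MN).
Qed.

Lemma bounded_mfun_cst d (T : measurableType d) (c : R) :
  bounded_mfun (fun _ : T => c).
Proof. by split; [exact: measurable_cst|exists `|c|]. Qed.

Lemma bounded_mfunD d (T : measurableType d) (f g : T -> R) :
  bounded_mfun f -> bounded_mfun g -> bounded_mfun (fun x => f x + g x).
Proof.
move=> [mf [M fM]] [mg [N gN]]; split; first exact: measurable_funD.
by exists (M + N) => x; rewrite (le_trans (ler_normD _ _))// lerD.
Qed.

Lemma bounded_mfunM d (T : measurableType d) (f g : T -> R) :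
  bounded_mfun f -> bounded_mfun g -> bounded_mfun (fun x => f x * g x).
Proof.
move=> [mf [M fM]] [mg [N gN]]; split; first exact: measurable_funM.
by exists (M * N) => x; rewrite normrM ler_pM.
Qed.

Lemma bounded_mfunN d (T : measurableType d) (f : T -> R) :
  bounded_mfun f -> bounded_mfun (fun x => - f x).
Proof.
move=> [mf [M fM]]; split; first exact: measurableT_comp.
by exists M => x; rewrite normrN.
Qed.

Lemma bounded_mfunB d (T : measurableType d) (f g : T -> R) :
  bounded_mfun f -> bounded_mfun g -> bounded_mfun (fun x => f x - g x).
Proof. by move=> bf /bounded_mfunN; exact: bounded_mfunD. Qed.

Lemma bounded_mfun_comp d d' (T : measurableType d) (U : measurableType d')
    (f : U -> R) (g : T -> U) :
  bounded_mfun f -> measurable_fun setT g -> bounded_mfun (f \o g).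
Proof.
move=> [mf [M fM]] mg; split; first exact: measurableT_comp.
by exists M => x; exact: fM.
Qed.

Lemma bounded_mfun_cos d (T : measurableType d) (f : T -> R) :
  measurable_fun setT f -> bounded_mfun (cos \o f).
Proof.
move=> mf; apply: bounded_mfun_comp => //; split.
  exact: continuous_measurable_fun (@continuous_cos R).
by exists 1 => x; rewrite cos_max.
Qed.

Lemma bounded_mfun_sin d (T : measurableType d) (f : T -> R) :
  measurable_fun setT f -> bounded_mfun (sin \o f).
Proof.
move=> mf; apply: bounded_mfun_comp => //; split.
  exact: continuous_measurable_fun (@continuous_sin R).
by exists 1 => x; rewrite sin_max.
Qed.

Lemma bounded_mfun_indic d (T : measurableType d) (A : set T) :
  measurable A -> bounded_mfun (\1_A : T -> R).
Proof.
move=> mA; split; first exact: measurable_indic.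
by exists 1 => x; rewrite indicE; case: (_ \in _); rewrite ?normr1 ?normr0.
Qed.

Section finite_measure_integral.
Context d (T : measurableType d) (mu : {finite_measure set T -> \bar R}).
Implicit Types f g : T -> R.

Lemma bRintegralD f g : bounded_mfun f -> bounded_mfun g ->
  \int[mu]_x (f x + g x) = \int[mu]_x f x + \int[mu]_x g x.
Proof. by move=> bf bg; rewrite RintegralD//; exact: bounded_mfun_integrable. Qed.

Lemma bRintegralB f g : bounded_mfun f -> bounded_mfun g ->
  \int[mu]_x (f x - g x) = \int[mu]_x f x - \int[mu]_x g x.
Proof. by move=> bf bg; rewrite RintegralB//; exact: bounded_mfun_integrable. Qed.

Lemma bRintegralZl f r : bounded_mfun f ->
  \int[mu]_x (r * f x) = r * \int[mu]_x f x.
Proof. by move=> bf; rewrite RintegralZl//; exact: bounded_mfun_integrable. Qed.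

Lemma bRintegralZr f r : bounded_mfun f ->
  \int[mu]_x (f x * r) = \int[mu]_x f x * r.
Proof. by move=> bf; rewrite RintegralZr//; exact: bounded_mfun_integrable. Qed.

Lemma bRintegralN f : bounded_mfun f ->
  \int[mu]_x (- f x) = - \int[mu]_x f x.
Proof.
move=> bf; rewrite -[RHS]mulN1r -bRintegralZl//.
by apply: eq_Rintegral => x _; rewrite mulN1r.
Qed.

Lemma ble_Rintegral f g : bounded_mfun f -> bounded_mfun g ->
  (forall x, f x <= g x) -> \int[mu]_x f x <= \int[mu]_x g x.
Proof. by move=> bf bg fg; apply: le_Rintegral => //; exact: bounded_mfun_integrable. Qed.

Lemma EFin_bRintegral f : bounded_mfun f ->
  (\int[mu]_x f x)%:E = (\int[mu]_x (f x)%:E)%E.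
Proof.
by move=> bf; rewrite fineK//; apply: integrable_fin_num => //; exact: bounded_mfun_integrable.
Qed.

(** Bounded convergence. *)
Lemma bounded_cvg_Rintegral (f_ : nat -> T -> R) f (M : R) :
  (forall n, measurable_fun setT (f_ n)) -> measurable_fun setT f ->
  (forall n x, `|f_ n x| <= M) ->
  (forall x, f_ n x @[n --> \oo] --> f x) ->
  \int[mu]_x f_ n x @[n --> \oo] --> \int[mu]_x f x.
Proof.
move=> mf_ mf fM fcv; apply: fine_cvg.
have fle x : `|f x| <= M.
  have fx : `|f_ n x| @[n --> \oo] --> `|f x| by exact: cvg_norm.
  rewrite -(cvg_lim _ fx)//; apply: limr_le; last exact: nearW.
  by apply/cvg_ex; exists `|f x|.
rewrite EFin_bRintegral; last by split => //; exists M.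
have [] := @dominated_convergence _ _ _ mu setT measurableT (fun n x => (f_ n x)%:E)
  (fun x => (f x)%:E) (fun=> M%:E).
- by move=> n; exact/measurable_EFinP.
- exact/measurable_EFinP.
- by apply/aeW => x _; apply: cvg_EFin; [exact: nearW|exact: fcv].
- by apply: bounded_mfun_integrable; exact: bounded_mfun_cst.
- by apply/aeW => x n _ /=; rewrite lee_fin.
- by [].
Qed.

End finite_measure_integral.

Lemma Rintegral_prob_cst d (T : measurableType d) (P : probability T R) (c : R) :
  \int[P]_x c = c.
Proof. by rewrite Rintegral_cst//= probability_setT mulr1. Qed.

Lemma normr_Rintegral_prob d (T : measurableType d) (P : probability T R)
    (f : T -> R) M : measurable_fun setT f -> (forall x, `|f x| <= M) ->
  `|\int[P]_x f x| <= M.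
Proof.
move=> mf fM; have bf : bounded_mfun f by split => //; exists M.
rewrite ler_norml -[M](Rintegral_prob_cst P) -bRintegralN; last exact: bounded_mfun_cst.
have fM2 x : - M <= f x <= M by rewrite -ler_norml.
apply/andP; split; apply: ble_Rintegral; do ?[exact: bf|exact: bounded_mfun_cst].
  by move=> x; case/andP: (fM2 x).
by move=> x; case/andP: (fM2 x).
Qed.

Lemma eq_measure_Rintegral d (T : measurableType d) (m1 m2 : {measure set T -> \bar R})
    (f : T -> R) : (forall A, measurable A -> m1 A = m2 A) ->
  \int[m1]_x f x = \int[m2]_x f x.
Proof.
by move=> m12; rewrite /Rintegral; congr fine; apply: eq_measure_integral => A mA _; exact: m12.
Qed.

Lemma Rintegral_indic d (T : measurableType d) (P : probability T R) (A : set T) :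
  measurable A -> (\int[P]_x (\1_A x))%:E = P A.
Proof.
move=> mA; rewrite EFin_bRintegral; last exact: bounded_mfun_indic.
by rewrite integral_indic// setIT.
Qed.

Section fubini_bounded.
Context d1 d2 (T1 : measurableType d1) (T2 : measurableType d2).
Variables (m1 : {finite_measure set T1 -> \bar R}) (m2 : {finite_measure set T2 -> \bar R}).
Variable f : T1 * T2 -> R.
Hypothesis bf : bounded_mfun f.

Let mf : measurable_fun setT f := bf.1.

Lemma bounded_mfun_prod1 x : bounded_mfun (fun y => f (x, y)).
Proof. by apply: (bounded_mfun_comp bf); exact: measurable_pair1. Qed.

Lemma bounded_mfun_prod2 y : bounded_mfun (fun x => f (x, y)).
Proof. by apply: (bounded_mfun_comp bf); exact: measurable_pair2. Qed.

Let finf : (m1 \x m2)%E.-integrable setT (EFin \o f).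
Proof.
have [_ [M fM]] := bf.
apply/integrable12ltyP; first exact/measurable_EFinP.
apply: (@le_lt_trans _ _ (\int[m1]_x \int[m2]_y `|M|%:E)%E).
  apply: ge0_le_integral => //.
  - by move=> x _; exact: integral_ge0.
  - apply: (@measurable_fun_fubini_tonelli_F _ _ _ _ _ m2 (fun z => `|(f z)%:E|%E)) => //.
    by apply: measurableT_comp => //; exact/measurable_EFinP.
  - move=> x _; apply: ge0_le_integral => //.
    + apply: measurableT_comp => //; apply/measurable_EFinP.
      by case: (bounded_mfun_prod1 x).
    + by move=> y _; rewrite lee_fin (le_trans (fM _))// ler_norm.
under eq_integral do rewrite integral_cst//.
rewrite integral_cst//= ltey_eq fin_numM// ?fin_num_measure//.
by rewrite fin_numM// fin_num_measure.
Qed.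

Lemma bounded_mfun_Rintegral1 : bounded_mfun (fun x => \int[m2]_y f (x, y)).
Proof.
have [_ [M fM]] := bf; split.
  apply/measurable_EFinP.
  apply: (eq_measurable_fun (fun x => \int[m2]_y (f (x, y))%:E)%E).
    by move=> x _; rewrite /= EFin_bRintegral//; exact: bounded_mfun_prod1.
  exact: (measurable_fubini_F finf).
exists (M * fine (m2 setT)) => x.
rewrite ler_norml -Rintegral_cst// -bRintegralN; last exact: bounded_mfun_cst.
have fM2 y : - M <= f (x, y) <= M by rewrite -ler_norml.
apply/andP; split; apply: ble_Rintegral;
    do ?[exact: bounded_mfun_prod1|exact: bounded_mfun_cst].
  by move=> y; case/andP: (fM2 y).
by move=> y; case/andP: (fM2 y).
Qed.

Lemma bounded_mfun_Rintegral2 : bounded_mfun (fun y => \int[m1]_x f (x, y)).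
Proof.
have [_ [M fM]] := bf; split.
  apply/measurable_EFinP.
  apply: (eq_measurable_fun (fun y => \int[m1]_x (f (x, y))%:E)%E).
    by move=> x _; rewrite /= EFin_bRintegral//; exact: bounded_mfun_prod2.
  exact: (measurable_fubini_G finf).
exists (M * fine (m1 setT)) => y.
rewrite ler_norml -Rintegral_cst// -bRintegralN; last exact: bounded_mfun_cst.
have fM2 x : - M <= f (x, y) <= M by rewrite -ler_norml.
apply/andP; split; apply: ble_Rintegral;
    do ?[exact: bounded_mfun_prod2|exact: bounded_mfun_cst].
  by move=> x; case/andP: (fM2 x).
by move=> x; case/andP: (fM2 x).
Qed.

Lemma Rintegral_prod1 :
  \int[(m1 \x m2)%E]_z f z = \int[m1]_x \int[m2]_y f (x, y).
Proof.
rewrite /Rintegral -(integral12_prod_meas1 finf) /fubini_F/=; congr fine.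
apply: eq_integral => x _; rewrite -EFin_bRintegral//; exact: bounded_mfun_prod1.
Qed.

Lemma Rintegral_prod2 :
  \int[(m1 \x m2)%E]_z f z = \int[m2]_y \int[m1]_x f (x, y).
Proof.
rewrite /Rintegral -(integral21_prod_meas1 finf) /fubini_G/=; congr fine.
apply: eq_integral => x _; rewrite -EFin_bRintegral//; exact: bounded_mfun_prod2.
Qed.

Lemma Rintegral_swap :
  \int[m1]_x \int[m2]_y f (x, y) = \int[m2]_y \int[m1]_x f (x, y).
Proof. by rewrite -Rintegral_prod1 Rintegral_prod2. Qed.

End fubini_bounded.

Section interval_integral.
Notation mu := (@lebesgue_measure R).

Let itv_fin (a b : R) : (mu `[a, b] < +oo)%E.
Proof. by rewrite lebesgue_measure_itv/=; case: ifP => // _; rewrite -EFinB ltry. Qed.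

Let lam (a b : R) : {finite_measure set (measurableTypeR R) -> \bar R} :=
  @mfrestr _ (measurableTypeR R) R `[a, b]%classic mu (measurable_itv `[a, b])
    (itv_fin a b).

Let Rintegral_lam a b (f : R -> R) : bounded_mfun f ->
  \int[lam a b]_x f x = \int[mu]_(x in `[a, b]) f x.
Proof.
move=> bf; rewrite /Rintegral; congr fine.
rewrite (@negligible_integral _ _ _ (lam a b) setT (~` `[a, b]))//.
- rewrite setTD setCK; apply: eq_measure_integral => A mA AD.
  by rewrite /lam/= /mfrestr /mrestr setIidl.
- exact: measurableC.
- exact: bounded_mfun_integrable.
- by rewrite /lam/= /mfrestr /mrestr setICl measure0.
Qed.

Lemma bounded_mfun_integrable_itv a b (f : R -> R) : bounded_mfun f ->
  mu.-integrable `[a, b] (EFin \o f).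
Proof.
move=> [mf [M fM]]; apply: measurable_bounded_integrable => //.
- exact: itv_fin.
- exact: measurable_funTS.
exists M; split => [|N MN x _]; first exact: num_real.
exact: le_trans (fM x) (ltW MN).
Qed.

Lemma bounded_mfun_Rintegral_itv d (T : measurableType d)
    (P : {finite_measure set T -> \bar R}) (a b : R) (f : T * R -> R) :
  bounded_mfun f -> bounded_mfun (fun x => \int[mu]_(v in `[a, b]) f (x, v)).
Proof.
move=> bf; have := @bounded_mfun_Rintegral1 _ _ T _ P (lam a b) f bf.
congr bounded_mfun; apply/funext => x; rewrite Rintegral_lam//.
exact: (bounded_mfun_prod1 bf).
Qed.

Lemma Rintegral_itv_swap d (T : measurableType d)
    (P : {finite_measure set T -> \bar R}) (a b : R) (f : T * R -> R) :
  bounded_mfun f ->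
  \int[P]_x \int[mu]_(v in `[a, b]) f (x, v) =
  \int[mu]_(v in `[a, b]) \int[P]_x f (x, v).
Proof.
move=> bf; rewrite -Rintegral_lam; last exact: (@bounded_mfun_Rintegral2 _ _ _ _ P (lam a b)).
rewrite -(@Rintegral_swap _ _ _ _ P (lam a b) _ bf).
by apply: eq_Rintegral => x _; rewrite -Rintegral_lam//; exact: (bounded_mfun_prod1 bf).
Qed.

Lemma bounded_cvg_Rintegral_itv (a b : R) (f_ : nat -> R -> R) (f : R -> R) (M : R) :
  (forall n, measurable_fun setT (f_ n)) -> measurable_fun setT f ->
  (forall n x, `|f_ n x| <= M) -> (forall x, `|f x| <= M) ->
  (forall x, f_ n x @[n --> \oo] --> f x) ->
  \int[mu]_(x in `[a, b]) f_ n x @[n --> \oo] --> \int[mu]_(x in `[a, b]) f x.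
Proof.
move=> mf_ mf f_M fM cf.
rewrite -Rintegral_lam; last by split => //; exists M.
have E n : \int[mu]_(x in `[a, b]) f_ n x = \int[lam a b]_x f_ n x.
  by rewrite Rintegral_lam//; split => //; exists M.
under eq_fun do rewrite E.
exact: (@bounded_cvg_Rintegral _ (measurableTypeR R) (lam a b) f_ f M).
Qed.

End interval_integral.

Section distribution_integral.
Context d d' (T : measurableType d) (T' : measurableType d') (P : probability T R).

Lemma Rintegral_distribution (X : {mfun T >-> T'}) (f : T' -> R) : bounded_mfun f ->
  \int[distribution P X]_x f x = \int[P]_t f (X t).
Proof.
move=> bf; rewrite /Rintegral integral_pushforward//.
- by apply/measurable_EFinP; case: bf.
- by rewrite preimage_setT; apply: bounded_mfun_integrable; exact: bounded_mfun_comp.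
Qed.

End distribution_integral.

End bounded_measurable.

(** * Calculus and Cauchy's theorem for pairs of conjugate functions *)

Section derivatives.
Context {R : realType}.
Implicit Types (f g : R -> R) (x a b : R).

Lemma has_derive_cst x a : is_derive x 1 (fun=> a) (0 : R).
Proof. exact: is_derive_cst. Qed.

Lemma has_derive_id x : is_derive x 1 (fun y : R => y) (1 : R).
Proof. exact: is_derive_id. Qed.

Lemma has_derive_add f g x a b : is_derive x 1 f a -> is_derive x 1 g b ->
  is_derive x 1 (fun y => f y + g y) (a + b).
Proof. exact: is_deriveD. Qed.

Lemma has_derive_opp f x a : is_derive x 1 f a -> is_derive x 1 (fun y => - f y) (- a).
Proof. exact: is_deriveN. Qed.

Lemma has_derive_mul f g x a b : is_derive x 1 f a -> is_derive x 1 g b ->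
  is_derive x 1 (fun y => f y * g y) (f x * b + g x * a).
Proof. exact: is_deriveM. Qed.

Lemma has_derive_comp f g x a b : is_derive (g x) 1 f a -> is_derive x 1 g b ->
  is_derive x 1 (fun y => f (g y)) (a * b).
Proof. exact: is_derive1_comp. Qed.

Lemma has_derive_expR g x b : is_derive x 1 g b ->
  is_derive x 1 (fun y => expR (g y)) (expR (g x) * b).
Proof. by apply: has_derive_comp. Qed.

Lemma has_derive_cos g x b : is_derive x 1 g b ->
  is_derive x 1 (fun y => cos (g y)) (- sin (g x) * b).
Proof. by apply: has_derive_comp. Qed.

Lemma has_derive_sin g x b : is_derive x 1 g b ->
  is_derive x 1 (fun y => sin (g y)) (cos (g x) * b).
Proof. by apply: has_derive_comp. Qed.

Lemma has_derive_atan g x b : is_derive x 1 g b ->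
  is_derive x 1 (fun y => atan (g y)) ((1 + g x ^+ 2)^-1 * b).
Proof. by apply: has_derive_comp; exact: is_derive1_atan. Qed.

Lemma has_derive_inv g x b : g x != 0 -> is_derive x 1 g b ->
  is_derive x 1 (fun y => (g y)^-1) (- (g x) ^- 2 * b).
Proof. by move=> g0 dg; exact: is_deriveV. Qed.

Lemma has_derive_eq f x a b : is_derive x 1 f a -> a = b -> is_derive x 1 f b.
Proof. by move=> df <-. Qed.

Lemma has_derive_continuous f x a : is_derive x 1 f a -> {for x, continuous f}.
Proof.
by case=> df _; apply: differentiable_continuous; exact/derivable1_diffP.
Qed.

End derivatives.

Lemma cvg_ext {R : realType} (T : Type) (F : set_system T) (f g : T -> R) (l : R) :
  f =1 g -> f x @[x --> F] --> l -> g x @[x --> F] --> l.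
Proof. by move=> /funext ->. Qed.

(** Computes a derivative up to the form of the result. *)
Ltac diff := eapply has_derive_eq;
  [repeat first [exact: has_derive_cst|exact: has_derive_id|eapply has_derive_opp
    |eapply has_derive_add|eapply has_derive_mul|eapply has_derive_expR|eapply has_derive_cos
    |eapply has_derive_sin|eapply has_derive_atan|eapply has_derive_inv]|].

Section rectangle.
Context {R : realType}.
Notation mu := (@lebesgue_measure R).
Notation Re := complex.Re.
Notation Im := complex.Im.

Lemma Rintegral_FTC (f F : R -> R) a b : a < b -> {in `[a, b], continuous f} ->
  (forall x, x \in `[a, b] -> is_derive x 1 F (f x)) ->
  \int[mu]_(x in `[a, b]) f x = F b - F a.
Proof.
move=> ab cf dF.
have cF x : x \in `[a, b] -> {for x, continuous F}.
  by move=> /dF dx; apply: differentiable_continuous; apply/derivable1_diffP; case: dx.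
rewrite /Rintegral (@continuous_FTC2 _ f F)//.
- apply: continuous_in_subspaceT => x; rewrite inE => xab; exact: cf.
- split.
  + by move=> x xab; have /dF[] : x \in `[a, b] by exact: subset_itv_oo_cc xab.
  + apply: cvg_at_right_filter; apply: cF; by rewrite in_itv/= lexx ltW.
  + apply: cvg_at_left_filter; apply: cF; by rewrite in_itv/= lexx ltW.
- move=> x xab; rewrite derive1E.
  by have /dF[_ ->] : x \in `[a, b] by exact: subset_itv_oo_cc xab.
Qed.

Lemma compact_rectangle (a b c e : R) : compact (`[a, b] `*` `[c, e]).
Proof. by apply: compact_setX; exact: segment_compact. Qed.

Lemma continuous_rectangle_bounded (f : R * R -> R) (a b c e : R) :
  (forall x y, a <= x <= b -> c <= y <= e -> {for (x, y), continuous f}) ->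
  exists M, forall x y, a <= x <= b -> c <= y <= e -> `|f (x, y)| <= M.
Proof.
move=> cf.
have [M [_ HM]] : bounded_set (f @` (`[a, b] `*` `[c, e])).
  apply: compact_bounded; apply: continuous_compact; last exact: compact_rectangle.
  apply: continuous_in_subspaceT => -[x y]; rewrite inE => -[/= xab yce].
  by apply: cf; [move: xab|move: yce]; rewrite in_itv.
exists (M + 1) => x y xab yce; apply: (HM (M + 1)); first by rewrite ltrDl.
by exists (x, y) => //; split => /=; rewrite in_itv.
Qed.

(** Differentiating the upper integral in [t] under the integral sign and using
    the Cauchy-Riemann equation leaves the integral of a [v]-derivative. *)
Lemma rectangle_cauchy (u w c : R * R -> R) (a b d0 d1 : R) :
  a < b -> d0 < d1 ->
  (forall v t, a <= v <= b -> d0 < t < d1 ->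
     [/\ is_derive v 1 (fun v => u (v, t)) (c (v, t)),
         is_derive t 1 (fun t => w (v, t)) (c (v, t)) &
         {for (v, t), continuous c}]) ->
  (forall v t, a <= v <= b -> d0 < t < d1 -> {for (v, t), continuous w}) ->
  (forall t, d0 < t < d1 -> {for t, continuous (fun t => u (b, t))}) ->
  (forall t, d0 < t < d1 -> {for t, continuous (fun t => u (a, t))}) ->
  forall t0 t1, d0 < t0 -> t0 < t1 -> t1 < d1 ->
  \int[mu]_(v in `[a, b]) w (v, t1) - \int[mu]_(v in `[a, b]) w (v, t0) =
  \int[mu]_(t in `[t0, t1]) (u (b, t) - u (a, t)).
Proof.
move=> ab dd H cw cub cua t0 t1 dt0 t01 t1d.
have slice_cont (f : R * R -> R) v t : {for (v, t), continuous f} ->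
    {for v, continuous (fun v => f (v, t))}.
  move=> cf; apply: (@continuous2_cvg _ _ _ _ (nbhs v) _ id (fun=> t) (fun a b => f (a, b))).
  - by rewrite (_ : (fun z => f (z.1, z.2)) = f)//; apply/funext => -[].
  - exact: cvg_id.
  - exact: cvg_cst.
have FTCv t : d0 < t < d1 ->
    \int[mu]_(v in `[a, b]) c (v, t) = u (b, t) - u (a, t).
  move=> td; apply: (Rintegral_FTC (F := fun v => u (v, t))) => // [v|v]; rewrite in_itv/= => vab.
    by apply: (slice_cont c v t); have [] := H v t vab td.
  by have [] := H v t vab td.
pose G t := \int[mu]_(v in `[a, b]) w (v, t).
rewrite -/(G t1) -/(G t0); apply/esym.
have inner t : t0 <= t <= t1 -> d0 < t < d1.
  by move=> /andP[A B]; rewrite (lt_le_trans dt0 A) (le_lt_trans B t1d).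
apply: (Rintegral_FTC (F := G)) => // t; rewrite in_itv/= => /inner td.
  by apply: (@continuousB _ R^o); [exact: cub|exact: cua].
have [/andP[dt td1]] := (td).
pose l := (d0 + t) / 2; pose r := (t + d1) / 2.
have [lt tr] : l < t /\ t < r by rewrite /l /r; split; lra.
have lr s : l <= s <= r -> d0 < s < d1 by rewrite /l /r; lra.
have lro s : `]l, r[%classic s -> d0 < s < d1.
  by rewrite /= in_itv/= => /andP[A B]; apply: lr; rewrite !ltW.
have [M cM] : exists M, forall x y, a <= x <= b -> l <= y <= r -> `|c (x, y)| <= M.
  by apply: continuous_rectangle_bounded => x y xab /lr ylr; have [] := H x y xab ylr.
have Itr : `]l, r[%classic t by rewrite /= in_itv/= lt tr.
have intw s : `]l, r[%classic s -> mu.-integrable `[a, b] (EFin \o (fun v => w (v, s))).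
  move=> /lro sd; apply: continuous_compact_integrable; first exact: segment_compact.
  apply: continuous_in_subspaceT => v; rewrite inE/= in_itv/= => vab.
  by apply: (slice_cont w v s); exact: cw.
have derw s v : `]l, r[%classic s -> `[a, b]%classic v ->
    derivable (fun s => w (v, s)) s 1.
  by move=> /lro sd; rewrite /= in_itv/= => vab; have [_ [? _] _] := H v s vab sd.
have dE s v : d0 < s < d1 -> a <= v <= b ->
    partial1of2 (fun s v => w (v, s)) s v = c (v, s).
  move=> sd vab; rewrite partial1of2E.
  by have [_ [_ ?] _] := H v s vab sd.
have M0 : 0 <= M.
  apply: le_trans (cM a t _ _) => //; first by rewrite lexx ltW.
  by rewrite !ltW.
have boundw s v : `]l, r[%classic s -> `[a, b]%classic v ->
    `|partial1of2 (fun s v => w (v, s)) s v| <= (fun=> M) v.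
  move=> slr; have sd := lro _ slr; rewrite /= in_itv/= => vab.
  rewrite dE//; apply: cM => //.
  by move: slr; rewrite /= in_itv/= => /andP[A B]; rewrite !ltW.
have intM : mu.-integrable `[a, b] (EFin \o (fun _ : R => M)).
  apply: continuous_compact_integrable; first exact: segment_compact.
  by apply: continuous_subspaceT => x; exact: cvg_cst.
have mab : measurable (`[a, b] : set R) by [].
have derG := @derivable_under_integral R _ (measurableTypeR R) mu (fun s v => w (v, s)) _ mab t l r
  Itr intw derw (fun=> M) (fun=> M0) intM boundw.
have derGE := @differentiation_under_integral R _ (measurableTypeR R) mu (fun s v => w (v, s)) _ mab t l r
  Itr intw derw (fun=> M) (fun=> M0) intM boundw.
apply: DeriveDef; first exact: derG.
rewrite -derive1E; apply: (eq_trans derGE).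
rewrite -FTCv//; apply: eq_Rintegral => v; rewrite inE/= in_itv/= => vab.
by rewrite dE.
Qed.

End rectangle.

Local Open Scope complex_scope.

(** * Laws of products, convolutions and mixtures *)

Section laws.
Context {R : realType}.
Notation PR := (probability (measurableTypeR R) R).
Implicit Types (p q m : PR) (f : R -> R).

Definition same_law p q := forall A, measurable A -> p A = q A.

Lemma same_lawP p q : same_law p q <->
  (forall f, bounded_mfun (f : measurableTypeR R -> R) -> \int[p]_x f x = \int[q]_x f x).
Proof.
split=> [pq f bf|pq A mA]; first exact: eq_measure_Rintegral.
by rewrite -!Rintegral_indic//; congr EFin; apply: pq; exact: bounded_mfun_indic.
Qed.

Lemma same_law_trans p q m : same_law p q -> same_law q m -> same_law p m.
Proof. by move=> pq qm A mA; rewrite pq// qm. Qed.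

Definition mul_pair (z : measurableTypeR R * measurableTypeR R) :
  measurableTypeR R := (z.1 : R) * (z.2 : R).

Lemma measurable_mul_pair : measurable_fun setT mul_pair.
Proof.
by apply: (@measurable_funM _ _ R); [exact: measurable_fst|exact: measurable_snd].
Qed.

HB.instance Definition _ :=
  isMeasurableFun.Build _ _ _ _ mul_pair measurable_mul_pair.

Definition product_law p q : PR := distribution (p \x q)%E mul_pair.

Lemma Rintegral_product_law p q f : bounded_mfun (f : measurableTypeR R -> R) ->
  \int[product_law p q]_x f x = \int[p]_x \int[q]_y f (x * y).
Proof.
move=> bf; rewrite Rintegral_distribution//.
rewrite (Rintegral_prod1 p q (f := fun z => f (z.1 * z.2)))//.
by apply: (bounded_mfun_comp bf); exact: measurable_mul_pair.
Qed.

Lemma Rintegral_convolution p q f : bounded_mfun (f : measurableTypeR R -> R) ->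
  \int[convolution p q]_x f x = \int[p]_x \int[q]_y f (x + y).
Proof.
move=> bf; rewrite Rintegral_distribution//.
rewrite (Rintegral_prod1 p q (f := fun z => f (z.1 + z.2)))//.
by apply: (bounded_mfun_comp bf); exact: measurable_add_pair.
Qed.

Lemma bounded_mfun_scale f (a : R) : bounded_mfun (f : measurableTypeR R -> R) ->
  bounded_mfun (fun y : measurableTypeR R => f (a * y)).
Proof. by move=> bf; apply: (bounded_mfun_comp bf (g := fun y => a * y)); exact: measurable_funM. Qed.

Lemma product_law_ext p q q' : same_law q q' ->
  same_law (product_law p q) (product_law p q').
Proof.
move=> /same_lawP qq'; apply/same_lawP => f bf; rewrite !Rintegral_product_law//.
apply: eq_Rintegral => x _; apply: qq'; exact: bounded_mfun_scale.
Qed.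

Lemma product_lawA p q m :
  same_law (product_law p (product_law q m)) (product_law (product_law p q) m).
Proof.
apply/same_lawP => f bf; rewrite !Rintegral_product_law//.
  apply: eq_Rintegral => x _; rewrite Rintegral_product_law; last exact: bounded_mfun_scale.
  apply: eq_Rintegral => y _; apply: eq_Rintegral => z _; by rewrite mulrA.
have := @bounded_mfun_Rintegral1 _ _ _ _ _ p m (fun z => f (z.1 * z.2)).
by apply; apply: (bounded_mfun_comp bf); exact: measurable_mul_pair.
Qed.

Definition charf p (t : R) : R[i] :=
  (\int[p]_x cos (t * x)) +i* (\int[p]_x sin (t * x)).

Lemma bcos (t : R) : bounded_mfun (fun x : measurableTypeR R => cos (t * x)).
Proof. by apply: (bounded_mfun_cos (f := fun x => t * x)); exact: measurable_funM. Qed.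

Lemma bsin (t : R) : bounded_mfun (fun x : measurableTypeR R => sin (t * x)).
Proof. by apply: (bounded_mfun_sin (f := fun x => t * x)); exact: measurable_funM. Qed.

Lemma same_law_charf p q : same_law p q -> charf p =1 charf q.
Proof.
move=> /same_lawP pq t; rewrite /charf pq ?pq//; [exact: bsin|exact: bcos].
Qed.

Lemma charf_convolution p q t : charf (convolution p q) t = charf p t * charf q t.
Proof.
have bc := bcos t; have bs := bsin t.
rewrite /charf !Rintegral_convolution//; apply/eqP; rewrite eq_complex /=; apply/andP; split; apply/eqP.
- under eq_Rintegral => x _.
    under eq_Rintegral => y _ do rewrite mulrDr cosD.
    rewrite bRintegralB; do ?[exact: bounded_mfunM|exact: bounded_mfun_cst|
      by apply: bounded_mfunM => //; exact: bounded_mfun_cst].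
    rewrite !bRintegralZl//; over.
  rewrite /= bRintegralB; do ?[by apply: bounded_mfunM => //; exact: bounded_mfun_cst].
  by rewrite !bRintegralZr.
- under eq_Rintegral => x _.
    under eq_Rintegral => y _ do rewrite mulrDr sinD.
    rewrite bRintegralD; do ?[by apply: bounded_mfunM => //; exact: bounded_mfun_cst].
    rewrite !bRintegralZl//; over.
  rewrite /= bRintegralD; do ?[by apply: bounded_mfunM => //; exact: bounded_mfun_cst].
  by rewrite !bRintegralZr// addrC.
Qed.

Lemma charf_dirac0 t : charf (\d_(0 : measurableTypeR R)) t = 1.
Proof.
rewrite /charf /Rintegral !integral_dirac//=; do ?by apply/measurable_EFinP; have [] := bcos t; have [] := bsin t.
by rewrite indicT !mul1r !mulr0 cos0 sin0.
Qed.

Lemma charf_convolution_power p n t : charf (convolution_power p n) t = charf p t ^+ n.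
Proof.
elim: n => [|n IH]; first by rewrite expr0 -(charf_dirac0 t).
by rewrite exprS -IH -charf_convolution.
Qed.

Definition std_exponential : PR.
Proof. unshelve refine (exponential_prob (1 : R) : PR); exact: ltr01. Defined.

Definition left_RV (z : measurableTypeR R * measurableTypeR R) : R := z.1.
Definition right_RV (z : measurableTypeR R * measurableTypeR R) : R := z.2.

HB.instance Definition _ :=
  isMeasurableFun.Build _ _ _ _ left_RV (@measurable_fst _ _ _ _).
HB.instance Definition _ :=
  isMeasurableFun.Build _ _ _ _ right_RV (@measurable_snd _ _ _ _).

(** A product of laws is realised on the product space by its two coordinates. *)
Lemma exponential_mixtures_product_law m p :
  same_law m (product_law p std_exponential) -> exponential_mixtures m.
Proof.
move=> mp.
pose P : probability (measurableTypeR R * measurableTypeR R)%type R := (p \x std_exponential)%E.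
have PAB A B : measurable A -> measurable B -> P (A `*` B) = (p A * std_exponential B)%E.
  by move=> mA mB; exact: product_measure1E.
have PX A : measurable A -> P (left_RV @^-1` A) = p A.
  move=> mA; have -> : left_RV @^-1` A = A `*` setT by apply/seteqP; split => -[x y]//= [].
  by rewrite PAB// probability_setT mule1.
have PE B : measurable B -> P (right_RV @^-1` B) = std_exponential B.
  move=> mB; have -> : right_RV @^-1` B = setT `*` B by apply/seteqP; split => -[x y]//= [].
  by rewrite PAB// probability_setT mul1e.
exists _, _, P, left_RV, right_RV; split.
- move=> A B mA mB; rewrite PX// PE//.
  have -> : left_RV @^-1` A `&` right_RV @^-1` B = A `*` B by [].
  by rewrite PAB.
- by move=> B mB; rewrite /pushforward PE.
- by move=> A mA; rewrite mp.
Qed.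

Lemma boolean_stable_mixtures_product_law alpha rho m :
  boolean_stable_mixtures alpha rho m ->
  exists b p, [/\ is_boolean_stable alpha rho b, same_law m (product_law p b) &
    forall f, bounded_mfun (f : measurableTypeR R -> R) ->
      \int[p]_x f x = \int[p]_x f `|x|].
Proof.
move=> [b [bst [d [T [P [X [B [XB X0 lB lXB]]]]]]]].
have mX : measurable_fun setT (X : T -> measurableTypeR R) by exact: (measurable_funPT X).
have mB : measurable_fun setT (B : T -> measurableTypeR R) by exact: (measurable_funPT B).
pose X' : {mfun T >-> measurableTypeR R} := HB.pack (X : T -> measurableTypeR R)
  (isMeasurableFun.Build _ _ _ _ (X : T -> measurableTypeR R) mX).
pose B' : {mfun T >-> measurableTypeR R} := HB.pack (B : T -> measurableTypeR R)
  (isMeasurableFun.Build _ _ _ _ (B : T -> measurableTypeR R) mB).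
pose p : PR := distribution P X'; pose q : PR := distribution P B'.
exists b, p; split => //.
- apply: (@same_law_trans _ (product_law p q)); last exact: product_law_ext.
  move=> A mA; rewrite -lXB//.
  pose J (t : T) : measurableTypeR R * measurableTypeR R := (X t, B t).
  have mJ : measurable_fun setT J by exact: measurable_fun_pair.
  pose J' : {mfun T >-> (measurableTypeR R * measurableTypeR R)%type} :=
    HB.pack J (isMeasurableFun.Build _ _ _ _ J mJ).
  transitivity (distribution P J' (mul_pair @^-1` A)) => //.
  apply/esym; apply: (@product_measure_unique _ _ _ _ _ p q (distribution P J')).
    by move=> A1 A2 mA1 mA2; rewrite -XB.
  by rewrite -[X in measurable X]setTI; exact: measurable_mul_pair.
- move=> f bf; rewrite !Rintegral_distribution//; last first.
    by apply: (bounded_mfun_comp bf); apply: continuous_measurable_fun; exact: norm_continuous.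
  by apply: eq_Rintegral => t _; exact: (congr1 f (esym (ger0_norm (X0 t)))).
Qed.

End laws.

(** * Stieltjes inversion in polar coordinates *)

Section inversion.
Context {R : realType}.
Notation PR := (probability (measurableTypeR R) R).
Notation mu := (@lebesgue_measure R).
Notation Re := complex.Re.
Notation Im := complex.Im.
Implicit Types (m : PR).

Lemma measurable_inv : measurable_fun setT (fun x : R => x^-1).
Proof.
rewrite -(setvU [set 0 : R]); apply/measurable_funU => //.
  exact: measurableC.
split.
  apply: open_continuous_measurable_fun; first exact: closed_openC.
  by move=> x; rewrite inE/= => /eqP x0; exact: inv_continuous.
exact: measurable_fun_set1.
Qed.

Definition polar_den (v w t : R) : R :=
  (expR v - t * cos w) ^+ 2 + (t * sin w) ^+ 2.

Definition polar_kernel (v w t : R) : R := t * expR v * sin w / polar_den v w t.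

Definition polar_stieltjes m v w := \int[m]_t polar_kernel v w t.

Lemma polar_denE v w t :
  polar_den v w t = expR v ^+ 2 - 2 * t * expR v * cos w + t ^+ 2.
Proof.
rewrite /polar_den sqrrB !exprMn; have := cos2Dsin2 w; move: (cos w) (sin w) => c s cs.
have -> : s ^+ 2 = 1 - c ^+ 2 by rewrite -cs; ring.
by ring.
Qed.

Lemma abs_cos_lt1 w : 0 < w < pi -> `|cos w| < 1 :> R.
Proof.
move=> w0; rewrite -(@ltr_sqr _ `|cos w| 1) ?nnegrE ?ler01// expr1n real_normK ?num_real//.
have s0 := sin_gt0_pi w0.
have cs := cos2Dsin2 w; have s2 : 0 < sin w ^+ 2 by rewrite exprn_gt0.
by lra.
Qed.

Lemma polar_den_gt0 v w t : 0 < w < pi -> 0 < polar_den v w t.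
Proof.
move=> w0; have s0 := sin_gt0_pi w0.
have [->|t0] := eqVneq t 0.
  by rewrite /polar_den !mul0r subr0 expr0n/= addr0 exprn_gt0// expR_gt0.
rewrite /polar_den ltr_wpDl ?sqr_ge0//.
by rewrite exprn_even_gt0//= mulf_neq0// gt_eqF.
Qed.

Lemma polar_kernel_bound w : 0 < w < pi ->
  forall v t, `|polar_kernel v w t| <= sin w / (1 - `|cos w|).
Proof.
move=> w0 v t; have s0 := sin_gt0_pi w0; have c1 := abs_cos_lt1 w0.
have d0 := polar_den_gt0 v t w0.
rewrite /polar_kernel normrM normfV (gtr0_norm d0) ler_pdivrMr//.
rewrite normrM (gtr0_norm s0) [X in X <= _]mulrC -mulrA ler_pM2l// mulrC.
rewrite [leRHS]mulrC ler_pdivlMr ?subr_gt0// polar_denE mulrC normrM (gtr0_norm (expR_gt0 v)).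
have x0 := expR_gt0 v; move: (expR v) x0 => x x0.
have tc : t * cos w <= `|t| * `|cos w| by rewrite -normrM ler_norm.
have t2 : t ^+ 2 = `|t| ^+ 2 by rewrite real_normK ?num_real.
have := sqr_ge0 (x - `|t|).
have n0 := normr_ge0 t; have m0 := normr_ge0 (cos w).
rewrite t2; move: `|t| `|cos w| tc n0 m0 c1 => T C tc n0 m0 c1 sq.
have h1 : 0 <= T * x by rewrite mulr_ge0// ltW.
have h2 : x * (t * cos w) <= x * (T * C) by rewrite ler_pM2l.
have h3 : T * x * C <= T * x by rewrite ler_piMr// ltW.
have h4 : 0 <= T * x * C by rewrite mulr_ge0.
nra.
Qed.

Lemma measurable_polar_kernel w d (T : measurableType d) (f g : T -> R) :
  measurable_fun setT f -> measurable_fun setT g ->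
  measurable_fun setT (fun x => polar_kernel (f x) w (g x)).
Proof.
move=> mf mg; have mef : measurable_fun setT (expR \o f) by exact: measurableT_comp.
apply: measurable_funM.
  by apply: measurable_funM => //; exact: measurable_funM.
apply: (measurableT_comp measurable_inv).
apply: measurable_funD; apply: measurable_funX.
  by apply: measurable_funB => //; exact: measurable_funM.
exact: measurable_funM.
Qed.

Lemma bounded_polar_kernel v w : 0 < w < pi ->
  bounded_mfun (polar_kernel v w : measurableTypeR R -> R).
Proof.
move=> w0; split; first exact: measurable_polar_kernel.
by exists (sin w / (1 - `|cos w|)) => t; exact: polar_kernel_bound.
Qed.

Definition cauchy_re (a y x : R) : R := (a - x) / ((a - x) ^+ 2 + y ^+ 2).
Definition cauchy_im (a y x : R) : R := y / ((a - x) ^+ 2 + y ^+ 2).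

Lemma cauchy_den_gt0 a y x : 0 < y -> 0 < (a - x) ^+ 2 + y ^+ 2 :> R.
Proof. by move=> y0; rewrite ltr_wpDl ?sqr_ge0// exprn_gt0. Qed.

Lemma measurable_cauchy_re a y : measurable_fun setT (cauchy_re a y).
Proof.
apply: measurable_funM; first exact: measurable_funB.
apply: (measurableT_comp measurable_inv).
by apply: measurable_funD => //; apply: measurable_funX; exact: measurable_funB.
Qed.

Lemma measurable_cauchy_im a y : measurable_fun setT (cauchy_im a y).
Proof.
apply: measurable_funM; first exact: measurable_cst.
apply: (measurableT_comp measurable_inv).
by apply: measurable_funD => //; apply: measurable_funX; exact: measurable_funB.
Qed.

Lemma bounded_cauchy_re a y : 0 < y ->
  bounded_mfun (cauchy_re a y : measurableTypeR R -> R).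
Proof.
move=> y0; split; first exact: measurable_cauchy_re.
exists y^-1 => x; have d0 := cauchy_den_gt0 a x y0.
rewrite /cauchy_re normrM normfV (gtr0_norm d0) ler_pdivrMr// mulrC ler_pdivlMr//.
have := sqr_ge0 (`|a - x| - y); rewrite sqrrB real_normK ?num_real//.
have := sqr_ge0 (a - x); have := sqr_ge0 y; nra.
Qed.

Lemma bounded_cauchy_im a y : 0 < y ->
  bounded_mfun (cauchy_im a y : measurableTypeR R -> R).
Proof.
move=> y0; split; first exact: measurable_cauchy_im.
exists y^-1 => x; have d0 := cauchy_den_gt0 a x y0.
rewrite /cauchy_im normrM normfV (gtr0_norm d0) ler_pdivrMr// mulrC ler_pdivlMr//.
by rewrite gtr0_norm//; have := sqr_ge0 (a - x); rewrite expr2; nra.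
Qed.

Lemma cauchy_transformE m a y : 0 < y ->
  cauchy_transform m (a +i* y) =
  (\int[m]_x cauchy_re a y x) +i* (- \int[m]_x cauchy_im a y x).
Proof.
move=> y0; rewrite /cauchy_transform /Cintegral -bRintegralN; last exact: bounded_cauchy_im.
have E (x : R) : (a +i* y - x%:C)^-1 = cauchy_re a y x +i* (- cauchy_im a y x).
  rewrite /GRing.inv/= subr0 /cauchy_re /cauchy_im; apply/eqP.
  by rewrite eq_complex/= !eqxx.
by congr (_ +i* _); apply: eq_Rintegral => x _; rewrite E.
Qed.

Lemma polar_kernelE v w x :
  polar_kernel v w x = expR v * cos w * cauchy_im (expR v * cos w) (expR v * sin w) x
                     - expR v * sin w * cauchy_re (expR v * cos w) (expR v * sin w) x.
Proof.
rewrite /cauchy_im /cauchy_re /polar_kernel.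
have -> : (expR v * cos w - x) ^+ 2 + (expR v * sin w) ^+ 2 = polar_den v w x.
  rewrite polar_denE; have cs := cos2Dsin2 w; move: (cos w) (sin w) cs => c s cs.
  transitivity (expR v ^+ 2 * (c ^+ 2 + s ^+ 2) - 2 * x * expR v * c + x ^+ 2); first by ring.
  by rewrite cs mulr1.
by move: (polar_den v w x)^-1 => d; ring.
Qed.

Definition polar (v w : R) : R[i] := (expR v * cos w) +i* (expR v * sin w).

Lemma polar_stieltjesE m v w : 0 < w < pi ->
  polar_stieltjes m v w = - Im (polar v w * cauchy_transform m (polar v w)).
Proof.
move=> w0; have y0 : 0 < expR v * sin w by rewrite mulr_gt0 ?expR_gt0// sin_gt0_pi.
rewrite cauchy_transformE//= /polar_stieltjes.
under eq_Rintegral do rewrite polar_kernelE.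
rewrite bRintegralB; do ?[by apply: bounded_mfunM; [exact: bounded_mfun_cst|
  first [exact: bounded_cauchy_re|exact: bounded_cauchy_im]]].
rewrite (bRintegralZl m _ (bounded_cauchy_im _ y0)).
rewrite (bRintegralZl m _ (bounded_cauchy_re _ y0)).
by ring.
Qed.

Lemma continuous_polar_kernel w t : 0 < w < pi ->
  continuous (fun v => polar_kernel v w t).
Proof.
move=> w0 v; have d0 := polar_den_gt0 v t w0.
apply: (@continuousM _ _ (fun v => t * expR v * sin w)).
  apply: (@continuousM _ _ (fun v => t * expR v)); last exact: cvg_cst.
  by apply: continuousM; [exact: cvg_cst|exact: continuous_expR].
apply: (@continuousV _ _ (fun v => polar_den v w t)); first by rewrite gt_eqF.
apply: (@continuousD _ R^o); last exact: cvg_cst.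
apply: (@continuous_comp _ _ _ (fun v => expR v - t * cos w) (fun x => x ^+ 2)).
  by apply: (@continuousB _ R^o); [exact: continuous_expR|exact: cvg_cst].
exact: exprn_continuous.
Qed.

Definition polar_primitive (v w t : R) := atan ((expR v - t * cos w) / (t * sin w)).

Lemma Rintegral_polar_kernel v1 v2 w t : v1 < v2 -> 0 < w < pi -> t != 0 ->
  \int[mu]_(v in `[v1, v2]) polar_kernel v w t =
  polar_primitive v2 w t - polar_primitive v1 w t.
Proof.
move=> v12 w0 t0; have s0 := sin_gt0_pi w0.
apply: (Rintegral_FTC (F := fun v => polar_primitive v w t)) => //.
  by move=> v _; exact: continuous_polar_kernel.
move=> v _; have d0 := polar_den_gt0 v t w0.
have ts0 : t * sin w != 0 by rewrite mulf_neq0// gt_eqF.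
rewrite /polar_primitive; diff; rewrite /polar_kernel; move: d0; rewrite /polar_den.
have -> : t * expR v * sin w = expR v * (t * sin w) by ring.
move: (t * sin w) ts0 (expR v - t * cos w) => u u0 r d0.
by field; rewrite u0/= !gt_eqF//; lra.
Qed.

Lemma atan_quotient_cvgy (num den : nat -> R) L :
  num n @[n --> \oo] --> L -> 0 < L -> (forall n, 0 < den n) ->
  den n @[n --> \oo] --> 0 -> atan (num n / den n) @[n --> \oo] --> pi / 2.
Proof.
move=> numL L0 d0 den0.
have q : num n / den n @[n --> \oo] --> +oo.
  apply/cvgryPge => A.
  have c : num n - A * den n @[n --> \oo] --> L.
    rewrite -[L]subr0 -[X in _ - X](mulr0 A); apply: cvgB => //.
    by apply: cvgMr.
  near=> n; rewrite ler_pdivlMr// -subr_ge0 ltW//; near: n; exact: (cvgr_gt L c).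
exact: (cvg_comp _ _ q (@cvgy_atan R)).
Unshelve. all: by end_near. Qed.

Definition small_angle (n : nat) : R := n.+1%:R^-1.

Lemma small_angle_bound n : 0 < small_angle n < pi.
Proof.
rewrite /small_angle invr_gt0 ltr0Sn/=.
apply: (@le_lt_trans _ _ 1); last by apply: lt_le_trans (@pi_ge2 R); rewrite ltr1n.
by rewrite invf_le1// ler1n.
Qed.

Lemma small_angle_cvg : small_angle n @[n --> \oo] --> (0 : R).
Proof. exact: cvg_harmonic. Qed.

Lemma small_angle_cos : cos (small_angle n) @[n --> \oo] --> (1 : R).
Proof.
have c := cvg_comp _ _ small_angle_cvg (@continuous_cos R 0).
by rewrite cos0 in c; exact: c.
Qed.

Lemma small_angle_sin : sin (small_angle n) @[n --> \oo] --> (0 : R).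
Proof.
have c := cvg_comp _ _ small_angle_cvg (@continuous_sin R 0).
by rewrite sin0 in c; exact: c.
Qed.

Let num_cvg v t : expR v - t * cos (small_angle n) @[n --> \oo] --> expR v - t.
Proof.
apply: cvgB; first exact: cvg_cst.
by rewrite -[X in _ --> X]mulr1; apply: cvgMl_tmp; exact: small_angle_cos.
Qed.

Let den_cvg t : t * sin (small_angle n) @[n --> \oo] --> (0 : R).
Proof. by rewrite -[X in _ --> X](mulr0 t); apply: cvgMl_tmp; exact: small_angle_sin. Qed.

Lemma cvg_polar_primitive_gt0 v t : 0 < t ->
  polar_primitive v (small_angle n) t @[n --> \oo] --> pi / 2 * Num.sg (expR v - t).
Proof.
move=> t0; have d0 n : 0 < t * sin (small_angle n).
  by rewrite mulr_gt0// sin_gt0_pi// small_angle_bound.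
have [vt|vt|vt] := ltrgtP (expR v) t.
- have vt0 : 0 < - (expR v - t) by lra.
  rewrite ltr0_sg ?subr_lt0// mulrN1.
  have h : atan (- (expR v - t * cos (small_angle n)) / (t * sin (small_angle n)))
      @[n --> \oo] --> pi / 2.
    by apply: atan_quotient_cvgy vt0 d0 (den_cvg t); apply: cvgN; exact: num_cvg.
  apply: cvg_ext (cvgN h) => n.
  by rewrite /polar_primitive mulNr atanN opprK.
- rewrite gtr0_sg ?subr_gt0// mulr1.
  have vt0 : 0 < expR v - t by rewrite subr_gt0.
  have h := atan_quotient_cvgy (@num_cvg v t) vt0 d0 (den_cvg t).
  exact: (cvg_ext _ h).
- rewrite /polar_primitive vt subrr sgr0 mulr0 -atan0.
  have e n : (t - t * cos (small_angle n)) / (t * sin (small_angle n)) =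
      sin (small_angle n) / (1 + cos (small_angle n)).
    have sn0 := sin_gt0_pi (small_angle_bound n).
    have := abs_cos_lt1 (small_angle_bound n); rewrite ltr_norml => /andP[c1 _].
    have := cos2Dsin2 (small_angle n).
    move: (cos _) (sin _) c1 sn0 => c s c1 sn0 cs.
    have c10 : 0 < 1 + c by lra.
    have ss : s * s = (1 - c) * (1 + c).
      by transitivity (c ^+ 2 + s ^+ 2 - c ^+ 2); [ring|rewrite cs; ring].
    have -> : t - t * c = t * (1 - c) by ring.
    rewrite -mulf_div divff ?gt_eqF// mul1r.
    have s0 : s != 0 by rewrite gt_eqF.
    have c0 : 1 + c != 0 by rewrite gt_eqF.
    by apply/eqP; rewrite eqr_div// ss.
  under eq_fun do rewrite e.
  have : sin (small_angle n) / (1 + cos (small_angle n)) @[n --> \oo] --> 0.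
    rewrite -[X in _ --> X](mul0r (1 + 1)^-1); apply: cvgM; first exact: small_angle_sin.
    apply: cvgV; first by rewrite gt_eqF.
    by apply: cvgD; [exact: cvg_cst|exact: small_angle_cos].
  by move=> c; exact: (cvg_comp _ _ c (@continuous_atan R 0)).
Qed.

Lemma cvg_polar_primitive_lt0 v t : t < 0 ->
  polar_primitive v (small_angle n) t @[n --> \oo] --> - (pi / 2).
Proof.
move=> t0; have d0 n : 0 < - (t * sin (small_angle n)).
  by rewrite -mulNr mulr_gt0// ?oppr_gt0// sin_gt0_pi// small_angle_bound.
have vt0 : 0 < expR v - t by have := expR_gt0 v; lra.
have dc : - (t * sin (small_angle n)) @[n --> \oo] --> (0 : R).
  by rewrite -[X in _ --> X]oppr0; apply: cvgN; exact: den_cvg.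
have h := atan_quotient_cvgy (@num_cvg v t) vt0 d0 dc.
apply: cvg_ext (cvgN h) => n.
by rewrite /polar_primitive invrN mulrN atanN opprK.
Qed.

(** Half of the open interval and half of the closed one: the limit of the
    harmonic measures of an interval. *)
Definition window (a c t : R) : R := (\1_(`]a, c[) t + \1_(`[a, c]) t) / 2.

Lemma bounded_window a c : bounded_mfun (window a c : measurableTypeR R -> R).
Proof.
apply: bounded_mfunM; last exact: bounded_mfun_cst.
by apply: bounded_mfunD; apply: bounded_mfun_indic.
Qed.

Lemma window_sg a c t : a < c -> window a c t = (Num.sg (c - t) - Num.sg (a - t)) / 2.
Proof.
move=> ac; rewrite /window !indicE !mem_setE !in_itv/=.
have sgB x : Num.sg (x - t) = if t < x then 1 else if x < t then -1 else 0.
  case: (ltgtP t x) => h; first by rewrite gtr0_sg ?subr_gt0.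
    by rewrite ltr0_sg ?subr_lt0.
  by rewrite h subrr sgr0.
rewrite !sgB; have [ta|ta|ta] := ltgtP a t; have [tc|tc|tc] := ltgtP t c => /=; lra.
Qed.

Theorem polar_inversion m v1 v2 : v1 < v2 ->
  \int[mu]_(v in `[v1, v2]) polar_stieltjes m v (small_angle n) @[n --> \oo]
    --> pi * \int[m]_t window (expR v1) (expR v2) t.
Proof.
move=> v12; rewrite -bRintegralZl; last exact: bounded_window.
have bk n : bounded_mfun ((fun z => polar_kernel z.2 (small_angle n) z.1)
    : measurableTypeR R * measurableTypeR R -> R).
  split; first exact: measurable_polar_kernel.
  exists (sin (small_angle n) / (1 - `|cos (small_angle n)|)) => z.
  exact: polar_kernel_bound (small_angle_bound n) _ _.
pose Th n t := \int[mu]_(v in `[v1, v2]) polar_kernel v (small_angle n) t.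
have ThE n t : Th n t = if t == 0 then 0 else
    polar_primitive v2 (small_angle n) t - polar_primitive v1 (small_angle n) t.
  case: eqP => [->|/eqP t0].
    rewrite /Th; under eq_Rintegral do rewrite /polar_kernel !mul0r.
    by rewrite Rintegral_cst// mul0r.
  exact: Rintegral_polar_kernel (small_angle_bound n) t0.
have swap n : \int[mu]_(v in `[v1, v2]) polar_stieltjes m v (small_angle n) =
    \int[m]_t Th n t.
  by rewrite /Th (Rintegral_itv_swap m v1 v2 (bk n)).
under eq_fun do rewrite swap.
have ac : expR v1 < expR v2 by rewrite ltr_expR.
apply: (@bounded_cvg_Rintegral _ _ _ m Th _ pi).
- by move=> n; case: (bounded_mfun_Rintegral_itv m v1 v2 (bk n)).
- by apply: measurable_funM => //; case: (bounded_window (expR v1) (expR v2)).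
- move=> n t; rewrite ThE; case: eqP => _; first by rewrite normr0 pi_ge0.
  rewrite ler_norml /polar_primitive.
  have := atan_gtNpi2 ((expR v1 - t * cos (small_angle n)) / (t * sin (small_angle n))).
  have := atan_ltpi2 ((expR v1 - t * cos (small_angle n)) / (t * sin (small_angle n))).
  have := atan_gtNpi2 ((expR v2 - t * cos (small_angle n)) / (t * sin (small_angle n))).
  have := atan_ltpi2 ((expR v2 - t * cos (small_angle n)) / (t * sin (small_angle n))).
  by move: (atan _) (atan _) => p q h1 h2 h3 h4; apply/andP; split; lra.
- move=> t; have [t0|t0|t0] := ltgtP t 0.
  + have -> : pi * window (expR v1) (expR v2) t = - (pi / 2) - - (pi / 2).
      rewrite window_sg// !gtr0_sg ?subrr ?mul0r ?mulr0// subr_gt0;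
        exact: lt_trans t0 (expR_gt0 _).
    have h : polar_primitive v2 (small_angle n) t - polar_primitive v1 (small_angle n) t
        @[n --> \oo] --> - (pi / 2) - - (pi / 2).
      by apply: cvgB; exact: cvg_polar_primitive_lt0.
    apply: (cvg_ext _ h) => n.
    by rewrite ThE lt_eqF.
  + have -> : pi * window (expR v1) (expR v2) t =
        pi / 2 * Num.sg (expR v2 - t) - pi / 2 * Num.sg (expR v1 - t).
      by rewrite window_sg//; field.
    have h : polar_primitive v2 (small_angle n) t - polar_primitive v1 (small_angle n) t
        @[n --> \oo] --> pi / 2 * Num.sg (expR v2 - t) - pi / 2 * Num.sg (expR v1 - t).
      by apply: cvgB; exact: cvg_polar_primitive_gt0.
    apply: (cvg_ext _ h) => n.
    by rewrite ThE gt_eqF.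
  + rewrite window_sg// t0 !subr0 !gtr0_sg ?expR_gt0// subrr mul0r mulr0.
    have -> : Th ^~ 0 = (fun=> 0) by apply/funext => n; rewrite ThE eqxx.
    exact: cvg_cst.
Qed.

End inversion.

(** * Holomorphic functions *)

Section holomorphic.
Context {R : realType}.
Notation mu := (@lebesgue_measure R).
Notation Re := complex.Re.
Notation Im := complex.Im.
Implicit Types (F G : R * R -> R[i]) (p : R * R).

Lemma Re_mul (x y : R[i]) : Re (x * y) = Re x * Re y - Im x * Im y.
Proof. by case: x y => [a b] [c d]. Qed.
Lemma Im_mul (x y : R[i]) : Im (x * y) = Re x * Im y + Im x * Re y.
Proof. by case: x y => [a b] [c d]. Qed.
Lemma Re_add (x y : R[i]) : Re (x + y) = Re x + Re y.
Proof. by case: x y => [a b] [c d]. Qed.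
Lemma Im_add (x y : R[i]) : Im (x + y) = Im x + Im y.
Proof. by case: x y => [a b] [c d]. Qed.
Lemma Re_opp (x : R[i]) : Re (- x) = - Re x. Proof. by case: x. Qed.
Lemma Im_opp (x : R[i]) : Im (- x) = - Im x. Proof. by case: x. Qed.
Lemma Re_inv (x : R[i]) : Re (x^-1) = Re x / (Re x ^+ 2 + Im x ^+ 2).
Proof. by case: x. Qed.
Lemma Im_inv (x : R[i]) : Im (x^-1) = - Im x / (Re x ^+ 2 + Im x ^+ 2).
Proof. by case: x => a b; rewrite /GRing.inv/= mulNr. Qed.
Lemma Re_Cexp (x : R[i]) : Re (Cexp x) = expR (Re x) * cos (Im x).
Proof. by case: x => a b; rewrite /Cexp Re_mul/= mul0r subr0. Qed.
Lemma Im_Cexp (x : R[i]) : Im (Cexp x) = expR (Re x) * sin (Im x).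
Proof. by case: x => a b; rewrite /Cexp Im_mul/= mul0r addr0. Qed.

Lemma sqr_norm_neq0 (x : R[i]) : x != 0 -> 0 < Re x ^+ 2 + Im x ^+ 2.
Proof.
case: x => a b; rewrite eq_complex/= negb_and => /orP[a0|b0].
  by rewrite ltr_pwDl ?sqr_ge0// exprn_even_gt0.
by rewrite ltr_wpDl ?sqr_ge0// exprn_even_gt0.
Qed.

Definition ccontinuous F p :=
  Re (F q) @[q --> p] --> Re (F p) /\ Im (F q) @[q --> p] --> Im (F p).

(** [F' p] is the complex derivative of [F] at the point [p.1 + i p.2]; the
    Cauchy-Riemann equations are built in. *)
Definition holomorphic_at F F' p : Prop :=
  [/\ is_derive p.1 1 (fun v => Re (F (v, p.2))) (Re (F' p)),
      is_derive p.1 1 (fun v => Im (F (v, p.2))) (Im (F' p)),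
      is_derive p.2 1 (fun t => Re (F (p.1, t))) (- Im (F' p)),
      is_derive p.2 1 (fun t => Im (F (p.1, t))) (Re (F' p)) &
      ccontinuous F p /\ ccontinuous F' p].

Lemma ccontinuous_cst c p : ccontinuous (fun=> c) p.
Proof. by split; exact: cvg_cst. Qed.

Lemma ccontinuousD F G p : ccontinuous F p -> ccontinuous G p ->
  ccontinuous (fun q => F q + G q) p.
Proof.
move=> [F1 F2] [G1 G2]; split.
  by under eq_fun do rewrite Re_add; rewrite Re_add; exact: cvgD.
by under eq_fun do rewrite Im_add; rewrite Im_add; exact: cvgD.
Qed.

Lemma ccontinuousN F p : ccontinuous F p -> ccontinuous (fun q => - F q) p.
Proof.
move=> [F1 F2]; split.
  by under eq_fun do rewrite Re_opp; rewrite Re_opp; exact: cvgN.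
by under eq_fun do rewrite Im_opp; rewrite Im_opp; exact: cvgN.
Qed.

Lemma ccontinuousM F G p : ccontinuous F p -> ccontinuous G p ->
  ccontinuous (fun q => F q * G q) p.
Proof.
move=> [F1 F2] [G1 G2]; split.
  by under eq_fun do rewrite Re_mul; rewrite Re_mul; apply: cvgB; exact: cvgM.
by under eq_fun do rewrite Im_mul; rewrite Im_mul; apply: cvgD; exact: cvgM.
Qed.

Lemma ccontinuousV F p : F p != 0 -> ccontinuous F p ->
  ccontinuous (fun q => (F q)^-1) p.
Proof.
move=> /sqr_norm_neq0 F0 [F1 F2].
have cden : (Re (F q) ^+ 2 + Im (F q) ^+ 2)^-1 @[q --> p] -->
    (Re (F p) ^+ 2 + Im (F p) ^+ 2)^-1.
  apply: cvgV; first by rewrite gt_eqF.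
  by apply: cvgD; exact: cvgM.
split.
  by under eq_fun do rewrite Re_inv; rewrite Re_inv; exact: cvgM.
by under eq_fun do rewrite Im_inv; rewrite Im_inv; apply: cvgM => //; exact: cvgN.
Qed.

Lemma ccontinuous_Cexp F p : ccontinuous F p -> ccontinuous (fun q => Cexp (F q)) p.
Proof.
move=> [F1 F2]; split.
  under eq_fun do rewrite Re_Cexp; rewrite Re_Cexp; apply: cvgM.
    exact: (cvg_comp _ _ F1 (@continuous_expR R _)).
  exact: (cvg_comp _ _ F2 (@continuous_cos R _)).
under eq_fun do rewrite Im_Cexp; rewrite Im_Cexp; apply: cvgM.
  exact: (cvg_comp _ _ F1 (@continuous_expR R _)).
exact: (cvg_comp _ _ F2 (@continuous_sin R _)).
Qed.

Lemma holomorphic_cst c p : holomorphic_at (fun=> c) (fun=> 0) p.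
Proof.
have D0 (x a : R) : is_derive x 1 (fun _ : R => a) (- 0 : R).
  by rewrite oppr0; exact: has_derive_cst.
split.
- exact: (has_derive_cst p.1 (Re c)).
- exact: (has_derive_cst p.1 (Im c)).
- exact: (D0 p.2 (Re c)).
- exact: (has_derive_cst p.2 (Im c)).
- by split; exact: ccontinuous_cst.
Qed.

Lemma holomorphic_linear (a : R) p :
  holomorphic_at (fun q => (a * q.1) +i* (a * q.2)) (fun=> a%:C) p.
Proof.
split => /=.
- by diff; rewrite mulr0 addr0 mulr1.
- by rewrite /=; exact: has_derive_cst.
- by rewrite oppr0; exact: has_derive_cst.
- by diff; rewrite mulr0 addr0 mulr1.
- split; last exact: ccontinuous_cst.
  split=> /=; apply: continuousM; do ?exact: cvg_cst; [exact: cvg_fst|exact: cvg_snd].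
Qed.

Lemma holomorphicD F F' G G' p : holomorphic_at F F' p -> holomorphic_at G G' p ->
  holomorphic_at (fun q => F q + G q) (fun q => F' q + G' q) p.
Proof.
move=> [F1 F2 F3 F4 [F5 F6]] [G1 G2 G3 G4 [G5 G6]]; split.
- under eq_fun do rewrite Re_add; rewrite Re_add; exact: has_derive_add.
- under eq_fun do rewrite Im_add; rewrite Im_add; exact: has_derive_add.
- under eq_fun do rewrite Re_add; rewrite Im_add opprD; exact: has_derive_add.
- under eq_fun do rewrite Im_add; rewrite Re_add; exact: has_derive_add.
- by split; exact: ccontinuousD.
Qed.

Lemma holomorphicM F F' G G' p : holomorphic_at F F' p -> holomorphic_at G G' p ->
  holomorphic_at (fun q => F q * G q) (fun q => F' q * G q + F q * G' q) p.
Proof.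
move=> [F1 F2 F3 F4 [F5 F6]] [G1 G2 G3 G4 [G5 G6]].
have E : (p.1, p.2) = p by case: p {F1 F2 F3 F4 F5 F6 G1 G2 G3 G4 G5 G6}.
split.
- under eq_fun do rewrite Re_mul; eapply has_derive_eq.
    by eapply has_derive_add; [|eapply has_derive_opp]; eapply has_derive_mul; eassumption.
  by rewrite /= E Re_add !Re_mul; ring.
- under eq_fun do rewrite Im_mul; eapply has_derive_eq.
    by eapply has_derive_add; eapply has_derive_mul; eassumption.
  by rewrite /= E Im_add !Im_mul; ring.
- under eq_fun do rewrite Re_mul; eapply has_derive_eq.
    by eapply has_derive_add; [|eapply has_derive_opp]; eapply has_derive_mul; eassumption.
  by rewrite /= E Im_add !Im_mul; ring.
- under eq_fun do rewrite Im_mul; eapply has_derive_eq.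
    by eapply has_derive_add; eapply has_derive_mul; eassumption.
  by rewrite /= E Re_add !Re_mul; ring.
- by split; [exact: ccontinuousM|apply: ccontinuousD; exact: ccontinuousM].
Qed.

Lemma holomorphicV F F' p : F p != 0 -> holomorphic_at F F' p ->
  holomorphic_at (fun q => (F q)^-1) (fun q => - (F' q * (F q)^-1 * (F q)^-1)) p.
Proof.
move=> Fp0 [F1 F2 F3 F4 [F5 F6]]; have n0 := sqr_norm_neq0 Fp0.
have E : (p.1, p.2) = p by case: p {Fp0 n0 F1 F2 F3 F4 F5 F6}.
have dsq (f : R -> R) (x a : R) : is_derive x 1 f a -> is_derive x 1 (fun y : R => f y ^+ 2) (2 * f x * a).
  move=> df; under eq_fun do rewrite expr2.
  by eapply has_derive_eq; [eapply has_derive_mul; eassumption|ring].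
split.
- under eq_fun do rewrite Re_inv; eapply has_derive_eq.
    eapply has_derive_mul; first eassumption.
    eapply has_derive_inv; first by rewrite /= E gt_eqF.
    by eapply has_derive_add; eapply dsq; eassumption.
  by rewrite /= E Re_opp !(Re_mul, Im_mul) !(Re_inv, Im_inv); field; rewrite gt_eqF.
- under eq_fun do rewrite Im_inv; eapply has_derive_eq.
    eapply has_derive_mul; first by eapply has_derive_opp; eassumption.
    eapply has_derive_inv; first by rewrite /= E gt_eqF.
    by eapply has_derive_add; eapply dsq; eassumption.
  by rewrite /= E Im_opp !(Re_mul, Im_mul) !(Re_inv, Im_inv); field; rewrite gt_eqF.
- under eq_fun do rewrite Re_inv; eapply has_derive_eq.
    eapply has_derive_mul; first eassumption.
    eapply has_derive_inv; first by rewrite /= E gt_eqF.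
    by eapply has_derive_add; eapply dsq; eassumption.
  by rewrite /= E Im_opp !(Re_mul, Im_mul) !(Re_inv, Im_inv); field; rewrite gt_eqF.
- under eq_fun do rewrite Im_inv; eapply has_derive_eq.
    eapply has_derive_mul; first by eapply has_derive_opp; eassumption.
    eapply has_derive_inv; first by rewrite /= E gt_eqF.
    by eapply has_derive_add; eapply dsq; eassumption.
  by rewrite /= E Re_opp !(Re_mul, Im_mul) !(Re_inv, Im_inv); field; rewrite gt_eqF.
- split; first exact: ccontinuousV.
  apply: ccontinuousN; apply: ccontinuousM; last exact: ccontinuousV.
  by apply: ccontinuousM => //; exact: ccontinuousV.
Qed.

Lemma holomorphic_Cexp F F' p : holomorphic_at F F' p ->
  holomorphic_at (fun q => Cexp (F q)) (fun q => F' q * Cexp (F q)) p.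
Proof.
move=> [F1 F2 F3 F4 [F5 F6]].
have E : (p.1, p.2) = p by case: p {F1 F2 F3 F4 F5 F6}.
split.
- under eq_fun do rewrite Re_Cexp; eapply has_derive_eq.
    by eapply has_derive_mul; [eapply has_derive_expR|eapply has_derive_cos]; eassumption.
  by rewrite /= E Re_mul Re_Cexp Im_Cexp; ring.
- under eq_fun do rewrite Im_Cexp; eapply has_derive_eq.
    by eapply has_derive_mul; [eapply has_derive_expR|eapply has_derive_sin]; eassumption.
  by rewrite /= E Im_mul Re_Cexp Im_Cexp; ring.
- under eq_fun do rewrite Re_Cexp; eapply has_derive_eq.
    by eapply has_derive_mul; [eapply has_derive_expR|eapply has_derive_cos]; eassumption.
  by rewrite /= E Im_mul Re_Cexp Im_Cexp; ring.
- under eq_fun do rewrite Im_Cexp; eapply has_derive_eq.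
    by eapply has_derive_mul; [eapply has_derive_expR|eapply has_derive_sin]; eassumption.
  by rewrite /= E Re_mul Re_Cexp Im_Cexp; ring.
- split; first exact: ccontinuous_Cexp.
  by apply: ccontinuousM => //; exact: ccontinuous_Cexp.
Qed.

(** Cauchy's theorem on a rectangle, in imaginary part. *)
Lemma cauchy_Im F F' a b d0 d1 t0 t1 : a < b -> d0 < t0 -> t0 < t1 -> t1 < d1 ->
  (forall v t, a <= v <= b -> d0 < t < d1 -> holomorphic_at F F' (v, t)) ->
  \int[mu]_(v in `[a, b]) Im (F (v, t1)) - \int[mu]_(v in `[a, b]) Im (F (v, t0)) =
  \int[mu]_(t in `[t0, t1]) (Re (F (b, t)) - Re (F (a, t))).
Proof.
move=> ab dt0 t01 t1d H.
have dd : d0 < d1 by lra.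
apply: (@rectangle_cauchy _ (fun q => Re (F q)) (fun q => Im (F q))
  (fun q => Re (F' q)) a b d0 d1) => // [v t vab td|v t vab td|t td|t td].
- by have [? ? ? ? [? []]] := H v t vab td.
- by have [? ? ? ? [[]]] := H v t vab td.
- have bab : a <= b <= b by rewrite lexx ltW.
  by have [_ _ dF _ _] := H b t bab td; exact: has_derive_continuous dF.
- have aab : a <= a <= b by rewrite lexx ltW.
  by have [_ _ dF _ _] := H a t aab td; exact: has_derive_continuous dF.
Qed.

End holomorphic.

(** * Uniqueness of the Cauchy transform *)

Section uniqueness.
Context {R : realType}.
Notation PR := (probability (measurableTypeR R) R).
Notation mu := (@lebesgue_measure R).
Implicit Types (m : PR).

Definition neg_fun (x : measurableTypeR R) : measurableTypeR R := - (x : R).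

Lemma measurable_neg_fun : measurable_fun setT neg_fun.
Proof. exact: (@oppr_measurable R setT). Qed.

HB.instance Definition _ :=
  isMeasurableFun.Build _ _ _ _ neg_fun measurable_neg_fun.

Definition reflection m : PR := distribution m neg_fun.

Lemma Rintegral_reflection m (f : R -> R) : bounded_mfun (f : measurableTypeR R -> R) ->
  \int[reflection m]_x f x = \int[m]_x f (- x).
Proof. by move=> bf; rewrite Rintegral_distribution. Qed.

Lemma cvg_window_in (a c : nat -> R) t : (\forall n \near \oo, a n < t < c n) ->
  window (a n) (c n) t @[n --> \oo] --> (1 : R).
Proof.
move=> H; apply: cvg_near_cst; near=> n.
have /andP[an cn] : a n < t < c n by near: n.
by rewrite /window !indicE !mem_setE !in_itv/= an cn !ltW//=; field.
Unshelve. all: by end_near. Qed.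

Lemma cvg_window_out (a c : nat -> R) t : (\forall n \near \oo, t < a n \/ c n < t) ->
  window (a n) (c n) t @[n --> \oo] --> (0 : R).
Proof.
move=> H; apply: cvg_near_cst; near=> n.
have [an|cn] : t < a n \/ c n < t by near: n.
  rewrite /window !indicE !mem_setE !in_itv/=.
  by rewrite [_ <= t]leNgt [_ < t]ltNge an (ltW an)/= addr0 mul0r.
rewrite /window !indicE !mem_setE !in_itv/=.
by rewrite [t <= _]leNgt [t < _]ltNge cn (ltW cn)/= !andbF addr0 mul0r.
Unshelve. all: by end_near. Qed.

Lemma window_le1 a c t : `|window a c t| <= 1 :> R.
Proof.
rewrite /window !indicE; do 2 case: (_ \in _); rewrite ger0_norm//=; lra.
Qed.

Lemma cvg_window m (a c : nat -> R) (S : set R) : measurable (S : set (measurableTypeR R)) ->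
  (forall t, S t -> \forall n \near \oo, a n < t < c n) ->
  (forall t, ~ S t -> \forall n \near \oo, t < a n \/ c n < t) ->
  \int[m]_t window (a n) (c n) t @[n --> \oo] --> \int[m]_t \1_S t.
Proof.
move=> mS Sin Sout; apply: (bounded_cvg_Rintegral (M := 1)).
- by move=> n; case: (bounded_window (a n) (c n)).
- exact: measurable_indic.
- by move=> n t; exact: window_le1.
- move=> t; have [St|St] := pselect (S t).
    by rewrite indicE mem_set//; apply: cvg_window_in; exact: Sin.
  by rewrite indicE memNset//; apply: cvg_window_out; exact: Sout.
Qed.

Definition same_windows m1 m2 := forall v1 v2, v1 < v2 ->
  \int[m1]_t window (expR v1) (expR v2) t = \int[m2]_t window (expR v1) (expR v2) t.

Lemma same_windows_limit m1 m2 (v1 v2 : nat -> R) (S : set R) :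
  same_windows m1 m2 -> (forall n, v1 n < v2 n) ->
  measurable (S : set (measurableTypeR R)) ->
  (forall t, S t -> \forall n \near \oo, expR (v1 n) < t < expR (v2 n)) ->
  (forall t, ~ S t -> \forall n \near \oo, t < expR (v1 n) \/ expR (v2 n) < t) ->
  m1 S = m2 S.
Proof.
move=> m12 v12 mS Sin Sout; rewrite -!Rintegral_indic//; congr EFin.
have c1 := @cvg_window m1 _ _ S mS Sin Sout; have c2 := @cvg_window m2 _ _ S mS Sin Sout.
have E n : \int[m1]_t window (expR (v1 n)) (expR (v2 n)) t =
           \int[m2]_t window (expR (v1 n)) (expR (v2 n)) t by exact: m12.
exact: (cvg_unique _ (cvg_ext E c1) c2).
Qed.

Let expR_linear_cvgy (u : R) t : \forall n \near \oo, t < expR (u + n.+2%:R).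
Proof.
near=> n; apply: (@lt_le_trans _ _ (1 + (u + n.+2%:R))); last exact: expR_ge1Dx.
rewrite -ltrBlDl -ltrBlDl; apply: (@lt_trans _ _ n%:R); last by rewrite ltr_nat.
by near: n; exact: nbhs_infty_gtr.
Unshelve. all: by end_near. Qed.

Let expR_harmonic (u s : R) : expR (u + s * n.+1%:R^-1) @[n --> \oo] --> expR u.
Proof.
have h : u + s * n.+1%:R^-1 @[n --> \oo] --> u.
  rewrite -[X in _ --> X]addr0 -[X in _ --> _ + X](mulr0 s).
  by apply: cvgD; [exact: cvg_cst|apply: cvgMl_tmp; exact: cvg_harmonic].
exact: (cvg_comp _ _ h (@continuous_expR R u)).
Qed.

Lemma same_windows_gt m1 m2 r : same_windows m1 m2 -> 0 <= r ->
  m1 `]r, +oo[%classic = m2 `]r, +oo[%classic.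
Proof.
move=> m12; rewrite le_eqVlt => /orP[/eqP <-|r0].
- apply: (@same_windows_limit _ _ (fun n => - (0 + n.+2%:R)) (fun n => 0 + n.+2%:R)) => //.
  + move=> n; rewrite add0r; by apply: (@lt_trans _ _ 0); rewrite ?oppr_lt0.
  + move=> t; rewrite /= in_itv/= andbT => t0; near=> n; apply/andP; split.
      rewrite expRN -[t]invrK ltf_pV2 ?posrE ?invr_gt0 ?expR_gt0//.
      by near: n; exact: expR_linear_cvgy.
    by near: n; exact: expR_linear_cvgy.
  + move=> t; rewrite /= in_itv/= andbT => /negP; rewrite -leNgt => t0.
    by near=> n; left; apply: le_lt_trans t0 _; exact: expR_gt0.
- apply: (@same_windows_limit _ _ (fun n => ln r + 1 * n.+1%:R^-1) (fun n => ln r + n.+2%:R)) => //.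
  + move=> n; rewrite ltrD2l mul1r; apply: (@le_lt_trans _ _ 1); last by rewrite ltr1n.
    by rewrite invf_le1// ler1n.
  + move=> t; rewrite /= in_itv/= andbT => rt.
    have rt' : expR (ln r) < t by rewrite lnK// posrE.
    have H := cvgr_lt _ (@expR_harmonic (ln r) 1) _ rt'.
    near=> n; apply/andP; split; first by near: n; exact: H.
    by near: n; exact: expR_linear_cvgy.
  + move=> t; rewrite /= in_itv/= andbT => /negP; rewrite -leNgt => tr.
    near=> n; left; apply: le_lt_trans tr _.
    by rewrite -[ltLHS]lnK ?posrE// ltr_expR ltrDl mul1r invr_gt0.
Unshelve. all: by end_near. Qed.

Lemma same_windows_ge m1 m2 r : same_windows m1 m2 -> 0 < r ->
  m1 `[r, +oo[%classic = m2 `[r, +oo[%classic.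
Proof.
move=> m12 r0.
apply: (@same_windows_limit _ _ (fun n => ln r + (-1) * n.+1%:R^-1) (fun n => ln r + n.+2%:R)) => //.
+ move=> n; rewrite ltrD2l mulN1r; have h1 : 0 < n.+1%:R^-1 :> R by rewrite invr_gt0.
  by apply: (@lt_trans _ _ 0); rewrite ?oppr_lt0.
+ move=> t; rewrite /= in_itv/= andbT => rt; near=> n; apply/andP; split.
    apply: lt_le_trans rt.
    by rewrite -[ltRHS]lnK ?posrE// ltr_expR gtrDl mulN1r oppr_lt0 invr_gt0.
  by near: n; exact: expR_linear_cvgy.
+ move=> t; rewrite /= in_itv/= andbT => /negP; rewrite -ltNge => tr.
  have rt' : t < expR (ln r) by rewrite lnK// posrE.
  have H := cvgr_gt _ (@expR_harmonic (ln r) (-1)) _ rt'.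
  by near=> n; left; near: n; exact: H.
Unshelve. all: by end_near. Qed.

Lemma same_law_rays m1 m2 : (forall r, m1 `]-oo, r]%classic = m2 `]-oo, r]%classic) ->
  same_law m1 m2.
Proof.
move=> rays A mA.
have ocE a b : m1 `]a, b]%classic = m2 `]a, b]%classic.
  have [ab|ba] := leP a b; last by rewrite set_itv_ge ?measure0// bnd_simp -leNgt ltW.
  have U : `]-oo, b]%classic = `]-oo, a]%classic `|` `]a, b]%classic.
    by rewrite -itv_bndbnd_setU// bnd_simp.
  have dis : [disjoint `]-oo, a]%classic & `]a, b]%classic].
    apply/disj_setPS => x []/=; rewrite !in_itv/= => xa /andP[]; by rewrite ltNge xa.
  have mE (m : PR) : m `]-oo, b]%classic = (m `]-oo, a]%classic + m `]a, b]%classic)%E.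
    by rewrite U measureU//; exact/disj_set2P.
  have h : (m1 `]a, b]%classic + m2 `]-oo, a]%classic)%E =
           (m2 `]a, b]%classic + m2 `]-oo, a]%classic)%E.
    by have := rays b; rewrite !mE rays addeC => ->; rewrite addeC.
  have fin : m2 `]-oo, a]%classic \is a fin_num by exact: fin_num_measure.
  by rewrite -[LHS](addeK _ fin) h addeK.
apply: (@measure_unique _ _ (measurableTypeR R) (@ocitv R) (fun k => `](- k%:R), k%:R]%classic)) => //.
- exact: ocitvI.
- by move=> k; exact: is_ocitv.
- apply/seteqP; split => // x _; exists (Num.truncn `|x|).+1 => //=; rewrite in_itv/=.
  by have := truncnS_gt `|x|; rewrite ltr_norml => /andP[-> /ltW ->].
- by move=> _ [[a b] _ <-]; exact: ocE.
- by move=> k; rewrite (le_lt_trans (probability_le1 _ _))// ltry.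
Qed.

Lemma same_law_windows m1 m2 : same_windows m1 m2 ->
  same_windows (reflection m1) (reflection m2) -> same_law m1 m2.
Proof.
move=> m12 n12; apply: same_law_rays => r.
have [r0|r0] := leP 0 r.
  have cE (m : PR) : m `]-oo, r]%classic = (1 - m `]r, +oo[%classic)%E.
    rewrite -setCitvr -probability_setC// setCK.
  by rewrite !cE (same_windows_gt m12 r0).
have E (m : PR) : m `]-oo, r]%classic = reflection m `[(- r), +oo[%classic.
  rewrite /reflection /distribution /pushforward; congr (m _).
  by apply/seteqP; split => x/=; rewrite !in_itv/= andbT /neg_fun lerN2.
by rewrite !E; apply: same_windows_ge; rewrite // oppr_gt0.
Qed.

Lemma same_windows_cauchy m1 m2 :
  (forall a y, 0 < y -> \int[m1]_x cauchy_re a y x = \int[m2]_x cauchy_re a y x) ->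
  (forall a y, 0 < y -> \int[m1]_x cauchy_im a y x = \int[m2]_x cauchy_im a y x) ->
  same_windows m1 m2.
Proof.
move=> re im v1 v2 v12; apply: (mulfI (lt0r_neq0 (@pi_gt0 R))).
have c1 := @polar_inversion _ m1 _ _ v12; have c2 := @polar_inversion _ m2 _ _ v12.
have E n : \int[mu]_(v in `[v1, v2]) polar_stieltjes m1 v (small_angle n) =
           \int[mu]_(v in `[v1, v2]) polar_stieltjes m2 v (small_angle n).
  apply: eq_Rintegral => v _; have w0 := @small_angle_bound R n.
  rewrite !polar_stieltjesE// !cauchy_transformE ?re ?im//;
    by rewrite mulr_gt0 ?expR_gt0// sin_gt0_pi.
exact: (cvg_unique _ (cvg_ext E c1) c2).
Qed.

(** Stieltjes: the inversion formula recovers the mass of intervals. *)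
Theorem same_law_cauchy m1 m2 :
  (forall a y, 0 < y -> cauchy_transform m1 (a +i* y) = cauchy_transform m2 (a +i* y)) ->
  same_law m1 m2.
Proof.
move=> H.
have re a y : 0 < y -> \int[m1]_x cauchy_re a y x = \int[m2]_x cauchy_re a y x.
  by move=> y0; have := H a y y0; rewrite !cauchy_transformE// => -[].
have im a y : 0 < y -> \int[m1]_x cauchy_im a y x = \int[m2]_x cauchy_im a y x.
  by move=> y0; have := H a y y0; rewrite !cauchy_transformE// => -[_ /oppr_inj].
apply: same_law_windows; first exact: same_windows_cauchy.
apply: same_windows_cauchy => a y y0.
  rewrite !Rintegral_reflection; do ?exact: bounded_cauchy_re.
  have E (m : PR) : \int[m]_x cauchy_re a y (- x) = - \int[m]_x cauchy_re (- a) y x.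
    rewrite -bRintegralN; last exact: bounded_cauchy_re.
    apply: eq_Rintegral => x _; rewrite /cauchy_re (_ : a - - x = - (- a - x)).
      by rewrite sqrrN mulNr.
    by rewrite opprD !opprK.
  by rewrite !E re.
rewrite !Rintegral_reflection; do ?exact: bounded_cauchy_im.
have E (m : PR) : \int[m]_x cauchy_im a y (- x) = \int[m]_x cauchy_im (- a) y x.
  apply: eq_Rintegral => x _; rewrite /cauchy_im (_ : a - - x = - (- a - x)).
    by rewrite sqrrN.
  by rewrite opprD !opprK.
by rewrite !E im.
Qed.

End uniqueness.

(** * Laws given by densities *)

Section density.
Context {R : realType} d (T : measurableType d) (mu : {measure set T -> \bar R}).
Variable w : T -> R.
Hypotheses (mw : measurable_fun setT w) (w0 : forall x, 0 <= w x).

Section density_integral.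
Variable nu : {measure set T -> \bar R}.
Hypothesis nuE : forall A, measurable A -> nu A = (\int[mu]_(x in A) (w x)%:E)%E.
Import HBNNSimple.

Let density_indic A : measurable A ->
  (\int[nu]_x (\1_A x)%:E = \int[mu]_x ((\1_A x)%:E * (w x)%:E))%E.
Proof.
move=> mA; rewrite integral_indic// setIT nuE// integral_mkcond.
apply: eq_integral => x _; rewrite patchE indicE.
by case: ifPn => _; rewrite ?mul1e ?mul0e.
Qed.

Let density_nnsfun (f : {nnsfun T >-> R}) :
  (\int[nu]_x (f x)%:E = \int[mu]_x ((f x)%:E * (w x)%:E))%E.
Proof.
under [LHS]eq_integral do rewrite fimfunE -fsumEFin//.
rewrite [LHS]ge0_integral_fsum//; last 2 first.
  - by move=> r; exact/measurable_EFinP/measurableT_comp.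
  - by move=> n x _; rewrite EFinM nnfun_muleindic_ge0.
under [RHS]eq_integral.
  move=> x xD; rewrite fimfunE -fsumEFin// muleC ge0_mule_fsumr; last first.
    by move=> r; rewrite EFinM nnfun_muleindic_ge0.
  over.
rewrite [RHS]ge0_integral_fsum//; last 2 first.
  - move=> r; apply/measurable_EFinP; apply: measurable_funM => //.
    exact: measurableT_comp.
  - move=> n x _; apply: mule_ge0; first by rewrite lee_fin.
    by rewrite EFinM nnfun_muleindic_ge0.
apply: eq_fsbigr => r _; rewrite integralZl_indic_nnsfun//= density_indic//.
have [r0|r0] := leP 0 r.
  rewrite -ge0_integralZl//; last 2 first.
  - by apply/measurable_EFinP; apply: measurable_funM.
  - by move=> x _; rewrite mule_ge0// lee_fin.
  apply: eq_integral => x _; rewrite EFinM [RHS]muleCA.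
  by congr (_ * _)%E; rewrite muleC.
by rewrite preimage_nnfun0//; under eq_integral do rewrite indic0 mul0e;
  under [RHS]eq_integral do rewrite indic0 mulr0 mule0; rewrite !integral0 mule0.
Qed.

Lemma ge0_integral_density (f : T -> \bar R) :
  measurable_fun setT f -> (forall x, 0 <= f x)%E ->
  (\int[nu]_x f x = \int[mu]_x (f x * (w x)%:E))%E.
Proof.
move=> mf f0; pose f_ := nnsfun_approx measurableT mf.
transitivity (lim (\int[nu]_x (f_ n x)%:E @[n --> \oo])%E).
  rewrite -monotone_convergence//=.
  - apply: eq_integral => ? /[!inE] xD; apply/esym/cvg_lim => //=.
    exact: cvg_nnsfun_approx.
  - by move=> n; exact/measurable_EFinP/measurable_funTS.
  - by move=> n ? _; rewrite lee_fin.
  - by move=> ? _ ? ? mn; rewrite lee_fin; exact/lefP/nd_nnsfun_approx.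
transitivity (lim (\int[mu]_x ((f_ n x)%:E * (w x)%:E) @[n --> \oo])%E).
  by apply: congr_lim; apply/funext => n; exact: density_nnsfun.
rewrite -monotone_convergence//=.
- apply: eq_integral => x _; apply/cvg_lim => //=.
  by apply: cvgeZr => //; exact: cvg_nnsfun_approx.
- move=> n; apply: emeasurable_funM; last exact/measurable_EFinP.
  exact/measurable_EFinP.
- by move=> n ? _; rewrite mule_ge0// lee_fin.
- move=> x _ m n mn; rewrite lee_pmul// ?lee_fin//.
  exact/lefP/nd_nnsfun_approx.
Qed.

End density_integral.

Lemma exists_density : exists nu : {measure set T -> \bar R},
  forall A, measurable A -> nu A = (\int[mu]_(x in A) (w x)%:E)%E.
Proof.
pose nu (A : set T) := (\int[mu]_(x in A) (w x)%:E)%E.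
have nu0 : nu set0 = 0%E by rewrite /nu integral_set0.
have nu_ge0 A : (0 <= nu A)%E by apply: integral_ge0 => x _; rewrite lee_fin.
have nu_sig : semi_sigma_additive nu.
  move=> F mF tF mUF; rewrite /nu; apply: cvg_toP.
    apply: ereal_nondecreasing_is_cvgn => m n mn.
    by apply: lee_sum_nneg_natr => // k _ _; exact: nu_ge0.
  rewrite ge0_integral_bigcup//=.
  - exact/measurable_EFinP/measurable_funTS.
  - by move=> x _; rewrite lee_fin.
pose nu' : {measure set T -> \bar R} := HB.pack nu
  (isMeasure.Build _ _ _ nu nu0 nu_ge0 nu_sig).
by exists nu'.
Qed.

End density.

Section Rintegral_density.
Context {R : realType} d (T : measurableType d) (mu : {measure set T -> \bar R}).

Lemma integrable_bounded_density (f w : T -> R) : bounded_mfun f ->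
  mu.-integrable setT (EFin \o w) ->
  mu.-integrable setT (EFin \o (fun x => f x * w x)).
Proof.
move=> [mf [M fM]] /integrableP[mw iw].
have mw' : measurable_fun setT w by exact/measurable_EFinP.
apply: (@le_integrable _ _ _ mu setT measurableT _ (EFin \o (fun x => M * w x))) => //=.
- by apply/measurable_EFinP; exact: measurable_funM.
- move=> x _; rewrite lee_fin !normrM; apply: ler_wpM2r => //.
  exact: le_trans (fM x) (ler_norm _).
- under [X in integrable _ _ X]eq_fun do rewrite EFinM.
  by apply: integrableZl => //; exact/integrableP.
Qed.

Lemma Rintegral_shift_density (f w : T -> R) M : bounded_mfun f ->
  mu.-integrable setT (EFin \o w) ->
  \int[mu]_x ((f x + M) * w x) = \int[mu]_x (f x * w x) + M * \int[mu]_x w x.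
Proof.
move=> bf iw; under eq_Rintegral do rewrite mulrDl.
rewrite RintegralD//; last 2 first.
- exact: integrable_bounded_density.
- apply: (integrable_bounded_density (f := fun=> M)) => //; exact: bounded_mfun_cst.
by rewrite RintegralZl.
Qed.

Lemma Rintegral_density (w : T -> R) (P : probability T R) (f : T -> R) :
  measurable_fun setT w -> (forall x, 0 <= w x) ->
  (forall A, measurable A -> P A = (\int[mu]_(x in A) (w x)%:E)%E) ->
  bounded_mfun f ->
  mu.-integrable setT (EFin \o w) /\ \int[P]_x f x = \int[mu]_x (f x * w x).
Proof.
move=> mw w0 PE bf; have [mf [M fM]] := bf.
have w1 : (\int[mu]_x (w x)%:E = 1)%E by rewrite -PE// probability_setT.
have iw : mu.-integrable setT (EFin \o w).
  apply/integrableP; split; first exact/measurable_EFinP.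
  under eq_integral do rewrite /= ger0_norm//.
  by rewrite w1 ltry.
split => //.
have g0 x : 0 <= f x + M by have := fM x; rewrite ler_norml => /andP[]; lra.
have bg : bounded_mfun (fun x => f x + M).
  by apply: bounded_mfunD => //; exact: bounded_mfun_cst.
have key : \int[P]_x (f x + M) = \int[mu]_x ((f x + M) * w x).
  apply: EFin_inj; rewrite EFin_bRintegral//.
  rewrite (ge0_integral_density mw w0 PE)//; last by apply/measurable_EFinP; case: bg.
  by rewrite /Rintegral fineK//; apply: integrable_fin_num => //; exact: integrable_bounded_density.
move: key; rewrite bRintegralD//; last exact: bounded_mfun_cst.
rewrite Rintegral_prob_cst Rintegral_shift_density//.
have -> : \int[mu]_x w x = 1 by rewrite /Rintegral w1.
by rewrite mulr1 => /addIr.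
Qed.

End Rintegral_density.

Section laws_from_densities.
Context {R : realType} d (T : measurableType d) (mu : {measure set T -> \bar R}).
Notation PR := (probability (measurableTypeR R) R).

Let push (nu : {measure set T -> \bar R}) (X : T -> measurableTypeR R)
  (mX : measurable_fun setT X) : {measure set (measurableTypeR R) -> \bar R}.
Proof.
unshelve refine (pushforward nu X : {measure set (measurableTypeR R) -> \bar R}).
exact: mX.
Defined.

(** A law given by a density on each of two parametrised pieces of the line. *)
Lemma exists_law_ge0 (X1 X2 w1 w2 : T -> R) :
  measurable_fun setT X1 -> measurable_fun setT X2 ->
  measurable_fun setT w1 -> measurable_fun setT w2 ->
  (forall x, 0 <= w1 x) -> (forall x, 0 <= w2 x) ->
  (\int[mu]_x (w1 x)%:E + \int[mu]_x (w2 x)%:E = 1)%E ->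
  exists p : PR, forall f : measurableTypeR R -> \bar R,
    measurable_fun setT f -> (forall x, 0 <= f x)%E ->
    (\int[p]_x f x = \int[mu]_x (f (X1 x) * (w1 x)%:E)
                   + \int[mu]_x (f (X2 x) * (w2 x)%:E))%E.
Proof.
move=> mX1 mX2 mw1 mw2 w10 w20 w12.
have [nu1 nu1E] := exists_density mu mw1 w10.
have [nu2 nu2E] := exists_density mu mw2 w20.
have mX1' : measurable_fun setT (X1 : T -> measurableTypeR R) by exact: mX1.
have mX2' : measurable_fun setT (X2 : T -> measurableTypeR R) by exact: mX2.
pose q : {measure set (measurableTypeR R) -> \bar R} :=
  measure_add (push nu1 mX1') (push nu2 mX2').
have q1 : q setT = 1%E.
  transitivity (nu1 (X1 @^-1` setT) + nu2 (X2 @^-1` setT))%E.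
    exact: (measure_addE (push nu1 mX1') (push nu2 mX2')).
  by rewrite !preimage_setT nu1E// nu2E.
pose p : PR := HB.pack (Measure.sort q) q
  (Measure_isProbability.Build _ _ _ q q1).
exists p => f mf f0.
transitivity (\int[q]_x f x)%E; first by [].
rewrite /q ge0_integral_measure_add//.
have PF (nu : {measure set T -> \bar R}) (X : T -> measurableTypeR R)
    (mX : measurable_fun setT X) : (\int[push nu mX]_x f x = \int[nu]_x f (X x))%E.
  transitivity (\int[nu]_(x in X @^-1` setT) (f \o X) x)%E; last by rewrite preimage_setT.
  exact: (@ge0_integral_pushforward _ _ _ _ _ X mX nu setT f measurableT mf (fun y _ => f0 y)).
rewrite !PF.
rewrite (ge0_integral_density mw1 w10 nu1E)//; last exact: measurableT_comp.
by rewrite (ge0_integral_density mw2 w20 nu2E)//; exact: measurableT_comp.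
Qed.

Lemma exists_law (X1 X2 w1 w2 : T -> R) :
  measurable_fun setT X1 -> measurable_fun setT X2 ->
  measurable_fun setT w1 -> measurable_fun setT w2 ->
  (forall x, 0 <= w1 x) -> (forall x, 0 <= w2 x) ->
  (\int[mu]_x (w1 x)%:E + \int[mu]_x (w2 x)%:E = 1)%E ->
  exists p : PR, forall f : R -> R, bounded_mfun (f : measurableTypeR R -> R) ->
    \int[p]_x f x = \int[mu]_x (f (X1 x) * w1 x) + \int[mu]_x (f (X2 x) * w2 x).
Proof.
move=> mX1 mX2 mw1 mw2 w10 w20 w12.
have [p pE] := exists_law_ge0 mX1 mX2 mw1 mw2 w10 w20 w12.
exists p => f bf; have [mf [M fM]] := bf.
have iw1 : (0 <= \int[mu]_x (w1 x)%:E)%E by apply: integral_ge0 => x _; rewrite lee_fin.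
have iw2 : (0 <= \int[mu]_x (w2 x)%:E)%E by apply: integral_ge0 => x _; rewrite lee_fin.
have int1 : mu.-integrable setT (EFin \o w1).
  apply/integrableP; split; first exact/measurable_EFinP.
  under eq_integral do rewrite /= ger0_norm//.
  by apply: (@le_lt_trans _ _ 1%E); rewrite ?ltry// -w12 leeDl.
have int2 : mu.-integrable setT (EFin \o w2).
  apply/integrableP; split; first exact/measurable_EFinP.
  under eq_integral do rewrite /= ger0_norm//.
  by apply: (@le_lt_trans _ _ 1%E); rewrite ?ltry// -w12 leeDr.
have b1 : bounded_mfun (f \o X1) by exact: (bounded_mfun_comp bf).
have b2 : bounded_mfun (f \o X2) by exact: (bounded_mfun_comp bf).
have i1 := integrable_bounded_density b1 int1.
have i2 := integrable_bounded_density b2 int2.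
have g0 x : 0 <= f x + M by have := fM x; rewrite ler_norml => /andP[]; lra.
have bg : bounded_mfun ((fun x => f x + M) : measurableTypeR R -> R).
  by apply: bounded_mfunD => //; exact: bounded_mfun_cst.
have sum1 : \int[mu]_x w1 x + \int[mu]_x w2 x = 1.
  have := congr1 fine w12; rewrite fineD//; exact: integrable_fin_num.
have key : \int[p]_x (f x + M) = \int[mu]_x ((f (X1 x) + M) * w1 x)
                               + \int[mu]_x ((f (X2 x) + M) * w2 x).
  apply: EFin_inj; rewrite EFin_bRintegral//.
  rewrite (pE (fun x => (f x + M)%:E)); last 2 first.
  - by apply/measurable_EFinP; case: bg.
  - by move=> x; rewrite lee_fin.
  rewrite EFinD; congr (_ + _)%E; rewrite /Rintegral fineK//.
    apply: integrable_fin_num => //.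
    apply: (integrable_bounded_density (f := fun x => f (X1 x) + M)) => //.
    by apply: bounded_mfunD => //; exact: bounded_mfun_cst.
  apply: integrable_fin_num => //.
  apply: (integrable_bounded_density (f := fun x => f (X2 x) + M)) => //.
  by apply: bounded_mfunD => //; exact: bounded_mfun_cst.
move: key; rewrite bRintegralD//; last exact: bounded_mfun_cst.
rewrite Rintegral_prob_cst (Rintegral_shift_density M b1 int1).
by rewrite (Rintegral_shift_density M b2 int2); nra.
Qed.

End laws_from_densities.

Section symmetric_intervals.
Context {R : realType}.
Notation mu := (@lebesgue_measure R).

Lemma cvg_Rintegral_symmetric (h : R -> R) : mu.-integrable setT (EFin \o h) ->
  \int[mu]_(x in `[(- n%:R), n%:R]) h x @[n --> \oo] --> \int[mu]_x h x.
Proof.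
move=> ih; have [mh _] := integrableP _ _ _ ih.
have ihn := integrable_fin_num measurableT ih.
apply: fine_cvg; rewrite fineK//.
pose D (n : nat) : set R := `[(- n%:R), n%:R]%classic.
pose h_ (n : nat) x := ((h x)%:E * (\1_(D n) x)%:E)%E.
have hE n : (\int[mu]_(x in D n) (h x)%:E = \int[mu]_x h_ n x)%E.
  rewrite integral_mkcond; apply: eq_integral => x _.
  by rewrite patchE /h_ indicE; case: ifPn => _; rewrite ?mule1 ?mule0.
rewrite (_ : (fun n : nat => _) = (fun n => \int[mu]_x h_ n x)%E); last first.
  by apply/funext => n; exact: hE.
have [] := @dominated_convergence _ _ _ mu setT measurableT h_ (EFin \o h)
  (fun x => `|h x|%:E).
- move=> n; apply: emeasurable_funM => //; apply/measurable_EFinP.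
  by apply: measurable_indic; exact: measurable_itv.
- exact: mh.
- apply/aeW => x _; apply: cvg_near_cst; near=> n.
  have Dx : D n x.
    by rewrite /D/= in_itv/= -ler_norml; near: n; exact: nbhs_infty_ger.
  by rewrite /h_ indicE (mem_set Dx) mule1.
- exact: (integrable_abse ih).
- apply/aeW => x n _; rewrite /h_ indicE; case: (_ \in _); rewrite ?mule1 ?mule0//=.
  by rewrite normr0 lee_fin.
- by [].
Unshelve. all: by end_near. Qed.

Lemma cvg_integral_symmetric (g : R -> R) : measurable_fun setT g ->
  (forall x, 0 <= g x) ->
  (\int[mu]_(x in `[(- n.+1%:R)%R, (n.+1%:R)%R]) (g x)%:E @[n --> \oo] --> \int[mu]_x (g x)%:E)%E.
Proof.
move=> mg g0; pose D (n : nat) : set R := `[(- n.+1%:R), n.+1%:R]%classic.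
have DT : \bigcup_n D n = setT.
  apply/seteqP; split => // x _; exists (Num.truncn `|x|).+1 => //=.
  rewrite /D/= in_itv/= -ler_norml (le_trans (ltW (truncnS_gt _)))// ler_nat.
  by rewrite ltnW// ltnS.
suff : (\int[mu]_(x in D n) (g x)%:E @[n --> \oo] --> \int[mu]_x (g x)%:E)%E by [].
rewrite -DT; apply: ge0_nondecreasing_set_cvg_integral => //.
- move=> n p np; apply/subsetPset => x; rewrite /D/= !in_itv/= -!ler_norml => xn.
  by apply: le_trans xn _; rewrite ler_nat ltnS.
- by move=> n; exact: measurable_itv.
- by move=> n; apply/measurable_EFinP; exact: measurable_funTS.
- by move=> n x _; rewrite lee_fin.
Qed.

Lemma integrable_ge0_sup (g : R -> R) C : bounded_mfun g -> (forall x, 0 <= g x) ->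
  (forall n : nat, \int[mu]_(x in `[(- n.+1%:R), n.+1%:R]) g x <= C) ->
  mu.-integrable setT (EFin \o g).
Proof.
move=> bg g0 gC; have mg : measurable_fun setT g by case: bg.
apply/integrableP; split; first exact/measurable_EFinP.
under eq_integral do rewrite /= ger0_norm//.
apply: (@le_lt_trans _ _ C%:E); last exact: ltry.
apply: (cvge_to_le (cvg_integral_symmetric mg g0)); apply: nearW => n.
have i : mu.-integrable `[(- n.+1%:R), n.+1%:R] (EFin \o g).
  exact: bounded_mfun_integrable_itv.
rewrite -[leLHS]fineK ?lee_fin//; last exact: (integrable_fin_num _ i).
exact: gC.
Qed.

End symmetric_intervals.

(** * Uniqueness of the characteristic function *)

Section exponential_integrals.
Context {R : realType}.
Notation PR := (probability (measurableTypeR R) R).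
Notation mu := (@lebesgue_measure R).
Implicit Types (m : PR).

Lemma cvg_expRN : expR (- n.+1%:R) @[n --> \oo] --> (0 : R).
Proof.
have h : (n.+1%:R : R) @[n --> \oo] --> +oo.
  by have := @cvgr_idn R; rewrite -(cvg_shiftS (fun n => n%:R : R)).
exact: (cvg_comp _ _ h (@cvgr_expR R)).
Qed.

(** Integration against the standard exponential law by primitives. *)
Lemma Rintegral_exponential (f g F : R -> R) C :
  bounded_mfun (f : measurableTypeR R -> R) ->
  (forall x, 0 <= x -> f x = g x) ->
  (forall x : R, {for x, continuous g}) ->
  (forall x : R, is_derive x 1 F (g x * expR (- x))) ->
  (forall x, 0 <= x -> `|F x| <= C * expR (- x)) ->
  \int[std_exponential]_x f x = - F 0.
Proof.
move=> bf fg cg dF FC.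
have [ifw ->] : mu.-integrable setT (EFin \o exponential_pdf 1) /\
    \int[std_exponential]_x f x = \int[mu]_x (f x * exponential_pdf 1 x).
  apply: (@Rintegral_density R _ _ mu _ std_exponential f) => //.
  - exact: measurable_exponential_pdf.
  - by move=> x; apply: exponential_pdf_ge0.
have c1 : \int[mu]_(x in `[(- n%:R), n%:R]) (f x * exponential_pdf 1 x) @[n --> \oo] -->
    \int[mu]_x (f x * exponential_pdf 1 x).
  by apply: cvg_Rintegral_symmetric; exact: (integrable_bounded_density bf ifw).
move: c1; rewrite -(cvg_shiftS (fun n : nat => \int[mu]_(x in `[(- n%:R), n%:R]) _)) => c1.
have ce (x : R) : {for x, continuous (fun y : R => expR (- y))}.
  by apply: (@has_derive_continuous _ _ _ (- expR (- x))); diff; ring.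
have cge (x : R) : {for x, continuous (fun y : R => g y * expR (- y))}.
  exact: (cvgM (cg x) (ce x)).
have E (n : nat) : \int[mu]_(x in `[(- n.+1%:R), n.+1%:R]) (f x * exponential_pdf 1 x) =
    F n.+1%:R - F 0.
  rewrite -(@Rintegral_FTC _ (fun x => g x * expR (- x))) ?ltr0Sn//; first last.
  - by move=> x _; exact: cge.
  rewrite Rintegral_mkcond [RHS]Rintegral_mkcond; apply: eq_Rintegral => x _.
  rewrite !patchE !mem_setE !in_itv/=.
  have [x0|x0] := leP 0 x.
    rewrite (le_trans _ x0) ?oppr_le0//= exponential_pdfE// fg// mul1r mulN1r.
    by [].
  by rewrite lt0_exponential_pdf// mulr0 if_same.
have c2 : F n.+1%:R - F 0 @[n --> \oo] --> - F 0.
  rewrite -[X in _ --> X]add0r; apply: cvgB; last exact: cvg_cst.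
  apply/norm_cvg0P.
  apply: (@squeeze_cvgr _ _ _ _ (fun=> 0) (fun n : nat => C * expR (- n.+1%:R))).
  - by apply: nearW => n; rewrite normr_ge0 FC.
  - exact: cvg_cst.
  - by rewrite -[X in _ --> X](mulr0 C); apply: cvgMl_tmp; exact: cvg_expRN.
exact: (cvg_unique _ (cvg_ext E c1) c2).
Qed.

Lemma bounded_damped (l : R) (f : R -> R) : 0 <= l ->
  bounded_mfun (f : measurableTypeR R -> R) ->
  bounded_mfun (fun s : measurableTypeR R => expR (- (l * `|s : R|)) * f s).
Proof.
move=> l0 bf; apply: bounded_mfunM => //; split.
  apply: measurableT_comp => //; apply: measurableT_comp => //.
  by apply: measurable_funM => //; exact: measurableT_comp.
by exists 1 => s; rewrite ger0_norm ?expR_ge0// -expR0 ler_expR oppr_le0 mulr_ge0.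
Qed.

Lemma Rintegral_exponential_cos (l k : R) : 0 <= l ->
  \int[std_exponential]_s (expR (- (l * `|s|)) * cos (k * s)) =
  (1 + l) / ((1 + l) ^+ 2 + k ^+ 2).
Proof.
move=> l0; have m0 : 0 < 1 + l by lra.
have D0 : 0 < (1 + l) ^+ 2 + k ^+ 2 by rewrite ltr_wpDr ?sqr_ge0// exprn_gt0.
pose F (s : R) := expR (- (l * s)) * expR (- s) * ((k * sin (k * s) - (1 + l) * cos (k * s)) /
     ((1 + l) ^+ 2 + k ^+ 2)).
transitivity (- F 0); last first.
  by rewrite /F !mulr0 oppr0 expR0 sin0 cos0 mulr0; field; rewrite gt_eqF.
refine (@Rintegral_exponential _ (fun s => expR (- (l * s)) * cos (k * s)) F ((`|k| + (1 + l)) / ((1 + l) ^+ 2 + k ^+ 2)) _ _ _ _ _); rewrite /F.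
- by apply: bounded_damped => //; exact: bcos.
- by move=> x x0; rewrite ger0_norm.
- move=> x; apply: (@has_derive_continuous _ _ _ (expR (- (l * x)) * (- l) * cos (k * x) + expR (- (l * x)) * (- (k * sin (k * x))))).
  by diff; rewrite /=; ring.
- by move=> x; diff; rewrite /=; field; rewrite gt_eqF.
- move=> x x0; rewrite !normrM normfV (gtr0_norm D0) !(ger0_norm (expR_ge0 _)).
  rewrite -mulrA mulrCA [leRHS]mulrC; apply: ler_wpM2l; first exact: expR_ge0.
  apply: (@le_trans _ _ (1 * (`|k * sin (k * x) - (1 + l) * cos (k * x)| / ((1 + l) ^+ 2 + k ^+ 2)))).
    apply: ler_wpM2r; first by rewrite divr_ge0// ltW.
    by rewrite -expR0 ler_expR oppr_le0 mulr_ge0.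
  rewrite mul1r; apply: ler_wpM2r; first by rewrite invr_ge0 ltW.
  apply: le_trans (ler_normB _ _) _; rewrite !normrM (gtr0_norm m0).
  by apply: lerD; rewrite ler_piMr ?normr_ge0 ?sin_max ?cos_max// ltW.
Qed.

Lemma Rintegral_exponential_sin (l k : R) : 0 <= l ->
  \int[std_exponential]_s (expR (- (l * `|s|)) * sin (k * s)) =
  k / ((1 + l) ^+ 2 + k ^+ 2).
Proof.
move=> l0; have m0 : 0 < 1 + l by lra.
have D0 : 0 < (1 + l) ^+ 2 + k ^+ 2 by rewrite ltr_wpDr ?sqr_ge0// exprn_gt0.
pose F (s : R) := expR (- (l * s)) * expR (- s) * (- (k * cos (k * s) + (1 + l) * sin (k * s)) /
     ((1 + l) ^+ 2 + k ^+ 2)).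
transitivity (- F 0); last first.
  by rewrite /F !mulr0 oppr0 expR0 sin0 cos0 mulr0; field; rewrite gt_eqF.
refine (@Rintegral_exponential _ (fun s => expR (- (l * s)) * sin (k * s)) F ((`|k| + (1 + l)) / ((1 + l) ^+ 2 + k ^+ 2)) _ _ _ _ _); rewrite /F.
- by apply: bounded_damped => //; exact: bsin.
- by move=> x x0; rewrite ger0_norm.
- move=> x; apply: (@has_derive_continuous _ _ _ (expR (- (l * x)) * (- l) * sin (k * x) + expR (- (l * x)) * (k * cos (k * x)))).
  by diff; rewrite /=; ring.
- by move=> x; diff; rewrite /=; field; rewrite gt_eqF.
- move=> x x0; rewrite !normrM normfV normrN (gtr0_norm D0) !(ger0_norm (expR_ge0 _)).
  rewrite -mulrA mulrCA [leRHS]mulrC; apply: ler_wpM2l; first exact: expR_ge0.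
  apply: (@le_trans _ _ (1 * (`|k * cos (k * x) + (1 + l) * sin (k * x)| / ((1 + l) ^+ 2 + k ^+ 2)))).
    apply: ler_wpM2r; first by rewrite divr_ge0// ltW.
    by rewrite -expR0 ler_expR oppr_le0 mulr_ge0.
  rewrite mul1r; apply: ler_wpM2r; first by rewrite invr_ge0 ltW.
  apply: le_trans (ler_normD _ _) _; rewrite !normrM (gtr0_norm m0).
  by apply: lerD; rewrite ler_piMr ?normr_ge0 ?sin_max ?cos_max// ltW.
Qed.

End exponential_integrals.

Section charf_uniqueness.
Context {R : realType}.
Notation PR := (probability (measurableTypeR R) R).
Notation Re := complex.Re.
Notation Im := complex.Im.
Implicit Types (m : PR).

Lemma cauchy_im_exponential (a y x : R) : 0 < y ->
  cauchy_im a y x = y^-1 * \int[std_exponential]_s cos ((a - x) / y * s).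
Proof.
move=> y0; have := @Rintegral_exponential_cos R 0 ((a - x) / y) (lexx 0).
under eq_Rintegral do rewrite mul0r oppr0 expR0 mul1r.
move=> ->; rewrite /cauchy_im addr0 expr1n; field.
by rewrite !gt_eqF//= 1?addrC ?cauchy_den_gt0// ltr_wpDr ?sqr_ge0// exprn_gt0.
Qed.

Lemma cauchy_re_exponential (a y x : R) : 0 < y ->
  cauchy_re a y x = y^-1 * \int[std_exponential]_s sin ((a - x) / y * s).
Proof.
move=> y0; have := @Rintegral_exponential_sin R 0 ((a - x) / y) (lexx 0).
under eq_Rintegral do rewrite mul0r oppr0 expR0 mul1r.
move=> ->; rewrite /cauchy_re addr0 expr1n; field.
by rewrite !gt_eqF//= 1?addrC ?cauchy_den_gt0// ltr_wpDr ?sqr_ge0// exprn_gt0.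
Qed.

Let mkernel (a y : R) : measurable_fun setT
  (fun z : measurableTypeR R * measurableTypeR R => (a - z.1) / y * z.2 : R).
Proof.
apply: measurable_funM; last exact: measurable_snd.
by apply: measurable_funM => //; apply: measurable_funB => //; exact: measurable_fst.
Qed.

Let phaseB (a y x s : R) : (a - x) / y * s = a / y * s - y^-1 * s * x.
Proof. by ring. Qed.

Lemma Rintegral_cauchy_im_charf m (a y : R) : 0 < y ->
  \int[m]_x cauchy_im a y x = y^-1 * \int[std_exponential]_s
    (cos (a / y * s) * Re (charf m (y^-1 * s)) + sin (a / y * s) * Im (charf m (y^-1 * s))).
Proof.
move=> y0; under eq_Rintegral do rewrite cauchy_im_exponential//.
have b2 := bounded_mfun_cos (mkernel a y).
rewrite bRintegralZl; last exact: (bounded_mfun_Rintegral1 m std_exponential b2).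
congr (_ * _); rewrite (Rintegral_swap m std_exponential b2).
apply: eq_Rintegral => s _ /=.
rewrite -!bRintegralZl; [|exact: bsin|exact: bcos].
rewrite -bRintegralD; last 2 first.
- by apply: bounded_mfunM; [exact: bounded_mfun_cst|exact: bcos].
- by apply: bounded_mfunM; [exact: bounded_mfun_cst|exact: bsin].
apply: eq_Rintegral => x _; rewrite -cosB; congr cos.
exact: phaseB.
Qed.

Lemma Rintegral_cauchy_re_charf m (a y : R) : 0 < y ->
  \int[m]_x cauchy_re a y x = y^-1 * \int[std_exponential]_s
    (sin (a / y * s) * Re (charf m (y^-1 * s)) - cos (a / y * s) * Im (charf m (y^-1 * s))).
Proof.
move=> y0; under eq_Rintegral do rewrite cauchy_re_exponential//.
have b2 := bounded_mfun_sin (mkernel a y).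
rewrite bRintegralZl; last exact: (bounded_mfun_Rintegral1 m std_exponential b2).
congr (_ * _); rewrite (Rintegral_swap m std_exponential b2).
apply: eq_Rintegral => s _ /=.
rewrite -!bRintegralZl; [|exact: bsin|exact: bcos].
rewrite -bRintegralB; last 2 first.
- by apply: bounded_mfunM; [exact: bounded_mfun_cst|exact: bcos].
- by apply: bounded_mfunM; [exact: bounded_mfun_cst|exact: bsin].
apply: eq_Rintegral => x _; rewrite -sinB; congr sin.
exact: phaseB.
Qed.

(** The characteristic function determines the Cauchy transform, by integration
    against exponentials. *)
Theorem same_law_charf_eq m1 m2 : charf m1 =1 charf m2 -> same_law m1 m2.
Proof.
move=> H; apply: same_law_cauchy => a y y0; rewrite !cauchy_transformE//.
congr (_ +i* (- _)).
  by rewrite !Rintegral_cauchy_re_charf//; under eq_Rintegral do rewrite H.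
by rewrite !Rintegral_cauchy_im_charf//; under eq_Rintegral do rewrite H.
Qed.

(** The Cauchy law of scale [s] centred at [c]. *)
Lemma cauchy_transform_cauchy_law m (s c : R) : 0 <= s ->
  (forall t, charf m t = (expR (- (s * `|t|)) * cos (c * t)) +i*
                         (expR (- (s * `|t|)) * sin (c * t))) ->
  forall a y, 0 < y -> cauchy_transform m (a +i* y) = ((a - c) +i* (y + s))^-1.
Proof.
move=> s0 H a y y0; rewrite cauchy_transformE//.
rewrite Rintegral_cauchy_re_charf// Rintegral_cauchy_im_charf//.
have l0 : 0 <= s / y by rewrite divr_ge0// ltW.
have EC : \int[std_exponential]_t
    (cos (a / y * t) * Re (charf m (y^-1 * t)) + sin (a / y * t) * Im (charf m (y^-1 * t)))
    = \int[std_exponential]_t (expR (- (s / y * `|t|)) * cos ((a - c) / y * t)).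
  apply: eq_Rintegral => t _; rewrite H/= normrM (gtr0_norm (_ : 0 < y^-1)) ?invr_gt0//.
  have -> : (a - c) / y * t = a / y * t - c * (y^-1 * t) by ring.
  by rewrite cosB [s * _]mulrA; ring.
have ES : \int[std_exponential]_t
    (sin (a / y * t) * Re (charf m (y^-1 * t)) - cos (a / y * t) * Im (charf m (y^-1 * t)))
    = \int[std_exponential]_t (expR (- (s / y * `|t|)) * sin ((a - c) / y * t)).
  apply: eq_Rintegral => t _; rewrite H/= normrM (gtr0_norm (_ : 0 < y^-1)) ?invr_gt0//.
  have -> : (a - c) / y * t = a / y * t - c * (y^-1 * t) by ring.
  by rewrite sinB [s * _]mulrA; ring.
rewrite EC ES Rintegral_exponential_cos// Rintegral_exponential_sin//.
have y1 : y != 0 by rewrite gt_eqF.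
have d1 : (a - c) ^+ 2 + (y + s) ^+ 2 != 0.
  by rewrite gt_eqF// ltr_wpDl ?sqr_ge0// exprn_gt0// ltr_wpDr.
have d2 : (y + s) ^+ 2 + (a - c) ^+ 2 != 0 by rewrite addrC.
apply/eqP; rewrite eq_complex/=; apply/andP; split; apply/eqP; field; rewrite ?y1 ?d1 ?d2//.
Qed.

End charf_uniqueness.

(** * The kernel of the triangle function *)

Section triangle_law.
Context {R : realType}.
Notation PR := (probability (measurableTypeR R) R).
Notation mu := (@lebesgue_measure R).

Definition sech_kernel (v : R) : R := (expR v + expR (- v))^-1.

Lemma sech_kernel_ge0 v : 0 <= sech_kernel v.
Proof. by rewrite invr_ge0 addr_ge0 ?expR_ge0. Qed.

Let mexpN : measurable_fun setT (fun v : R => expR (- v)).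
Proof. exact: measurableT_comp. Qed.

Lemma bounded_sech_kernel : bounded_mfun sech_kernel.
Proof.
split; first by apply: (measurableT_comp measurable_inv); exact: measurable_funD.
exists 1 => v; rewrite ger0_norm ?sech_kernel_ge0// invf_le1 ?addr_gt0 ?expR_gt0//.
by have e1 := expR_ge1Dx v; have e2 := expR_ge1Dx (- v); lra.
Qed.

Lemma is_derive_sech (v : R) : is_derive v 1 (fun v : R => atan (expR v)) (sech_kernel v).
Proof.
diff; rewrite /= /sech_kernel expRN; have e0 := expR_gt0 v; field.
by rewrite !gt_eqF//= ?addr_gt0// ?mulr_gt0// ?exprn_gt0//= ltr_wpDr ?sqr_ge0.
Qed.

Lemma continuous_sech (v : R) : {for v, continuous sech_kernel}.
Proof.
have e0 := expR_gt0 v; have e1 := expR_gt0 (- v).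
apply: (@has_derive_continuous _ _ _
  (- (expR v + expR (- v)) ^- 2 * (expR v * 1 + expR (- v) * -1))).
by rewrite /sech_kernel; apply: has_derive_inv; [rewrite gt_eqF// addr_gt0|diff].
Qed.

Lemma integrable_sech : mu.-integrable setT (EFin \o sech_kernel).
Proof.
apply: (@integrable_ge0_sup _ _ pi); [exact: bounded_sech_kernel|exact: sech_kernel_ge0|].
move=> n; have -> : \int[mu]_(v in `[(- n.+1%:R), n.+1%:R]) sech_kernel v =
    atan (expR n.+1%:R) - atan (expR (- n.+1%:R)).
  apply: (Rintegral_FTC (F := fun v : R => atan (expR v))).
  - by apply: (@lt_trans _ _ 0); rewrite ?oppr_lt0.
  - by move=> v _; exact: continuous_sech.
  - by move=> v _; exact: is_derive_sech.
have a1 := atan_ltpi2 (expR (n.+1%:R : R)); have a2 := atan_gtNpi2 (expR (- n.+1%:R : R)).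
by move: (atan _) (atan _) a1 a2 => p q; lra.
Qed.

Lemma integrable_sech_bound (f : R -> R) C : measurable_fun setT f ->
  (forall v, `|f v| <= C * sech_kernel v) -> mu.-integrable setT (EFin \o f).
Proof.
move=> mf fC.
apply: (@le_integrable _ _ _ mu setT measurableT _ (EFin \o (fun v => C * sech_kernel v))).
- exact/measurable_EFinP.
- by move=> v _ /=; rewrite lee_fin (le_trans (fC v))// ler_norm.
- under [X in integrable _ _ X]eq_fun do rewrite /= EFinM.
  by apply: integrableZl => //; exact: integrable_sech.
Qed.

Lemma abs_sin_le (x : R) : 0 < x -> `|sin x| <= x.
Proof.
move=> x0; have F (c : R) : `|c| <= 1 -> 0 <= x + c * sin x.
  move=> c1.
  have dF (u : R) : is_derive u 1 (fun u : R => u + c * sin u) (1 + c * cos u).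
    by diff; rewrite /=; ring.
  have cF (u : R) : {for u, continuous (fun u : R => 1 + c * cos u)}.
    by apply: (@has_derive_continuous _ _ _ (- (c * sin u))); diff; rewrite /=; ring.
  have -> : x + c * sin x = \int[mu]_(u in `[0, x]) (1 + c * cos u).
    rewrite (@Rintegral_FTC _ _ (fun u : R => u + c * sin u) _ _ x0 _ (fun u _ => dF u)).
      by rewrite sin0 mulr0 addr0 subr0.
    by move=> u _; exact: cF.
  apply: Rintegral_ge0 => u _; have := cos_max u.
  move=> cu; have : `|c * cos u| <= 1 by rewrite normrM mulr_ile1.
  by rewrite ler_norml => /andP[]; lra.
rewrite ler_norml; apply/andP; split.
  have := F 1; rewrite normr1 lexx => /(_ isT); lra.
have := F (-1); rewrite normrN1 lexx => /(_ isT); lra.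
Qed.

Lemma one_minus_cos_le (x : R) : 0 < x -> 1 - cos x <= x ^+ 2 / 2.
Proof.
move=> x0; have x2 : 0 < x / 2 by rewrite divr_gt0.
have s := abs_sin_le x2.
have -> : 1 - cos x = 2 * sin (x / 2) ^+ 2.
  have {1}-> : x = x / 2 + x / 2 by field.
  rewrite cosD; have cs := cos2Dsin2 (x / 2).
  move: (cos (x / 2)) (sin (x / 2)) cs => c s0 cs.
  by transitivity (c ^+ 2 + s0 ^+ 2 - (c * c - s0 * s0)); [rewrite cs|ring].
have : `|sin (x / 2)| ^+ 2 <= (x / 2) ^+ 2 by rewrite ler_pXn2r// nnegrE ?ltW.
by rewrite real_normK ?num_real//; nra.
Qed.

Definition triangle_kernel (s v : R) : R := (1 - cos (s * expR v)) * expR (- v).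

Lemma triangle_kernel_ge0 s v : 0 <= triangle_kernel s v.
Proof. by rewrite mulr_ge0 ?expR_ge0// subr_ge0 cos_le1. Qed.

Lemma continuous_triangle_kernel s : continuous (triangle_kernel s).
Proof.
move=> v; apply: (@has_derive_continuous _ _ _
  ((s * expR v) * sin (s * expR v) * expR (- v) - triangle_kernel s v)).
by rewrite /triangle_kernel; diff; rewrite /=; ring.
Qed.

Lemma integrable_triangle_kernel s : mu.-integrable setT (EFin \o triangle_kernel s).
Proof.
wlog s0 : s / 0 < s => [W|].
  have [s0|s0|->] := ltgtP s 0.
  - have := W (- s); rewrite oppr_gt0 => /(_ s0); congr (integrable _ _ (EFin \o _)).
    by apply/funext => v; rewrite /triangle_kernel mulNr cosN.
  - exact: W.
  - apply: (@integrable_sech_bound _ 0).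
      by apply: continuous_measurable_fun; exact: continuous_triangle_kernel.
    by move=> v; rewrite /triangle_kernel mul0r cos0 subrr !mul0r normr0.
apply: (@integrable_sech_bound _ (4 + s ^+ 2)).
  by apply: continuous_measurable_fun; exact: continuous_triangle_kernel.
move=> v; rewrite ger0_norm ?triangle_kernel_ge0// /sech_kernel.
have e0 := expR_gt0 v; have d0 : 0 < expR v + expR (- v) by rewrite addr_gt0 ?expR_gt0.
rewrite ler_pdivlMr// /triangle_kernel.
have b1 : 1 - cos (s * expR v) <= 2 by have := cos_geN1 (s * expR v); lra.
have b2 : 1 - cos (s * expR v) <= (s * expR v) ^+ 2 / 2.
  by apply: one_minus_cos_le; rewrite mulr_gt0.
have b0 : 0 <= 1 - cos (s * expR v) by rewrite subr_ge0 cos_le1.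
rewrite expRN; move: (expR v) e0 b0 b1 b2 => e e0; move: (1 - cos (s * e)) => c c0 b1 b2.
have i0 : 0 < e^-1 by rewrite invr_gt0.
have ee : e * e^-1 = 1 by rewrite divff// gt_eqF.
have -> : c * e^-1 * (e + e^-1) = c + c * (e^-1 * e^-1).
  by transitivity (c * (e * e^-1) + c * (e^-1 * e^-1)); [ring|rewrite ee mulr1].
have h : c * (e^-1 * e^-1) <= (s * e) ^+ 2 / 2 * (e^-1 * e^-1).
  by apply: ler_wpM2r => //; rewrite mulr_ge0// ltW.
have h2 : (s * e) ^+ 2 / 2 * (e^-1 * e^-1) = s ^+ 2 / 2.
  by transitivity (s ^+ 2 / 2 * ((e * e^-1) * (e * e^-1))); [ring|rewrite ee; ring].
by have := sqr_ge0 s; lra.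
Qed.

Definition triangle_mass := \int[mu]_v triangle_kernel 1 v.

Lemma triangle_mass_gt0 : 0 < triangle_mass.
Proof.
have p2 := pi_ge2 R; have c1 : cos 1 < 1 :> R.
  rewrite -[X in _ < X]cos0 ltr_cos ?in_itv/= ?lexx ?ler01//=; lra.
have l2 : 0 < ln 2 :> R by rewrite ln_gt0// ltr1n.
apply: (@lt_le_trans _ _ (\int[mu]_(v in `[0, ln 2]) ((1 - cos 1) / 2))).
  rewrite Rintegral_cst//= lebesgue_measure_itv/= lte_fin l2/= subr0.
  by rewrite mulr_gt0// divr_gt0// subr_gt0.
have i := integrable_triangle_kernel 1.
apply: (@le_trans _ _ (\int[mu]_(v in `[0, ln 2]) triangle_kernel 1 v)).
  apply: le_Rintegral => //=.
  - apply: bounded_mfun_integrable_itv; exact: bounded_mfun_cst.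
  - exact: integrableS i.
  - move=> v; rewrite in_itv/= => /andP[v0 v1]; rewrite /triangle_kernel mul1r.
    have e1 : 1 <= expR v by rewrite -expR0 ler_expR.
    have e2 : expR v <= 2 by rewrite -[leRHS]lnK ?posrE// ler_expR.
    apply: ler_pM; rewrite ?subr_ge0 ?cos_le1 ?invr_ge0//.
      rewrite lerD2l lerN2; have [->//|ne] := eqVneq (expR v) 1.
      by apply: ltW; rewrite ltr_cos ?in_itv/=; [rewrite lt_def ne|apply/andP; split; lra|
        apply/andP; split; lra].
    by rewrite expRN lef_pV2 ?posrE ?expR_gt0.
apply: fine_le; [exact: (integrable_fin_num _ (integrableS _ _ _ i))|exact: integrable_fin_num|].
apply: ge0_subset_integral => //; first by case/integrableP: i.
by move=> v _; rewrite lee_fin triangle_kernel_ge0.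
Qed.

End triangle_law.

(** * Moving lines of integration in a strip *)

Section kernel.
Context {R : realType}.
Notation mu := (@lebesgue_measure R).
Notation Re := complex.Re.
Notation Im := complex.Im.

Definition sqnorm (z : R[i]) : R := Re z ^+ 2 + Im z ^+ 2.

Lemma sqnormM x y : sqnorm (x * y) = sqnorm x * sqnorm y.
Proof. by rewrite /sqnorm Re_mul Im_mul; ring. Qed.

Lemma sqnormV x : sqnorm x^-1 = (sqnorm x)^-1.
Proof.
have [->|/sqr_norm_neq0 x0] := eqVneq x 0.
  by rewrite invr0 /sqnorm/= expr0n/= addr0 invr0.
by rewrite /sqnorm Re_inv Im_inv; field; rewrite gt_eqF.
Qed.

Lemma sqnorm_Cexp x : sqnorm (Cexp x) = expR (Re x) ^+ 2.
Proof.
rewrite /sqnorm Re_Cexp Im_Cexp !exprMn -mulrDr.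
by rewrite cos2Dsin2 mulr1.
Qed.

Lemma Re_sqnorm x : `|Re x| ^+ 2 <= sqnorm x.
Proof. by rewrite real_normK ?num_real// lerDl sqr_ge0. Qed.

Lemma Im_sqnorm x : `|Im x| ^+ 2 <= sqnorm x.
Proof. by rewrite real_normK ?num_real// lerDr sqr_ge0. Qed.

Variables (a th : R).
Hypotheses (a0 : 0 < a) (th0 : 0 <= th) (th2 : th <= pi / 2).

(** [2 cosh (a xi) + 2 cos th], where [xi] is the complex logarithm of the
    variable. *)
Definition chden (q : R * R) : R[i] :=
  Cexp ((a * q.1) +i* (a * q.2)) + Cexp ((- a * q.1) +i* (- a * q.2)) + (2 * cos th)%:C.

Lemma Re_chden (v t : R) :
  Re (chden (v, t)) = (expR (a * v) + expR (- a * v)) * cos (a * t) + 2 * cos th.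
Proof. by rewrite /chden !Re_add !Re_Cexp/= [- a * t]mulNr cosN; ring. Qed.

Lemma Im_chden (v t : R) :
  Im (chden (v, t)) = (expR (a * v) - expR (- a * v)) * sin (a * t).
Proof. by rewrite /chden !Im_add !Im_Cexp/= [- a * t]mulNr sinN; ring. Qed.

Lemma chden_cos_ge0 : 0 <= cos th.
Proof. by apply: cos_ge0_pihalf; rewrite th2 andbT; have p0 := pi_gt0 R; apply: le_trans th0; rewrite oppr_le0 divr_ge0// ltW. Qed.

(** The zeros nearest to the real line are at height [(pi - th) / a]; this is the
    width of the strip in which contours may be moved. *)
Lemma chden_neq0 (v t : R) : `|a * t| < pi - th -> chden (v, t) != 0.
Proof.
move=> atp; apply/eqP => E.
have := congr1 (@complex.Re R) E; have := congr1 (@complex.Im R) E; rewrite Re_chden Im_chden/=; clear E.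
have [t0 t2] := (th0, th2); have c0 := chden_cos_ge0; have e1 := expR_gt0 (a * v); have e2 := expR_gt0 (- a * v).
have cat : cos (a * t) = cos `|a * t|.
  by case: (ger0P (a * t)) => _; rewrite ?cosN.
move=> /eqP; rewrite mulf_eq0 subr_eq0 => /orP[/eqP ee|/eqP s0].
  have v0 : v = 0.
    have /expR_inj/eqP := ee; rewrite mulNr -subr_eq0 opprK -mulr2n mulrn_eq0/= mulf_eq0.
    by rewrite (gt_eqF a0)/= => /eqP.
  rewrite v0 !mulr0 expR0 => H; have p0 := pi_gt0 R.
  have : cos (pi - th) < cos `|a * t|.
    have at0 : 0 <= `|a * t| by exact: normr_ge0.
    rewrite ltr_cos ?in_itv//=; apply/andP; split; lra.
  rewrite cosB cospi sinpi mul0r addr0 mulN1r -cat; lra.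
have at0 : a * t = 0.
  apply/eqP; rewrite -normr_eq0; apply/negPn/negP => n0.
  have s : 0 < sin `|a * t|.
    apply: sin_gt0_pi; rewrite lt_def n0 normr_ge0/=; lra.
  move: s; case: (ger0P (a * t)) => _; rewrite ?sinN s0 ?oppr0 ltxx//.
by rewrite at0 cos0; lra.
Qed.

Lemma sqnorm_chden_ge (v t : R) :
  (expR (a * v) - expR (- a * v)) ^+ 2 / 2 - 4 <= sqnorm (chden (v, t)).
Proof.
rewrite /sqnorm Re_chden Im_chden.
have cs := cos2Dsin2 (a * t); have ct := cos2Dsin2 th; have s2 := sqr_ge0 (sin th).
have e1 := expR_gt0 (a * v); have e2 := expR_gt0 (- a * v).
move: (expR (a * v)) (expR (- a * v)) e1 e2 => x y x0 y0.
move: (cos (a * t)) (sin (a * t)) (cos th) (sin th) cs ct s2 => c s C S cs ct s2.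
have H2 : 0 <= (x - y) ^+ 2 * s ^+ 2 by rewrite mulr_ge0 ?sqr_ge0.
have H3 : (x - y) ^+ 2 = (x - y) ^+ 2 * c ^+ 2 + (x - y) ^+ 2 * s ^+ 2.
  by rewrite -mulrDr cs mulr1.
have H4 : 0 <= x * y * c ^+ 2 by apply: mulr_ge0; [apply: mulr_ge0; exact: ltW|exact: sqr_ge0].
have H5 : 0 <= ((x + y) * c + 2 * (2 * C)) ^+ 2 by exact: sqr_ge0.
rewrite H3; lra.
Qed.

Definition chden' (q : R * R) : R[i] :=
  a%:C * Cexp ((a * q.1) +i* (a * q.2)) + (- a)%:C * Cexp ((- a * q.1) +i* (- a * q.2)) + 0.

Lemma holomorphic_chden p : holomorphic_at chden chden' p.
Proof.
apply: holomorphicD; last exact: holomorphic_cst.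
by apply: holomorphicD; apply: holomorphic_Cexp; exact: holomorphic_linear.
Qed.

(** Away from the origin the hyperbolic cosine dominates, uniformly in the strip. *)
Lemma chden_far (v t : R) : 4 <= a * `|v| -> (a * `|v|) ^+ 2 / 4 <= sqnorm (chden (v, t)).
Proof.
move=> av; apply: le_trans (sqnorm_chden_ge v t).
have H (x : R) : 4 <= x -> x ^+ 2 <= (expR x - expR (- x)) ^+ 2.
  move=> x4; have e1 := expR_ge1Dx x.
  have e2 : expR (- x) <= 1 by rewrite -expR0 ler_expR; lra.
  by rewrite ler_pXn2r ?nnegrE//; lra.
have := H _ av.
have -> : (expR (a * `|v|) - expR (- (a * `|v|))) ^+ 2 = (expR (a * v) - expR (- a * v)) ^+ 2.
  rewrite mulNr; case: (ger0P v) => _ //.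
  by rewrite mulrN opprK -sqrrN opprB.
move: ((expR _ - _) ^+ 2) (a * `|v|) av => s x x4 xs.
have x16 : 16 <= x ^+ 2 by nra.
by lra.
Qed.

End kernel.

Section contour_shift.
Context {R : realType}.
Notation mu := (@lebesgue_measure R).
Notation Re := complex.Re.
Notation Im := complex.Im.

Lemma normr_Rintegral_itv (f : R -> R) (a b M : R) : a <= b ->
  {in `[a, b], continuous f} -> (forall x, a <= x <= b -> `|f x| <= M) ->
  `|\int[mu]_(x in `[a, b]) f x| <= M * (b - a).
Proof.
move=> ab cf fM.
have mab : measurable (`[a, b]%classic : set R) by exact: measurable_itv.
have i : mu.-integrable `[a, b] (EFin \o f).
  apply: continuous_compact_integrable; first exact: segment_compact.
  by apply: continuous_in_subspaceT => x; rewrite inE => xab; exact: cf.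
have ci (c : R) : mu.-integrable `[a, b] (EFin \o (fun=> c)).
  by apply: bounded_mfun_integrable_itv; exact: bounded_mfun_cst.
have cE (c : R) : \int[mu]_(x in `[a, b]) c = c * (b - a).
  rewrite Rintegral_cst//= lebesgue_measure_itv/= lte_fin.
  by move: ab; rewrite le_eqVlt => /orP[/eqP ->|ab]; [rewrite ltxx subrr|rewrite ab -EFinB].
have bd x : x \in `[a, b]%classic -> - M <= f x <= M.
  by rewrite inE/= in_itv/= -ler_norml => /fM.
rewrite ler_norml -mulNr -!cE; apply/andP; split; apply: le_Rintegral => //.
  by move=> x xab; have /andP[] := bd x (mem_set xab).
by move=> x xab; have /andP[] := bd x (mem_set xab).
Qed.

(** The vertical sides of the rectangle contribute at most their length times the
    decay of the integrand. *)
Lemma contour_bound_Im (F F' : R * R -> R[i]) (d0 d1 t0 t1 K N0 : R) (n : nat) :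
  d0 < t0 -> t0 < t1 -> t1 < d1 ->
  (forall v t : R, d0 < t < d1 -> holomorphic_at F F' (v, t)) ->
  (forall v t : R, t0 <= t <= t1 -> N0 <= `|v| -> `|Re (F (v, t))| <= K / `|v|) ->
  N0 <= n.+1%:R ->
  `|\int[mu]_(v in `[(- n.+1%:R), n.+1%:R]) Im (F (v, t1)) -
    \int[mu]_(v in `[(- n.+1%:R), n.+1%:R]) Im (F (v, t0))| <= 2 * K * n.+1%:R^-1 * (t1 - t0).
Proof.
move=> dt0 t01 t1d H far nN.
have n0 : - n.+1%:R < n.+1%:R :> R by apply: (@lt_trans _ _ 0); rewrite ?oppr_lt0.
have dd (t : R) : t0 <= t <= t1 -> d0 < t < d1.
  by move=> /andP[a b]; rewrite (lt_le_trans dt0 a) (le_lt_trans b t1d).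
rewrite (cauchy_Im n0 dt0 t01 t1d (fun v t _ => H v t)).
have cR (v t : R) : t \in `[t0, t1] -> {for t, continuous (fun t : R => Re (F (v, t)))}.
  by rewrite in_itv/= => /dd /(H v)[_ _ d _ _]; exact: has_derive_continuous d.
apply: normr_Rintegral_itv; first exact: ltW.
  by move=> t tt; apply: cvgB; exact: cR.
move=> t tt; have nn : `|n.+1%:R| = n.+1%:R :> R by rewrite ger0_norm.
have b1 := far n.+1%:R t tt; have b2 := far (- n.+1%:R) t tt.
rewrite normrN nn in b2; rewrite nn in b1.
apply: le_trans (ler_normB _ _) _.
have -> : 2 * K * n.+1%:R^-1 = K / n.+1%:R + K / n.+1%:R by ring.
by apply: lerD; [exact: b1|exact: b2].
Qed.

(** Moving a horizontal line of integration inside a strip of holomorphy. *)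
Lemma contour_shift_Re (F F' : R * R -> R[i]) (d0 d1 t0 t1 K N0 : R) :
  d0 < t0 -> t0 < t1 -> t1 < d1 ->
  (forall v t : R, d0 < t < d1 -> holomorphic_at F F' (v, t)) ->
  (forall v t : R, t0 <= t <= t1 -> N0 <= `|v| -> `|Im (F (v, t))| <= K / `|v|) ->
  \int[mu]_(v in `[(- n.+1%:R), n.+1%:R]) Re (F (v, t1)) -
  \int[mu]_(v in `[(- n.+1%:R), n.+1%:R]) Re (F (v, t0)) @[n --> \oo] --> (0 : R).
Proof.
move=> dt0 t01 t1d H far.
have iE (z : R[i]) : (0 +i* 1) * z = (- Im z) +i* Re z.
  by apply/eqP; rewrite eq_complex Re_mul Im_mul/= !mul0r !mul1r sub0r add0r !eqxx.
have h (n : nat) := @contour_bound_Im (fun q => (0 +i* 1) * F q) (fun q => 0 * F q + (0 +i* 1) * F' q)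
  d0 d1 t0 t1 K N0 n dt0 t01 t1d
  (fun v t td => holomorphicM (holomorphic_cst (0 +i* 1) (v, t)) (H v t td)).
have E t n : \int[mu]_(v in `[(- n.+1%:R), n.+1%:R]) Im ((0 +i* 1) * F (v, t)) =
    \int[mu]_(v in `[(- n.+1%:R), n.+1%:R]) Re (F (v, t)).
  by apply: eq_Rintegral => v _; rewrite iE.
have K' : 2 * K * n.+1%:R^-1 * (t1 - t0) @[n --> \oo] --> (0 : R).
  rewrite -[X in _ --> X](mul0r (t1 - t0)); apply: cvgMr_tmp.
  by rewrite -[X in _ --> X](mulr0 (2 * K)); apply: cvgMl_tmp; exact: cvg_harmonic.
apply/cvgrPdist_le => e e0; near=> n; rewrite sub0r normrN -!E.
apply: (@le_trans _ _ (2 * K * n.+1%:R^-1 * (t1 - t0))).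
  apply: h => [v t tt vN|]; first by rewrite iE/= normrN; exact: far.
  apply: (@le_trans _ _ n%:R); last by rewrite ler_nat.
  by near: n; exact: nbhs_infty_ger.
by near: n; exact: (cvgr_le _ K').
Unshelve. all: by end_near. Qed.

End contour_shift.

(** * Densities in logarithmic coordinates *)

Section log_density.
Context {R : realType}.
Notation PR := (probability (measurableTypeR R) R).
Notation mu := (@lebesgue_measure R).
Implicit Types (m : PR).

Let mexp : measurable_fun setT (expR : R -> R).
Proof. exact: measurable_expR. Qed.

Lemma window_exp (v1 v2 x : R) : window (expR v1) (expR v2) (expR x) = window v1 v2 x.
Proof. by rewrite /window !indicE !mem_setE !in_itv/= !ltr_expR !ler_expR. Qed.

Lemma Rintegral_indic_density (A : set R) (g : R -> R) : measurable A ->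
  \int[mu]_x (\1_A x * g x) = \int[mu]_(x in A) g x.
Proof.
move=> mA; rewrite [RHS]Rintegral_mkcond; apply: eq_Rintegral => x _.
by rewrite patchE indicE; case: ifPn => _; rewrite ?mul1r ?mul0r.
Qed.

Lemma Rintegral_window_mul (g : R -> R) v1 v2 : mu.-integrable setT (EFin \o g) ->
  \int[mu]_x (window v1 v2 x * g x) = \int[mu]_(x in `[v1, v2]) g x.
Proof.
move=> ig.
have E x : window v1 v2 x * g x =
    2^-1 * (\1_(`]v1, v2[%classic : set R) x * g x + \1_(`[v1, v2]%classic : set R) x * g x).
  by rewrite /window -mulrDl mulrAC mulrC.
under eq_Rintegral do rewrite E.
have i1 (A : set R) : measurable A -> mu.-integrable setT (EFin \o (fun x => \1_A x * g x)).
  by move=> mA; apply: integrable_bounded_density => //; exact: bounded_mfun_indic.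
rewrite RintegralZl//; last first.
  under [X in integrable _ _ X]eq_fun do rewrite /= EFinD.
  by apply: integrableD => //; exact: i1.
rewrite RintegralD//; [|exact: i1|exact: i1].
rewrite !Rintegral_indic_density//.
rewrite Rintegral_itv_bndo_bndc; last exact: integrableS ig.
rewrite Rintegral_itv_obnd_cbnd; last exact: integrableS ig.
by field.
Qed.

Lemma Rintegral_window_density (g : R -> R) v1 v2 : mu.-integrable setT (EFin \o g) ->
  \int[mu]_x (window (expR v1) (expR v2) (expR x) * g x) = \int[mu]_(x in `[v1, v2]) g x.
Proof.
by move=> ig; under eq_Rintegral do rewrite window_exp; exact: Rintegral_window_mul.
Qed.

Lemma Rintegral_window_neg (h : R -> R) v1 v2 :
  \int[mu]_x (window (expR v1) (expR v2) (- expR x) * h x) = 0.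
Proof.
have E x : window (expR v1) (expR v2) (- expR x) * h x = 0.
  rewrite /window !indicE !mem_setE !in_itv/=.
  have e1 := expR_gt0 x; have e2 := expR_gt0 v1.
  rewrite [_ < - _]ltNge [_ <= - _]leNgt.
  have a : - expR x < expR v1 by apply: (@lt_trans _ _ 0); rewrite ?oppr_lt0.
  by rewrite a (ltW a)/= addr0 !mul0r.
by under eq_Rintegral do rewrite E; rewrite Rintegral_cst// mul0r.
Qed.

Lemma expR_succ_cvgy (t : R) : \forall n \near \oo, t < expR n.+1%:R.
Proof.
near=> n; apply: (@lt_le_trans _ _ n.+1%:R).
  by apply: (@lt_trans _ _ n%:R); rewrite ?ltr_nat//; near: n; exact: nbhs_infty_gtr.
by apply: le_trans (expR_ge1Dx _); rewrite lerDr.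
Unshelve. all: by end_near. Qed.

Lemma cvg_window_gt0 m :
  \int[m]_t window (expR (- n.+1%:R)) (expR n.+1%:R) t @[n --> \oo]
    --> fine (m `]0, +oo[%classic).
Proof.
rewrite -Rintegral_indic//=.
apply: cvg_window => //.
- move=> t; rewrite /= in_itv/= andbT => t0; near=> n; apply/andP; split.
    rewrite expRN -[t]invrK ltf_pV2 ?posrE ?invr_gt0 ?expR_gt0//.
    near: n; exact: expR_succ_cvgy.
  near: n; exact: expR_succ_cvgy.
- move=> t; rewrite /= in_itv/= andbT => /negP; rewrite -leNgt => t0.
  by near=> n; left; apply: le_lt_trans t0 _; exact: expR_gt0.
Unshelve. all: by end_near. Qed.

Lemma integral_log_density m (g : R -> R) : bounded_mfun g -> (forall v, 0 <= g v) ->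
  (forall v1 v2, v1 < v2 -> \int[m]_t window (expR v1) (expR v2) t =
     \int[mu]_(v in `[v1, v2]) g v) ->
  (\int[mu]_v (g v)%:E)%E = m `]0, +oo[%classic.
Proof.
move=> bg g0 H; have mg : measurable_fun setT g by case: bg.
pose D (n : nat) : set R := `[(- n.+1%:R), n.+1%:R]%classic.
have c1 := cvg_integral_symmetric mg g0.
have E n : (\int[mu]_(x in D n) (g x)%:E)%E =
    (\int[m]_t window (expR (- n.+1%:R)) (expR n.+1%:R) t)%:E.
  rewrite H; last by apply: (@lt_trans _ _ 0); rewrite ?oppr_lt0.
  rewrite fineK//; apply: integrable_fin_num; first exact: measurable_itv.
  exact: bounded_mfun_integrable_itv.
have mfin : m `]0, +oo[%classic \is a fin_num by exact: fin_num_measure.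
rewrite -(fineK mfin).
have c2 : ((\int[m]_t window (expR (- n.+1%:R)) (expR n.+1%:R) t)%:E @[n --> \oo]
    --> (fine (m `]0, +oo[%classic))%:E)%E.
  by apply: cvg_EFin; [apply: nearW|exact: cvg_window_gt0].
move: c1; under eq_fun do rewrite E; move=> c1.
exact: (cvg_unique _ c1 c2).
Qed.

(** A law without atom at the origin is determined by its windows: here they
    are the integrals of a density in the logarithmic coordinate. *)
Theorem log_density m (g h : R -> R) : bounded_mfun g -> bounded_mfun h ->
  (forall v, 0 <= g v) -> (forall v, 0 <= h v) -> m [set 0] = 0%E ->
  (forall v1 v2, v1 < v2 -> \int[m]_t window (expR v1) (expR v2) t =
     \int[mu]_(v in `[v1, v2]) g v) ->
  (forall v1 v2, v1 < v2 -> \int[reflection m]_t window (expR v1) (expR v2) t =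
     \int[mu]_(v in `[v1, v2]) h v) ->
  [/\ mu.-integrable setT (EFin \o g), mu.-integrable setT (EFin \o h) &
   forall f : R -> R, bounded_mfun (f : measurableTypeR R -> R) ->
     \int[m]_x f x = \int[mu]_v (f (expR v) * g v) + \int[mu]_v (f (- expR v) * h v)].
Proof.
move=> bg bh g0 h0 m0 Hg Hh.
have mg : measurable_fun setT g by case: bg.
have mh : measurable_fun setT h by case: bh.
have ig := integral_log_density bg g0 Hg; have ih := integral_log_density bh h0 Hh.
have ihE : reflection m `]0, +oo[%classic = m `]-oo, 0[%classic.
  rewrite /reflection /distribution /pushforward; congr (m _).
  by apply/seteqP; split => x/=; rewrite !in_itv/= andbT /neg_fun oppr_gt0.
have total : (\int[mu]_v (g v)%:E + \int[mu]_v (h v)%:E = 1)%E.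
  rewrite ig ih ihE -(@probability_setT _ _ _ m).
  have -> : [set: measurableTypeR R] = `]0, +oo[%classic `|` (`]-oo, 0[%classic `|` [set (0 : R)]).
    apply/seteqP; split => // x _ /=; rewrite !in_itv/= andbT.
    by have [xl|xg|->] := ltgtP (x : R) 0; [right; left|left|right; right].
  have m1 : measurable (`]0, +oo[%classic : set (measurableTypeR R)) by exact: measurable_itv.
  have m2 : measurable (`]-oo, 0[%classic : set (measurableTypeR R)) by exact: measurable_itv.
  have m3 : measurable ([set (0 : R)] : set (measurableTypeR R)) by exact: measurable_set1.
  rewrite measureU//; last 2 first.
  - exact: measurableU.
  - apply/seteqP; split => // x []/=; rewrite !in_itv/= andbT => x0 [x1|x1].
      by have := lt_trans x0 x1; rewrite ltxx.
    by move: x0; rewrite x1 ltxx.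
  rewrite (measureU m m2 m3); first by congr (_ + _)%E; apply/esym; apply: etrans (adde0 _); congr (_ + _)%E; exact: m0.
  by apply/seteqP; split => // x []/=; rewrite !in_itv/= => x0 x1; move: x0; rewrite x1 ltxx.
have int1 (w : R -> R) : measurable_fun setT w -> (forall x, 0 <= w x) ->
    (\int[mu]_x (w x)%:E <= 1)%E -> mu.-integrable setT (EFin \o w).
  move=> mw w0 w1; apply/integrableP; split; first exact/measurable_EFinP.
  under eq_integral do rewrite /= ger0_norm//.
  by apply: (le_lt_trans w1); rewrite ltry.
have Ig : mu.-integrable setT (EFin \o g) by apply: int1 => //; rewrite ig probability_le1.
have Ih : mu.-integrable setT (EFin \o h) by apply: int1 => //; rewrite ih probability_le1.
split => // f bf.
have mN : measurable_fun setT (fun v : R => - expR v) by exact: measurableT_comp.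
have [p pE] := @exists_law R _ _ mu (@expR R) (fun v => - expR v) g h mexp mN mg mh g0 h0 total.
apply: etrans (pE f bf); move: f bf; apply/(same_lawP m p).
apply: same_law_windows => v1 v2 v12.
  rewrite Hg// pE; last exact: bounded_window.
  by rewrite Rintegral_window_density// Rintegral_window_neg addr0.
rewrite Hh// Rintegral_reflection; last exact: bounded_window.
rewrite pE; last first.
  by apply: (bounded_mfun_comp (bounded_window _ _)); exact: measurable_neg_fun.
rewrite Rintegral_window_neg add0r.
by under [RHS]eq_Rintegral do rewrite opprK; rewrite Rintegral_window_density.
Qed.

End log_density.

(** * Densities of Boolean stable laws *)

Section stable_densities.
Context {R : realType}.
Notation PR := (probability (measurableTypeR R) R).
Notation mu := (@lebesgue_measure R).
Notation Re := complex.Re.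
Notation Im := complex.Im.
Implicit Types (m b : PR).

Lemma polar_neq0 (v w : R) : polar v w != 0.
Proof.
apply/eqP => -[/eqP]; rewrite mulf_eq0 gt_eqF ?expR_gt0//= => /eqP c0.
move=> /eqP; rewrite mulf_eq0 gt_eqF ?expR_gt0//= => /eqP s0.
by have := cos2Dsin2 w; rewrite c0 s0 expr0n/= addr0 => /eqP; rewrite eq_sym oner_eq0.
Qed.

Lemma polarM (v w v' w' : R) : polar v w * polar v' w' = polar (v + v') (w + w').
Proof.
apply/eqP; rewrite eq_complex Re_mul Im_mul /= expRD cosD sinD.
by apply/andP; split; apply/eqP; ring.
Qed.

Lemma polarV (v w : R) : (polar v w)^-1 = polar (- v) (- w).
Proof.
apply: (mulfI (polar_neq0 v w)); rewrite mulfV ?polar_neq0// polarM !subrr.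
by rewrite /polar expR0 cos0 sin0 !mulr1 mulr0.
Qed.

Lemma Cexp_polar (x : R[i]) : Cexp x = polar (Re x) (Im x).
Proof. by apply/eqP; rewrite eq_complex Re_Cexp Im_Cexp !eqxx. Qed.

Lemma normc_polar (v w : R) : Normc.normc (polar v w) = expR v.
Proof.
rewrite /Normc.normc/= !exprMn -mulrDr cos2Dsin2 mulr1 sqrtr_sqr.
by rewrite gtr0_norm ?expR_gt0.
Qed.

Lemma Carg_polar (v w : R) : - pi < w < pi -> Carg (polar v w) = w.
Proof.
move=> /andP[w1 w2]; rewrite /Carg normc_polar /= pmulr_rge0 ?expR_gt0//.
rewrite mulrC mulrA mulVf ?gt_eqF ?expR_gt0// mul1r.
have [w0|w0] := leP 0 w.
  by rewrite sin_ge0_pi ?w0 ?ltW// cosK// in_itv/= w0 ltW.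
have s0 : sin w < 0 by rewrite -[w]opprK sinN oppr_lt0 sin_gt0_pi// oppr_gt0 w0/= ltrNl.
rewrite leNgt s0/= -cosN cosK ?opprK// in_itv/= oppr_ge0 (ltW w0)/=.
by rewrite lerNl ltW.
Qed.

Lemma Cpow_polar (v w a : R) : - pi < w < pi -> Cpow (polar v w) a%:C = polar (a * v) (a * w).
Proof.
move=> w1; rewrite /Cpow /Clog Carg_polar// normc_polar expRK Cexp_polar Re_mul Im_mul/=.
by rewrite !mul0r subr0 addr0.
Qed.

(** The Cauchy transform of a Boolean stable law, in polar coordinates. *)
Lemma boolean_stable_cauchy (a r : R) b v w : is_boolean_stable a r b ->
  0 <= r <= 1 -> 0 < w < pi ->
  polar v w * cauchy_transform b (polar v w) =
  (1 + polar (- (a * v)) (a * (r * pi - w)))^-1.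
Proof.
move=> H /andP[r0 r1] /andP[w0 w1].
have z0 : Im (polar (- v) (- w)) < 0.
  by rewrite /= sinN mulrN oppr_lt0 mulr_gt0 ?expR_gt0// sin_gt0_pi// w0.
have := H _ z0; rewrite /eta_transform /F_transform polarV !opprK.
have -> : Cexp (0 +i* (r * pi)) * polar (- v) (- w) = polar (- v) (r * pi - w).
  by rewrite Cexp_polar/= polarM add0r.
have p0 := pi_gt0 R.
have rp : 0 <= r * pi <= pi by apply/andP; split; [exact: mulr_ge0 r0 (ltW p0)|exact: ler_piMl (ltW p0) r1].
rewrite Cpow_polar; last by apply/andP; split; lra.
move: (cauchy_transform b (polar v w)) => G E; rewrite mulrN in E.
rewrite -[G]invrK -[polar v w]invrK polarV -invfM; congr (_^-1).
by rewrite [LHS](_ : _ = 1 - (1 - polar (- v) (- w) * G^-1));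
  [rewrite E opprK|rewrite opprB addrC subrK].
Qed.

Definition stable_kernel (a v w : R) : R :=
  sin w / (expR (a * v) + expR (- (a * v)) + 2 * cos w).

Lemma stable_kernel_den (a v w : R) : 0 <= cos w ->
  1 <= expR (a * v) + expR (- (a * v)) + 2 * cos w.
Proof.
move=> c0; have e1 := expR_ge1Dx (a * v); have e2 := expR_ge1Dx (- (a * v)); lra.
Qed.

Lemma stable_kernel_bound (a v w : R) : 0 <= cos w -> `|stable_kernel a v w| <= 1.
Proof.
move=> c0; have d1 := stable_kernel_den a v c0.
have d0 : 0 < expR (a * v) + expR (- (a * v)) + 2 * cos w by apply: lt_le_trans d1.
rewrite /stable_kernel normrM normfV (gtr0_norm d0) ler_pdivrMr// mul1r.
exact: le_trans (sin_max w) d1.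
Qed.

Lemma stable_kernel_ge0 (a v w : R) : 0 <= w <= pi / 2 -> 0 <= stable_kernel a v w.
Proof.
move=> /andP[w0 w1]; have p0 := pi_gt0 R.
have c0 : 0 <= cos w by apply: cos_ge0_pihalf; apply/andP; split; lra.
apply: divr_ge0; first by apply: sin_ge0_pi; apply/andP; split; lra.
exact: le_trans (stable_kernel_den a v c0).
Qed.

Lemma measurable_stable_kernel (a w : R) :
  measurable_fun setT (fun v => stable_kernel a v w).
Proof.
have me c : measurable_fun setT (fun v : R => expR (c * v)).
  by apply: measurableT_comp => //; exact: measurable_funM.
apply: measurable_funM => //; apply: (measurableT_comp measurable_inv).
apply: measurable_funD => //; apply: measurable_funD => //.
by have := me (- a); under eq_fun do rewrite mulNr.
Qed.

Definition stable_stieltjes (a r : R) m := forall v w, 0 < w < pi ->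
  polar_stieltjes m v w = stable_kernel a v (a * (r * pi - w)).

Lemma boolean_stable_stieltjes (a r : R) b : is_boolean_stable a r b ->
  0 <= r <= 1 -> stable_stieltjes a r b.
Proof.
move=> H r01 v w w0; rewrite polar_stieltjesE// (boolean_stable_cauchy v H r01 w0).
rewrite Im_inv Re_add Im_add/= add0r mulNr opprK /stable_kernel expRN.
have e0 := expR_gt0 (a * v).
move: (a * (r * pi - w)) (expR (a * v)) e0 => p e e0.
have [s0|s0] := eqVneq (sin p) 0; first by rewrite s0 mulr0 !mul0r.
have cs := cos2Dsin2 p.
have -> : (1 + e^-1 * cos p) ^+ 2 + (e^-1 * sin p) ^+ 2 = e^-1 * (e + e^-1 + 2 * cos p).
  have e1 : e != 0 by rewrite gt_eqF.
  transitivity (1 + 2 * e^-1 * cos p + e^-1 ^+ 2 * (cos p ^+ 2 + sin p ^+ 2)); first by ring.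
  by rewrite cs; field.
by rewrite -mulf_div divff ?mul1r// invr_eq0 gt_eqF.
Qed.

Lemma stable_stieltjes_reflection (a r : R) m : stable_stieltjes a r m ->
  stable_stieltjes a (1 - r) (reflection m).
Proof.
move=> H v w w0; have w1 : 0 < pi - w < pi by move: w0 => /andP[? ?]; apply/andP; split; lra.
rewrite /polar_stieltjes Rintegral_reflection; last exact: bounded_polar_kernel.
have E t : polar_kernel v w (- t) = - polar_kernel v (pi - w) t.
  rewrite /polar_kernel /polar_den.
  have -> : sin (pi - w) = sin w by rewrite sinB sinpi cospi; ring.
  have -> : cos (pi - w) = - cos w by rewrite cosB sinpi cospi; ring.
  by rewrite -mulNr !mulNr mulrN opprK -[(- (t * sin w)) ^+ 2]sqrrN !opprK.
under eq_Rintegral do rewrite E.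
rewrite bRintegralN; last exact: bounded_polar_kernel.
have -> : \int[m]_x polar_kernel v (pi - w) x = _ := H v (pi - w) w1.
have -> : a * (r * pi - (pi - w)) = - (a * ((1 - r) * pi - w)) by ring.
by rewrite /stable_kernel sinN cosN mulNr opprK.
Qed.

Lemma stable_windows (a r : R) m : stable_stieltjes a r m -> 0 < a <= 1 ->
  0 <= a * (r * pi) <= pi / 2 ->
  forall v1 v2, v1 < v2 -> \int[m]_t window (expR v1) (expR v2) t =
     \int[mu]_(v in `[v1, v2]) (pi^-1 * stable_kernel a v (a * (r * pi))).
Proof.
move=> H /andP[a0 a1] /andP[t0 t1] v1 v2 v12.
have p0 := pi_gt0 R; have p2 := pi_ge2 R.
have c1 := @polar_inversion _ m _ _ v12.
have E n : \int[mu]_(v in `[v1, v2]) polar_stieltjes m v (small_angle n) =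
    \int[mu]_(v in `[v1, v2]) stable_kernel a v (a * (r * pi - small_angle n)).
  by apply: eq_Rintegral => v _; rewrite H// small_angle_bound.
have cn n : 0 <= cos (a * (r * pi - small_angle n)).
  have /andP[s0 _] := @small_angle_bound R n.
  have s1 : small_angle n <= 1 :> R by rewrite invf_le1// ler1n.
  have as1 : a * small_angle n <= 1 by rewrite mulr_ile1// ltW.
  have as0 : 0 <= a * small_angle n by rewrite mulr_ge0 ?ltW.
  by apply: cos_ge0_pihalf; rewrite mulrBr; apply/andP; split; lra.
have c0 : 0 <= cos (a * (r * pi)) by apply: cos_ge0_pihalf; apply/andP; split; lra.
have c2 : \int[mu]_(v in `[v1, v2]) stable_kernel a v (a * (r * pi - small_angle n)) @[n --> \oo]
    --> \int[mu]_(v in `[v1, v2]) stable_kernel a v (a * (r * pi)).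
  apply: (@bounded_cvg_Rintegral_itv _ _ _ _ _ 1).
  - by move=> n; exact: measurable_stable_kernel.
  - exact: measurable_stable_kernel.
  - by move=> n v; exact: stable_kernel_bound.
  - by move=> v; exact: stable_kernel_bound.
  - move=> v; have h : a * (r * pi - small_angle n) @[n --> \oo] --> a * (r * pi).
      have h : r * pi - small_angle n @[n --> \oo] --> r * pi - 0.
        by apply: cvgB; [exact: cvg_cst|exact: small_angle_cvg].
      by rewrite subr0 in h; apply: cvgMl_tmp; exact: h.
    rewrite /stable_kernel; apply: cvgM.
      exact: (cvg_comp _ _ h (@continuous_sin R _)).
    apply: cvgV; first by rewrite gt_eqF// (lt_le_trans ltr01)// stable_kernel_den.
    apply: cvgD; first exact: cvg_cst.
    by apply: cvgMl_tmp; exact: (cvg_comp _ _ h (@continuous_cos R _)).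
have e : pi * \int[m]_t window (expR v1) (expR v2) t =
    \int[mu]_(v in `[v1, v2]) stable_kernel a v (a * (r * pi)).
  exact: (cvg_unique _ (cvg_ext E c1) c2).
rewrite RintegralZl//; last first.
  apply: bounded_mfun_integrable_itv; split; first exact: measurable_stable_kernel.
  by exists 1 => v; exact: stable_kernel_bound.
by rewrite -e mulrA mulVf ?gt_eqF// mul1r.
Qed.

Lemma boolean_stable_atom0 (a r : R) b : is_boolean_stable a r b ->
  0 < a <= 1 -> 0 <= r <= 1 -> b [set 0] = 0%E.
Proof.
move=> H /andP[a0 a1] /andP[r0 r1]; have p0 := pi_gt0 R.
have w0 : 0 < (pi / 2 : R) < pi.
  by apply/andP; split; lra.
have mS : measurable ([set 0] : set (measurableTypeR R)) by exact: measurable_set1.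
pose q := \int[b]_x \1_[set 0] x.
have qE : b [set 0] = q%:E by rewrite /q Rintegral_indic.
have q0 : 0 <= q by rewrite -lee_fin -qE.
have key v : q <= expR (a * v).
  have y0 : 0 < expR v by exact: expR_gt0.
  have pE : polar v (pi / 2) = 0 +i* expR v by rewrite /polar cos_pihalf sin_pihalf mulr0 mulr1.
  have le1 : q <= expR v * \int[b]_x cauchy_im 0 (expR v) x.
    have bc : bounded_mfun (cauchy_im 0 (expR v) : measurableTypeR R -> R).
      exact: bounded_cauchy_im.
    rewrite -bRintegralZl//; apply: ble_Rintegral.
    - exact: bounded_mfun_indic.
    - by apply: bounded_mfunM => //; exact: bounded_mfun_cst.
    - move=> x; rewrite indicE /cauchy_im; have d0 := cauchy_den_gt0 0 x y0.
      have [->|x0] := eqVneq (x : R) 0.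
        rewrite mem_set//= subrr expr0n/= add0r mulrA -expr2 divff// expf_neq0// gt_eqF//.
      by rewrite memNset; [rewrite mulr_ge0 ?divr_ge0// ltW|move=> /= x1; rewrite x1 eqxx in x0].
  have := boolean_stable_cauchy v H (introT andP (conj r0 r1)) w0.
  move=> /(congr1 (@complex.Re R)); rewrite pE cauchy_transformE// Re_mul/= mul0r sub0r mulrN opprK.
  rewrite add0r => F.
  apply: (le_trans le1); rewrite F.
  have c0 : 0 <= cos (a * (r * pi - pi / 2)).
    have h1 : `|r * pi - pi / 2| <= pi / 2.
      have rp : 0 <= r * pi <= pi by apply/andP; split; [exact: mulr_ge0 r0 (ltW p0)|exact: ler_piMl (ltW p0) r1].
      by rewrite ler_norml; apply/andP; split; lra.
    have h2 : `|a * (r * pi - pi / 2)| <= pi / 2.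
      by rewrite normrM (gtr0_norm a0); apply: le_trans h1; rewrite ler_piMl.
    by apply: cos_ge0_pihalf; rewrite -ler_norml.
  have cs := cos2Dsin2 (a * (r * pi - pi / 2)).
  have e0 := expR_gt0 (a * v); rewrite expRN.
  move: (cos _) (sin _) (expR (a * v)) c0 cs e0 => c s e c0 cs e0.
  have i0 : 0 < e^-1 by rewrite invr_gt0.
  have -> : (1 + e^-1 * c) ^+ 2 + (e^-1 * s) ^+ 2 = e^-1 * (e + 2 * c + e^-1).
    have e1 : e != 0 by rewrite gt_eqF.
    transitivity (1 + 2 * e^-1 * c + e^-1 ^+ 2 * (c ^+ 2 + s ^+ 2)); first by ring.
    by rewrite cs; field.
  have D : 0 < e + 2 * c + e^-1 by lra.
  rewrite ler_pdivrMr; last exact: mulr_gt0.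
  rewrite mulrA divff ?gt_eqF// mul1r.
  have c1 : c <= 1 by have := sqr_ge0 s; nra.
  have ee : e * e^-1 = 1 by rewrite divff// gt_eqF.
  nra.
have cv : expR (a * - n.+1%:R) @[n --> \oo] --> (0 : R).
  apply/cvgr0Pnorm_lt => e e0; near=> n.
  rewrite gtr0_norm ?expR_gt0// mulrN expRN -[e]invrK ltf_pV2 ?posrE ?expR_gt0 ?invr_gt0//.
  apply: (@lt_le_trans _ _ (a * n.+1%:R)); last by apply: le_trans (expR_ge1Dx _); rewrite lerDr.
  rewrite mulrC -ltr_pdivrMr//.
  by apply: (@lt_trans _ _ n%:R); rewrite ?ltr_nat//; near: n; exact: nbhs_infty_gtr.
rewrite qE; congr EFin; apply/eqP; rewrite eq_le q0 andbT.
by apply: (cvgr_to_ge cv); apply: nearW => n.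
Unshelve. all: by end_near. Qed.

(** Stieltjes inversion: the Cauchy transform is explicit up to the real line,
    where the imaginary part of its boundary values is the density. *)
Theorem boolean_stable_density (a r : R) b : is_boolean_stable a r b ->
  0 < a <= 1 -> 0 <= r <= 1 -> a * (r * pi) <= pi / 2 -> a * ((1 - r) * pi) <= pi / 2 ->
  let g v := pi^-1 * stable_kernel a v (a * (r * pi)) in
  let h v := pi^-1 * stable_kernel a v (a * ((1 - r) * pi)) in
  [/\ mu.-integrable setT (EFin \o g), mu.-integrable setT (EFin \o h) &
   forall f : R -> R, bounded_mfun (f : measurableTypeR R -> R) ->
     \int[b]_x f x = \int[mu]_v (f (expR v) * g v) + \int[mu]_v (f (- expR v) * h v)].
Proof.
move=> H a01 r01 t1 t2 g h; have p0 := pi_gt0 R.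
have [/andP[a0 a1] /andP[r0 r1]] := (a01, r01).
have T1 : 0 <= a * (r * pi) <= pi / 2.
  rewrite t1 andbT; apply: mulr_ge0; [exact: ltW|exact: mulr_ge0 r0 (ltW p0)].
have T2 : 0 <= a * ((1 - r) * pi) <= pi / 2.
  rewrite t2 andbT; apply: mulr_ge0; first exact: ltW.
  by apply: mulr_ge0; [rewrite subr_ge0|exact: ltW].
have St := boolean_stable_stieltjes H r01.
have bk t : 0 <= t <= pi / 2 -> bounded_mfun (fun v => pi^-1 * stable_kernel a v t).
  move=> /andP[tt0 tt1]; apply: bounded_mfunM; first exact: bounded_mfun_cst.
  split; first exact: measurable_stable_kernel.
  exists 1 => v; apply: stable_kernel_bound; apply: cos_ge0_pihalf; apply/andP; split; lra.
apply: log_density.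
- exact: bk.
- exact: bk.
- by move=> v; apply: mulr_ge0; [rewrite invr_ge0 ltW|exact: stable_kernel_ge0].
- by move=> v; apply: mulr_ge0; [rewrite invr_ge0 ltW|exact: stable_kernel_ge0].
- exact: boolean_stable_atom0 H a01 r01.
- exact: stable_windows St a01 T1.
- exact: stable_windows (stable_stieltjes_reflection St) a01 T2.
Qed.

End stable_densities.

(** * The triangle function *)

Section triangle_charf.
Context {R : realType}.
Notation PR := (probability (measurableTypeR R) R).
Notation mu := (@lebesgue_measure R).
Notation mass := (@triangle_mass R).

Lemma integral_translation (f : R -> R) (a : R) : continuous f -> (forall v, 0 <= f v) ->
  \int[mu]_v f (v + a) = \int[mu]_v f v.
Proof.
move=> cf f0; rewrite /Rintegral; congr fine; apply/esym.
have dF (v : R) : is_derive v 1 (fun v : R => v + a) (1 : R).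
  by diff; rewrite /= addr0.
have F1 : derive1 (fun v : R => v + a) = fun=> (1 : R).
  by apply/funext => v; rewrite derive1E; apply: derive_val.
rewrite (@increasing_ge0_integration_by_substitutionT _ (fun v : R => v + a) f)//.
- apply: eq_integral => v _; rewrite F1 /=; congr EFin.
  by rewrite /GRing.mul_fun/= mulr1.
- by move=> x y xy; rewrite ltrD2r.
- by rewrite F1 => v; exact: cvg_cst.
- by rewrite F1; exact: is_cvg_cst.
- by rewrite F1; exact: is_cvg_cst.
- apply/cvgrNyPle => A; near=> v.
  rewrite -lerBrDr; near: v; apply: nbhs_ninfty_le; exact: num_real.
- apply/cvgryPge => A; near=> v.
  rewrite -lerBlDr; near: v; apply: nbhs_pinfty_ge; exact: num_real.
Unshelve. all: by end_near. Qed.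

Lemma Rintegral_triangle_kernel (s : R) : \int[mu]_v triangle_kernel s v = `|s| * mass.
Proof.
wlog s0 : s / 0 < s => [W|].
  have [s0|s0|->] := ltgtP s 0.
  - have sn : 0 < - s by rewrite oppr_gt0.
    rewrite -normrN -(W _ sn); apply: eq_Rintegral => v _.
    by rewrite /triangle_kernel mulNr cosN.
  - exact: W.
  - rewrite normr0 mul0r; under eq_Rintegral do rewrite /triangle_kernel mul0r cos0 subrr mul0r.
    by rewrite Rintegral_cst// mul0r.
rewrite (gtr0_norm s0) /triangle_mass -RintegralZl//; last exact: integrable_triangle_kernel.
rewrite -(@integral_translation (fun v => s * triangle_kernel 1 v) (ln s)).
- apply: eq_Rintegral => v _; rewrite /triangle_kernel mul1r opprD !expRD lnK ?posrE//.
  by rewrite [expR (- ln s)]expRN lnK ?posrE// [expR v * s]mulrC; field; rewrite gt_eqF.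
- move=> v; apply: cvgMl_tmp; exact: continuous_triangle_kernel.
- by move=> v; rewrite mulr_ge0 ?triangle_kernel_ge0 ?ltW.
Qed.

(** The law whose characteristic function is the triangle function. *)
Lemma exists_triangle_law : exists p : PR, forall t,
  charf p t = (Num.max 0 (1 - `|t|))%:C.
Proof.
have m0 := @triangle_mass_gt0 R.
pose w v := (2 * mass)^-1 * triangle_kernel 1 v.
have cw : continuous w.
  by move=> v; apply: cvgMl_tmp; exact: continuous_triangle_kernel.
have mw : measurable_fun setT w by exact: continuous_measurable_fun.
have w0 v : 0 <= w v by rewrite mulr_ge0 ?triangle_kernel_ge0// invr_ge0 mulr_ge0// ltW.
have ik s := @integrable_triangle_kernel R s.
have iw : mu.-integrable setT (EFin \o w).
  under [X in integrable _ _ X]eq_fun do rewrite /= EFinM.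
  by apply: integrableZl => //; exact: ik.
have Iw : \int[mu]_v w v = 2^-1.
  by rewrite /w RintegralZl// -/mass; field; rewrite gt_eqF.
have tot : (\int[mu]_x (w x)%:E + \int[mu]_x (w x)%:E = 1)%E.
  have wf := integrable_fin_num measurableT iw.
  by rewrite -[X in (X + X)%E](fineK wf) -EFinD; congr EFin; move: Iw; rewrite /Rintegral => ->; field.
have mN : measurable_fun setT (fun v : R => - expR v) by exact: measurableT_comp.
have [p pE] := @exists_law R _ _ mu (@expR R) (fun v => - expR v) w w
  (@measurable_expR R) mN mw mw w0 w0 tot.
exists p => t; rewrite /charf !pE; [|exact: bsin|exact: bcos].
have bs (g : R -> R) : bounded_mfun g -> mu.-integrable setT (EFin \o (fun v => g v * w v)).
  by move=> bg; exact: integrable_bounded_density.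
have me : measurable_fun setT (fun v : R => t * expR v) by exact: measurable_funM.
apply/eqP; rewrite eq_complex/=; apply/andP; split; apply/eqP; last first.
  under [X in _ + X]eq_Rintegral do rewrite mulrN sinN mulNr -mulN1r.
  rewrite RintegralZl//; first by rewrite mulN1r subrr.
  by apply: (bs (fun v => sin (t * expR v))); exact: (bounded_mfun_sin me).
under [X in _ + X]eq_Rintegral do rewrite mulrN cosN.
have E v : cos (t * expR v) * w v = (2 * mass)^-1 * 2^-1 *
    (triangle_kernel (t + 1) v + triangle_kernel (t - 1) v - 2 * triangle_kernel t v).
  rewrite /w /triangle_kernel mul1r.
  have -> : (t + 1) * expR v = t * expR v + expR v by ring.
  have -> : (t - 1) * expR v = t * expR v - expR v by ring.
  rewrite (cosD (t * expR v) (expR v)) (cosB (t * expR v) (expR v)).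
  by field; rewrite gt_eqF.
under eq_Rintegral do rewrite E.
have i1 : mu.-integrable setT (EFin \o (fun v => triangle_kernel (t + 1) v + triangle_kernel (t - 1) v)).
  by under [X in integrable _ _ X]eq_fun do rewrite /= EFinD; apply: integrableD => //; exact: ik.
have i2 : mu.-integrable setT (EFin \o (fun v => 2 * triangle_kernel t v)).
  by under [X in integrable _ _ X]eq_fun do rewrite /= EFinM; apply: integrableZl => //; exact: ik.
have i3 : mu.-integrable setT (EFin \o (fun v => triangle_kernel (t + 1) v + triangle_kernel (t - 1) v - 2 * triangle_kernel t v)).
  by under [X in integrable _ _ X]eq_fun do rewrite /= EFinB; apply: integrableB => //.
rewrite RintegralZl// RintegralB// RintegralD// RintegralZl// !Rintegral_triangle_kernel.
transitivity ((`|t + 1| + `|t - 1|) / 2 - `|t|); first by field; rewrite gt_eqF.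
have [t1|t1] := leP `|t| 1.
  rewrite (max_r _) ?subr_ge0//; move: t1; rewrite ler_norml => /andP[t1 t2].
  rewrite (ger0_norm (_ : 0 <= t + 1)) ?(ler0_norm (_ : t - 1 <= 0)); lra.
rewrite (max_l _) ?subr_le0 ?ltW//; move: t1; rewrite ltr_normr => /orP[t1|t1].
  rewrite (ger0_norm (_ : 0 <= t + 1)) ?(ger0_norm (_ : 0 <= t - 1)) ?(ger0_norm (_ : 0 <= t)); lra.
rewrite (ler0_norm (_ : t + 1 <= 0)) ?(ler0_norm (_ : t - 1 <= 0)) ?(ler0_norm (_ : t <= 0)); lra.
Qed.

End triangle_charf.

(** * Pólya's criterion *)

Section cdf_laws.
Context {R : realType}.
Notation PR := (probability (measurableTypeR R) R).
Notation mu := (@lebesgue_measure R).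

Lemma exists_law_cdf (F : R -> R) : nondecreasing F -> right_continuous F ->
  F @ -oo --> (0 : R) -> F @ +oo --> (1 : R) ->
  exists p : PR, forall r, p `]-oo, r]%classic = (F r)%:E.
Proof.
move=> ndF rcF F0 F1.
pose G : cumulativeBounded (0 : R) (1 : R) :=
  HB.pack F (isCumulative.Build R _ R F ndF rcF) (isCumulativeBounded.Build R 0 1 F F0 F1).
exists (lebesgue_stieltjes_measure G : PR) => r.
have := cdf_lebesgue_stieltjes_id G r.
by rewrite /cdf /distribution /pushforward preimage_id.
Qed.

End cdf_laws.

Section supporting_slopes.
Context {R : realType}.
Notation PR := (probability (measurableTypeR R) R).
Notation mu := (@lebesgue_measure R).

(** A convex function with a continuous choice of supporting slopes is
    differentiable. *)
Lemma has_derive_slope (H F : R -> R) (x : R) : 0 < x ->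
  (forall u v : R, 0 < u -> 0 < v -> H u + F u * (v - u) <= H v) ->
  {for x, continuous F} -> is_derive x 1 H (F x).
Proof.
move=> x0 sl cF.
have c : h^-1 *: (H (h *: (1 : R) + x) - H x) @[h --> 0^'] --> F x.
  apply/cvgrPdist_le => e e0.
  have /cvgrPdist_le/(_ e e0) cF' := cF.
  have cx : h + x @[h --> (0 : R)] --> x.
    by rewrite -[X in _ --> X]add0r; apply: cvgD; [exact: cvg_id|exact: cvg_cst].
  have n1 : \forall h \near (0 : R), `|F x - F (h + x)| <= e by exact: cx cF'.
  have n2 : \forall h \near (0 : R), 0 < h + x by exact: (cvgr_gt x cx).
  near=> h.
  have h0 : h != 0 by near: h; exact: nbhs_dnbhs_neq.
  have a1 : `|F x - F (h + x)| <= e by near: h; exact: (nbhs_dnbhs n1).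
  have a2 : 0 < h + x by near: h; exact: (nbhs_dnbhs n2).
  have s1 := sl _ _ x0 a2; have s2 := sl _ _ a2 x0.
  rewrite /GRing.scale/= mulr1.
  have E : h + x - x = h by ring.
  have E' : x - (h + x) = - h by ring.
  rewrite E in s1; rewrite E' in s2.
  apply: le_trans a1.
  move: (H (h + x)) (H x) (F (h + x)) (F x) s1 s2 => p q r s s1 s2.
  have [hp|hn] := ltP 0 h.
    have i0 : 0 < h^-1 by rewrite invr_gt0.
    have b1 : s <= h^-1 * (p - q) by rewrite mulrC ler_pdivlMr//; lra.
    have b2 : h^-1 * (p - q) <= r by rewrite mulrC ler_pdivrMr//; lra.
    by rewrite ler0_norm ?ler0_norm; lra.
  have hn' : 0 < - h by rewrite oppr_gt0 lt_def eq_sym h0.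
  have -> : h^-1 * (p - q) = (q - p) / - h by rewrite invrN; ring.
  have b1 : (q - p) / - h <= s by rewrite ler_pdivrMr//; lra.
  have b2 : r <= (q - p) / - h by rewrite ler_pdivlMr//; lra.
  by rewrite ger0_norm ?ger0_norm; lra.
apply: DeriveDef; first by apply/cvg_ex; exists (F x).
by apply: cvg_lim.
Unshelve. all: by end_near. Qed.

End supporting_slopes.

Section polya.
Context {R : realType}.
Notation PR := (probability (measurableTypeR R) R).
Notation mu := (@lebesgue_measure R).
Variables (h d : R -> R).
Hypothesis support : forall r s : R, 0 < r -> 0 < s -> h r + d r * (s - r) <= h s.
Hypothesis d_le0 : forall r : R, 0 < r -> d r <= 0.
Hypothesis continuous_d : forall r : R, 0 < r -> {for r, continuous d}.
Hypothesis h01 : forall r : R, 0 < r -> 0 <= h r <= 1.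
Hypothesis h_lim : h n.+1%:R^-1 @[n --> \oo] --> (1 : R).

Let H (v : R) := v * h v^-1.
Let F (v : R) := h v^-1 - d v^-1 / v.

Let slope_H (u v : R) : 0 < u -> 0 < v -> H u + F u * (v - u) <= H v.
Proof.
move=> u0 v0; have iu : 0 < u^-1 by rewrite invr_gt0.
have iv : 0 < v^-1 by rewrite invr_gt0.
have s := ler_wpM2l (ltW v0) (support iu iv).
apply: le_trans s; rewrite /H /F le_eqVlt; apply/orP; left; apply/eqP; field.
by rewrite !gt_eqF.
Qed.

Let F_nd (u v : R) : 0 < u -> u <= v -> F u <= F v.
Proof.
move=> u0; rewrite le_eqVlt => /orP[/eqP ->//|uv].
have v0 := lt_trans u0 uv; have s1 := slope_H u0 v0; have s2 := slope_H v0 u0.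
have uv0 : 0 < v - u by rewrite subr_gt0.
rewrite -(ler_pM2r uv0); lra.
Qed.

Let F_ge (u : R) : 0 < u -> h u^-1 <= F u.
Proof.
move=> u0; have iu : 0 < u^-1 by rewrite invr_gt0.
by rewrite /F lerDl oppr_ge0 mulr_le0_ge0 ?d_le0// ltW.
Qed.

Let F_ge0 (u : R) : 0 < u -> 0 <= F u.
Proof.
move=> u0; apply: le_trans (F_ge u0).
have iu : 0 < u^-1 by rewrite invr_gt0.
by have /andP[] := h01 iu.
Qed.

Let F_le1 (u : R) : 0 < u -> F u <= 1.
Proof.
move=> u0; have iu : 0 < u^-1 by rewrite invr_gt0.
have c : h u^-1 + d u^-1 * (n.+1%:R^-1 - u^-1) @[n --> \oo] --> h u^-1 + d u^-1 * (0 - u^-1).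
  apply: cvgD; first exact: cvg_cst.
  by apply: cvgMl_tmp; apply: cvgB; [exact: cvg_harmonic|exact: cvg_cst].
have -> : F u = h u^-1 + d u^-1 * (0 - u^-1) by rewrite /F; ring.
apply: (cvgr_to_le c); apply: nearW => n.
have in0 : 0 < n.+1%:R^-1 :> R by rewrite invr_gt0.
apply: le_trans (support iu in0) _.
by have /andP[] := h01 in0.
Qed.

Let continuous_F (u : R) : 0 < u -> {for u, continuous F}.
Proof.
move=> u0; have iu : 0 < u^-1 by rewrite invr_gt0.
have ci : v^-1 @[v --> u] --> u^-1 by apply: cvgV; [rewrite gt_eqF|exact: cvg_id].
have ch : {for u^-1, continuous h}.
  apply: has_derive_continuous; apply: (has_derive_slope iu support).
  exact: continuous_d.
have c1 : h v^-1 @[v --> u] --> h u^-1 by exact: (cvg_comp _ _ ci ch).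
have c2 : d v^-1 @[v --> u] --> d u^-1 by exact: (cvg_comp _ _ ci (continuous_d iu)).
exact: (cvgB c1 (cvgM c2 ci)).
Qed.

Let Fc (v : R) := if v < 0 then 0 else inf (F @` `]v, +oo[).

Let inf_le (v u : R) : 0 <= v -> v < u -> inf (F @` `]v, +oo[) <= F u.
Proof.
move=> v0 vu; apply: ge_inf; last by exists u => //=; rewrite in_itv/= vu.
exists 0 => y [w /=]; rewrite in_itv/= andbT => vw <-; apply: F_ge0.
exact: le_lt_trans vw.
Qed.

Let inf_ge (v c : R) : (forall u, v < u -> c <= F u) -> c <= inf (F @` `]v, +oo[).
Proof.
move=> cF; apply: lb_le_inf.
  by exists (F (v + 1)), (v + 1) => //=; rewrite in_itv/= ltrDl ltr01.
by move=> y [w /=]; rewrite in_itv/= andbT => vw <-; exact: cF.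
Qed.

Let Fc_gt0 (v : R) : 0 < v -> Fc v = F v.
Proof.
move=> v0; rewrite /Fc ltNge (ltW v0)/=; apply/eqP; rewrite eq_le; apply/andP; split; last first.
  by apply: inf_ge => u vu; apply: F_nd => //; exact: ltW.
have c : F (v + n.+1%:R^-1) @[n --> \oo] --> F v.
  have c1 : v + n.+1%:R^-1 @[n --> \oo] --> v.
    by rewrite -[X in _ --> X]addr0; apply: cvgD; [exact: cvg_cst|exact: cvg_harmonic].
  exact: (cvg_comp _ _ c1 (continuous_F v0)).
apply: (cvgr_to_ge c); apply: nearW => n; apply: inf_le; first exact: ltW.
by rewrite ltrDl invr_gt0.
Qed.

Let Fc_nd : nondecreasing Fc.
Proof.
move=> u v uv; rewrite /Fc; case: ltP => u0; case: ltP => v0 //.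
- by apply: inf_ge => w vw; apply: F_ge0; exact: le_lt_trans vw.
- by have := le_lt_trans uv v0; rewrite ltNge u0.
- by apply: inf_ge => w vw; apply: inf_le => //; exact: le_lt_trans vw.
Qed.

Let Fc_rc : right_continuous Fc.
Proof.
move=> v; apply/cvgrPdist_le => e e0.
have [v0|v0] := ltP v 0.
  near=> u; have u0 : u < 0 by near: u; exact: nbhs_right_lt.
  by rewrite /Fc v0 u0 subrr normr0 ltW.
have [w vw Fw] : exists2 w, v < w & F w < Fc v + e.
  apply: contrapT => nex.
  have : Fc v + e <= Fc v; last by rewrite gerDl leNgt e0.
  rewrite {2}/Fc ltNge v0/=; apply: inf_ge => u vu; rewrite leNgt; apply/negP => Fu.
  by apply: nex; exists u.
near=> u; have vu : v < u by near: u; exact: nbhs_right_gt.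
have uw : u < w by near: u; exact: nbhs_right_lt.
have m1 : Fc v <= Fc u by apply: Fc_nd; exact: ltW.
have m2 : Fc u <= F w.
  by rewrite /Fc ltNge (le_trans v0 (ltW vu))/=; apply: inf_le => //; exact: le_trans v0 (ltW vu).
by rewrite ler0_norm; lra.
Unshelve. all: by end_near. Qed.

Let Fc_Ny : Fc @ -oo --> (0 : R).
Proof.
apply: cvg_near_cst; near=> v; rewrite /Fc ifT//.
Unshelve. all: by end_near. Qed.

Let Fc_y : Fc @ +oo --> (1 : R).
Proof.
apply/cvgrPdist_le => e e0.
have /cvgrPdist_le/(_ e e0) [n _ Hn] := h_lim.
near=> v; have vn : n.+1%:R <= v.
  by near: v; apply: nbhs_pinfty_ge; exact: num_real.
have v0 : 0 < v by apply: lt_le_trans vn.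
rewrite Fc_gt0// ger0_norm ?subr_ge0 ?F_le1//.
have hn := Hn n (leqnn n).
have n0 : 0 < n.+1%:R :> R by [].
have F1 := F_nd n0 vn; have F2 := F_ge n0.
have /andP[_ h1] : 0 <= h n.+1%:R^-1 <= 1 by apply: h01; rewrite invr_gt0.
by move: hn; rewrite /= ger0_norm ?subr_ge0//; lra.
Unshelve. all: by end_near. Qed.

Let Rintegral_step (e v x : R) : 0 < e -> e < v -> 0 <= x ->
  \int[mu]_(u in `[e, v]) (\1_(`[0, +oo[%classic : set R) (u - x)) =
  Num.max 0 (v - x) - Num.max 0 (e - x).
Proof.
move=> e0 ev x0.
have I (c : R) : e <= c -> c <= v ->
    (forall u : R, e <= u -> u <= v -> (x <= u) = (c <= u)) ->
    \int[mu]_(u in `[e, v]) (\1_(`[0, +oo[%classic : set R) (u - x)) = v - c.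
  move=> ec cv Hc; transitivity (\int[mu]_(u in `[c, v]) (1 : R)); last first.
    rewrite Rintegral_cst//= mul1r lebesgue_measure_itv/= lte_fin.
    by move: cv; rewrite le_eqVlt => /orP[/eqP ->|cv]; [rewrite ltxx subrr|rewrite cv -EFinB].
  rewrite Rintegral_mkcond [RHS]Rintegral_mkcond; apply: eq_Rintegral => u _.
  rewrite !patchE indicE !mem_setE !in_itv/= andbT subr_ge0.
  have [eu|ue] := leP e u; last by rewrite /= leNgt (lt_le_trans ue ec).
  by have [uv|vu] /= := leP u v; [rewrite Hc// andbT; case: (c <= u)|rewrite andbF].
have [xe|ex] := leP x e.
  rewrite (I e)//; last by move=> u eu uv; rewrite eu (le_trans xe eu).
    by rewrite !max_r ?subr_ge0//; [ring|exact: le_trans xe (ltW ev)].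
  exact: ltW.
have [xv|vx] := leP x v.
  rewrite (I x)//; last exact: ltW.
  by rewrite max_r ?subr_ge0// max_l ?subr_le0 ?ltW// subr0.
rewrite !max_l ?subr_le0 ?ltW// subr0.
transitivity (\int[mu]_(u in `[e, v]) (0 : R)); last by rewrite Rintegral_cst// mul0r.
apply: eq_Rintegral => u; rewrite mem_setE in_itv/= => /andP[_ uv].
by rewrite indicE mem_setE in_itv/= andbT subr_ge0 leNgt (le_lt_trans uv vx).
Qed.

Let bounded_tent (v : R) : 0 < v ->
  bounded_mfun ((fun x : R => Num.max 0 (v - `|x|)) : measurableTypeR R -> R).
Proof.
move=> v0; split.
  by apply: measurable_maxr => //; apply: measurable_funB => //; exact: normr_measurable.
exists v => x; rewrite ger0_norm ?le_max ?lexx// ge_max (ltW v0)/=.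
by rewrite gerBl.
Qed.

Let tent_mean (p : PR) (v : R) : (forall r, p `]-oo, r]%classic = (Fc r)%:E) -> 0 < v ->
  \int[p]_x Num.max 0 (v - `|x|) = H v.
Proof.
move=> pF v0.
pose ball (u : R) (x : measurableTypeR R) : R := \1_(`[0, +oo[%classic : set R) (u - `|x : R|).
have bball u : bounded_mfun (ball u).
  apply: (bounded_mfun_comp (bounded_mfun_indic _)); first exact: measurable_itv.
  by apply: measurable_funB => //; exact: normr_measurable.
pose ray (u : R) (x : measurableTypeR R) : R := \1_(`]-oo, u]%classic : set (measurableTypeR R)) x.
have bray u : bounded_mfun (ray u) by apply: bounded_mfun_indic; exact: measurable_itv.
have rayE u : \int[p]_x ray u x = Fc u.
  by apply: EFin_inj; rewrite /ray Rintegral_indic// pF.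
have ballE u : 0 < u -> \int[p]_x ball u x = F u.
  move=> u0; have n0 : - u < 0 by rewrite oppr_lt0.
  have Fn : \int[p]_x ray (- u) x = 0 by rewrite rayE /Fc n0.
  have Fu : \int[p]_x ray u x = F u by rewrite rayE Fc_gt0.
  apply/eqP; rewrite eq_le; apply/andP; split.
    rewrite -Fu; apply: ble_Rintegral => // x.
    rewrite /ball /ray !indicE !mem_setE !in_itv/= andbT subr_ge0.
    have [xu|xu] := leP `|x : R| u; last by rewrite /= ler0n.
    by rewrite (le_trans (ler_norm (x : R)) xu).
  rewrite -Fu -[X in X <= _](subr0) -{1}Fn -bRintegralB//.
  apply: ble_Rintegral => //; first exact: bounded_mfunB.
  move=> x; rewrite /ball /ray !indicE !mem_setE !in_itv/= andbT subr_ge0 ler_norml.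
  have [xu|ux] := leP (x : R) u.
    by have [xu'|ux'] := leP (x : R) (- u); [rewrite subrr|rewrite (ltW ux') subr0].
  rewrite andbF sub0r; have [xu'|ux'] := leP (x : R) (- u); last by rewrite oppr0.
  by rewrite oppr_le0.
have key e : 0 < e -> e < v ->
    \int[p]_x Num.max 0 (v - `|x|) - \int[p]_x Num.max 0 (e - `|x|) = H v - H e.
  move=> e0 ev; rewrite -bRintegralB; [|exact: bounded_tent|exact: bounded_tent].
  have bb : bounded_mfun (fun z : measurableTypeR R * R => ball z.2 z.1).
    have bi : bounded_mfun (\1_(`[0, +oo[%classic : set R) : R -> R).
      by apply: bounded_mfun_indic; exact: measurable_itv.
    apply: (bounded_mfun_comp bi).
    apply: measurable_funB; first exact: measurable_snd.
    by apply: measurableT_comp; [exact: normr_measurable|exact: measurable_fst].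
  transitivity (\int[p]_x \int[mu]_(u in `[e, v]) ball u x).
    by apply: eq_Rintegral => x _; rewrite Rintegral_step.
  rewrite (Rintegral_itv_swap p e v bb).
  transitivity (\int[mu]_(u in `[e, v]) F u).
    apply: eq_Rintegral => u; rewrite mem_setE in_itv/= => /andP[eu _].
    by apply: ballE; exact: lt_le_trans e0 eu.
  apply: Rintegral_FTC => // u; rewrite in_itv/= => /andP[eu _].
    by apply: continuous_F; exact: lt_le_trans e0 eu.
  have u0 : 0 < u by exact: lt_le_trans e0 eu.
  exact: (has_derive_slope u0 slope_H (continuous_F u0)).
apply/eqP; rewrite -subr_eq0 -normr_le0; apply/ler_addgt0Pr => e e0; rewrite add0r.
pose e' := Num.min e (v / 2).
have e'0 : 0 < e' by rewrite lt_min e0 divr_gt0.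
have e'v : e' < v by rewrite gt_min; apply/orP; right; rewrite ltr_pdivrMr// ltr_pMr// ltr1n.
have ee : e' <= e by rewrite ge_min lexx.
have k := key e' e'0 e'v.
have A0 : 0 <= \int[p]_x Num.max 0 (e' - `|x|) <= e'.
  have b := bounded_tent e'0; have mb := b.1.
  rewrite Rintegral_ge0 ?(fun x _ => _)//=; last by move=> x _; rewrite le_max lexx.
  apply: le_trans (ler_norm _) _; apply: normr_Rintegral_prob => // x.
  rewrite ger0_norm ?le_max ?lexx// ge_max (ltW e'0)/=; by rewrite gerBl.
have i0 : 0 < e'^-1 by rewrite invr_gt0.
have /andP[a1 a2] := h01 i0; have /andP[A1 A2] := A0.
have H1 : 0 <= H e' by apply: mulr_ge0 => //; exact: ltW.
have H2 : H e' <= e' by rewrite /H ler_piMr// ltW.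
rewrite ler_norml; apply/andP; split; lra.
Qed.

(** Pólya: a convex function decreasing from [1] is a characteristic function,
    because it is a mixture of triangles. *)
Theorem polya : exists nu : PR, forall t, t != 0 -> charf nu t = (h `|t|)%:C.
Proof.
have [p pF] := exists_law_cdf Fc_nd Fc_rc Fc_Ny Fc_y.
have [q qE] := @exists_triangle_law R.
exists (product_law p q) => t t0; have nt : 0 < `|t| by rewrite normr_gt0.
have it : 0 < `|t|^-1 by rewrite invr_gt0.
have qC x : \int[q]_y cos (t * (x * y)) = Num.max 0 (1 - `|t * x|).
  under eq_Rintegral do rewrite mulrA.
  by have := congr1 (@complex.Re R) (qE (t * x)).
have qS x : \int[q]_y sin (t * (x * y)) = 0.
  under eq_Rintegral do rewrite mulrA.
  by have := congr1 (@complex.Im R) (qE (t * x)).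
rewrite /charf !Rintegral_product_law; [|exact: bsin|exact: bcos].
under eq_Rintegral do rewrite qC.
under [X in _ +i* X]eq_Rintegral do rewrite qS.
rewrite Rintegral_prob_cst; congr (_ +i* _).
have E x : Num.max 0 (1 - `|t * x|) = `|t| * Num.max 0 (`|t|^-1 - `|x|).
  rewrite maxr_pMr ?normr_ge0// mulr0 mulrBr divff ?gt_eqF//.
  by rewrite normrM.
under eq_Rintegral do rewrite E.
rewrite bRintegralZl; last exact: bounded_tent.
rewrite (tent_mean pF it) /H invrK mulrA divff ?mul1r// gt_eqF//.
Qed.

End polya.

(** * Mixtures of symmetric Cauchy laws *)

Section laplace.
Context {R : realType}.
Notation PR := (probability (measurableTypeR R) R).

Lemma expR_gtangent (x m : R) : expR m * (1 + (x - m)) <= expR x.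
Proof.
have -> : expR x = expR m * expR (x - m) by rewrite -expRD addrC subrK.
by apply: ler_wpM2l; [exact: expR_ge0|exact: expR_ge1Dx].
Qed.

Variable p : PR.

Definition laplace (r : R) : R := \int[p]_x expR (- (r * `|x|)).
Definition laplace1 (r : R) : R := \int[p]_x (`|x| * expR (- (r * `|x|))).

Let mdamp (r : R) : measurable_fun setT (fun x : measurableTypeR R => expR (- (r * `|x : R|))).
Proof.
apply: measurableT_comp => //; apply: measurableT_comp => //.
by apply: measurable_funM => //; exact: normr_measurable.
Qed.

Lemma bounded_laplace r : 0 <= r ->
  bounded_mfun (fun x : measurableTypeR R => expR (- (r * `|x : R|))).
Proof.
move=> r0; split => //; exists 1 => x.
by rewrite ger0_norm ?expR_ge0// -expR0 ler_expR oppr_le0 mulr_ge0.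
Qed.

Lemma damp_le (r z : R) : 0 < r -> 0 <= z -> z * expR (- (r * z)) <= r^-1.
Proof.
move=> r0 z0; rewrite expRN ler_pdivrMr ?expR_gt0// mulrC ler_pdivlMr//.
by apply: le_trans (expR_ge1Dx _); rewrite mulrC lerDr.
Qed.

Lemma damp2_le (r z : R) : 0 < r -> 0 <= z -> z ^+ 2 * expR (- (r * z)) <= 4 / r ^+ 2.
Proof.
move=> r0 z0; have r2 : 0 < r / 2 by rewrite divr_gt0.
have d := damp_le r2 z0; have z1 : 0 <= z * expR (- (r / 2 * z)) by rewrite mulr_ge0 ?expR_ge0.
have -> : z ^+ 2 * expR (- (r * z)) = (z * expR (- (r / 2 * z))) ^+ 2.
  by rewrite exprMn -[in RHS]expRM_natl; congr (_ * expR _); field.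
have -> : 4 / r ^+ 2 = (r / 2)^-1 ^+ 2 by field; rewrite gt_eqF.
by rewrite ler_pXn2r// ?nnegrE// invr_ge0 ltW.
Qed.

Lemma bounded_laplace1 r : 0 < r ->
  bounded_mfun (fun x : measurableTypeR R => `|x : R| * expR (- (r * `|x : R|))).
Proof.
move=> r0; split; first by apply: measurable_funM => //; exact: normr_measurable.
exists r^-1 => x; rewrite ger0_norm ?mulr_ge0 ?expR_ge0//; exact: damp_le.
Qed.

Lemma laplace_le1 r : 0 <= r -> laplace r <= 1.
Proof.
move=> r0; rewrite -[leRHS](Rintegral_prob_cst p); apply: ble_Rintegral.
- exact: bounded_laplace.
- exact: bounded_mfun_cst.
- by move=> x; rewrite -expR0 ler_expR oppr_le0 mulr_ge0.
Qed.

Lemma laplace_gt0 r : 0 <= r -> 0 < laplace r.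
Proof.
move=> r0.
pose I (n : nat) (x : measurableTypeR R) : R := \1_(`]-oo, n%:R]%classic : set R) `|x : R|.
have bI n : bounded_mfun (I n).
  by apply: (bounded_mfun_comp (bounded_mfun_indic _)); [exact: measurable_itv|exact: normr_measurable].
have c : \int[p]_x I n x @[n --> \oo] --> \int[p]_x (1 : R).
  apply: (@bounded_cvg_Rintegral _ _ _ p I _ 1).
  - by move=> n; case: (bI n).
  - exact: measurable_cst.
  - by move=> n x; rewrite /I indicE; case: (_ \in _); rewrite ?normr1 ?normr0.
  - move=> x; apply: cvg_near_cst; near=> n; rewrite /I indicE mem_set//= in_itv/=.
    by near: n; exact: nbhs_infty_ger.
rewrite Rintegral_prob_cst in c.
have [n _ Hn] := cvgr_gt _ c _ (ltr01 : (0 : R) < 1).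
apply: (@lt_le_trans _ _ (expR (- (r * n%:R)) * \int[p]_x I n x)).
  by rewrite mulr_gt0 ?expR_gt0//; apply: Hn => /=.
rewrite -bRintegralZl//; apply: ble_Rintegral.
- by apply: bounded_mfunM => //; exact: bounded_mfun_cst.
- exact: bounded_laplace.
- move=> x; rewrite /I indicE mem_setE in_itv/=; have [xn|xn] := leP `|x : R| n%:R.
    by rewrite mulr1 ler_expR lerN2 ler_wpM2l.
  by rewrite mulr0 expR_ge0.
Unshelve. all: by end_near. Qed.

(** Jensen for the tilted law: the logarithm of a Laplace transform is convex. *)
Lemma laplace_log_convex (r s : R) : 0 < r -> 0 < s ->
  laplace r * expR (- ((s - r) * (laplace1 r / laplace r))) <= laplace s.
Proof.
move=> r0 s0; have L0 := laplace_gt0 (ltW r0).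
set m := laplace1 r / laplace r.
have b0 := bounded_laplace (ltW r0); have b1 := bounded_laplace1 r0.
have -> : laplace r * expR (- ((s - r) * m)) = expR (- ((s - r) * m)) *
    ((1 + (s - r) * m) * laplace r - (s - r) * laplace1 r).
  by rewrite /m; field; rewrite gt_eqF.
rewrite /laplace /laplace1 -!bRintegralZl// -bRintegralB; last 2 first.
- by apply: bounded_mfunM => //; exact: bounded_mfun_cst.
- by apply: bounded_mfunM => //; exact: bounded_mfun_cst.
rewrite -bRintegralZl; last first.
  by apply: bounded_mfunB; apply: bounded_mfunM => //; exact: bounded_mfun_cst.
apply: ble_Rintegral.
- apply: bounded_mfunM; first exact: bounded_mfun_cst.
  by apply: bounded_mfunB; apply: bounded_mfunM => //; exact: bounded_mfun_cst.
- exact: bounded_laplace (ltW s0).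
- move=> x; have t := expR_gtangent (- ((s - r) * `|x : R|)) (- ((s - r) * m)).
  have e0 := expR_ge0 (- (r * `|x : R|)).
  have -> : - (s * `|x : R|) = - (r * `|x : R|) + - ((s - r) * `|x : R|) by ring.
  rewrite expRD; have := ler_wpM2l e0 t; apply: le_trans; rewrite le_eqVlt; apply/orP; left.
  by apply/eqP; ring.
Qed.

Lemma continuous_laplace1 (r : R) : 0 < r -> {for r, continuous laplace1}.
Proof.
move=> r0; have r2 : 0 < r / 2 by rewrite divr_gt0.
pose C := 4 / (r / 2) ^+ 2.
have lip (s t z : R) : r / 2 <= s -> s <= t -> 0 <= z ->
    0 <= z * expR (- (s * z)) - z * expR (- (t * z)) <= C * (t - s).
  move=> rs st z0.
  have -> : z * expR (- (s * z)) - z * expR (- (t * z)) =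
      z * expR (- (s * z)) * (1 - expR (- ((t - s) * z))).
    rewrite mulrBr mulr1 -mulrA -expRD; congr (_ - z * expR _); ring.
  have tz : 0 <= (t - s) * z by rewrite mulr_ge0// subr_ge0.
  have u0 : 0 <= 1 - expR (- ((t - s) * z)).
    by rewrite subr_ge0 -expR0 ler_expR oppr_le0.
  have zs : 0 <= z * expR (- (s * z)) by rewrite mulr_ge0 ?expR_ge0.
  apply/andP; split; first exact: mulr_ge0.
  have u1 : 1 - expR (- ((t - s) * z)) <= (t - s) * z.
    by have := expR_ge1Dx (- ((t - s) * z)); lra.
  apply: (le_trans (ler_wpM2l zs u1)).
  have -> : z * expR (- (s * z)) * ((t - s) * z) = (z ^+ 2 * expR (- (s * z))) * (t - s) by ring.
  apply: ler_wpM2r; first by rewrite subr_ge0.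
  apply: le_trans (damp2_le r2 z0); apply: ler_wpM2l; first exact: sqr_ge0.
  by rewrite ler_expR lerN2 ler_wpM2r.
have lip' (s t : R) : r / 2 <= s -> s <= t -> `|laplace1 t - laplace1 s| <= C * (t - s).
  move=> rs st; have s0 := lt_le_trans r2 rs; have t0 := lt_le_trans s0 st.
  have [bs bt] := (bounded_laplace1 s0, bounded_laplace1 t0).
  rewrite distrC /laplace1 -bRintegralB//.
  apply: normr_Rintegral_prob; first by case: (bounded_mfunB bs bt).
  by move=> x; have /andP[l1 l2] := lip s t `|x : R| rs st (normr_ge0 _); rewrite ger0_norm.
apply/cvgrPdist_le => e e0.
have C0 : 0 < C by rewrite divr_gt0// exprn_gt0.
have rr : 0 < r - r / 2 by lra.
have eC : 0 < Num.min (e / C) (r - r / 2) by rewrite lt_min rr divr_gt0.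
have /cvgrPdist_le/(_ _ eC) ne := (@cvg_id _ (nbhs r)).
near=> s; have /andP[se sr2] : (`|r - s| <= e / C) && (`|r - s| <= r - r / 2).
  by rewrite -le_min; near: s; exact: ne.
have rs : r / 2 <= s by move: sr2; rewrite ler_norml => /andP[_]; lra.
have [rs'|sr] := leP r s.
  rewrite distrC; apply: (le_trans (lip' r s _ rs')).
    by rewrite ler_pdivrMr// ler_pMr// ler1n.
  by move: se; rewrite ler_pdivlMr// mulrC distrC ger0_norm// subr_ge0.
apply: (le_trans (lip' s r rs (ltW sr))).
by move: se; rewrite ler_pdivlMr// mulrC ger0_norm// subr_ge0 ltW.
Unshelve. all: by end_near. Qed.

Lemma is_derive_laplace (r : R) : 0 < r -> is_derive r 1 laplace (- laplace1 r).
Proof.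
move=> r0; apply: (@has_derive_slope _ laplace (fun r => - laplace1 r) r r0); last first.
  by apply: cvgN; exact: continuous_laplace1.
move=> u v u0 v0; apply: le_trans (laplace_log_convex u0 v0).
have L0 := laplace_gt0 (ltW u0).
have := ler_wpM2l (ltW L0) (expR_ge1Dx (- ((v - u) * (laplace1 u / laplace u)))).
apply: le_trans; rewrite le_eqVlt; apply/orP; left; apply/eqP; field.
by rewrite gt_eqF.
Qed.

Lemma laplace_cvg1 : laplace n.+1%:R^-1 @[n --> \oo] --> (1 : R).
Proof.
rewrite -[X in _ --> X](Rintegral_prob_cst p).
apply: (@bounded_cvg_Rintegral _ _ _ p (fun n x => expR (- (n.+1%:R^-1 * `|x : R|))) _ 1).
- by move=> n; exact: mdamp.
- exact: measurable_cst.
- move=> n x; rewrite ger0_norm ?expR_ge0// -expR0 ler_expR oppr_le0 mulr_ge0//.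
- move=> x; have c : - (n.+1%:R^-1 * `|x : R|) @[n --> \oo] --> - (0 * `|x : R|).
    by apply: cvgN; apply: cvgMr_tmp; exact: cvg_harmonic.
  have := cvg_comp _ _ c (@continuous_expR R _).
  by rewrite mul0r oppr0 expR0.
Qed.

End laplace.

Section roots_of_laplace.
Context {R : realType}.
Notation PR := (probability (measurableTypeR R) R).

Lemma charf_at0 (m : PR) : charf m 0 = 1.
Proof.
rewrite /charf; under eq_Rintegral do rewrite mul0r cos0.
under [X in _ +i* X]eq_Rintegral do rewrite mul0r sin0.
by rewrite !Rintegral_prob_cst.
Qed.

Variable p : PR.
Notation psi := (laplace p).

(** By convexity of the logarithm, a root of a Laplace transform is again convex
    and decreasing, so that it satisfies Pólya's criterion. *)
Lemma laplace_root (n : nat) : (0 < n)%N ->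
  exists nu : PR, forall t, t != 0 -> charf nu t = (expR (n%:R^-1 * ln (psi `|t|)))%:C.
Proof.
move=> n0; have N0 : 0 < n%:R^-1 :> R by rewrite invr_gt0 ltr0n.
pose h (r : R) := expR (n%:R^-1 * ln (psi r)).
pose d (r : R) := n%:R^-1 * (h r * (- laplace1 p r / psi r)).
have psi0 (r : R) : 0 < r -> 0 < psi r by move=> r0; apply: laplace_gt0; exact: ltW.
have c_psi (r : R) : 0 < r -> {for r, continuous psi}.
  by move=> r0; exact: has_derive_continuous (is_derive_laplace p r0).
have c_h (r : R) : 0 < r -> {for r, continuous h}.
  move=> r0; have c1 := continuous_ln (psi0 r r0).
  have c2 : n%:R^-1 * ln (psi s) @[s --> r] --> n%:R^-1 * ln (psi r).
    by apply: cvgMl_tmp; exact: (cvg_comp _ _ (c_psi r r0) c1).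
  exact: (cvg_comp _ _ c2 (@continuous_expR R _)).
have l1_ge0 (r : R) : 0 < r -> 0 <= laplace1 p r.
  by move=> r0; apply: Rintegral_ge0 => x _; rewrite mulr_ge0 ?expR_ge0.
apply: (@polya _ h d).
- move=> r s r0 s0; have P0 := psi0 r r0; have Q0 := psi0 s s0.
  have lc := laplace_log_convex p r0 s0.
  have L : ln (psi r) - (s - r) * (laplace1 p r / psi r) <= ln (psi s).
    rewrite -ler_expR expRD [expR (ln (psi s))]lnK ?posrE//.
    by rewrite [expR (ln (psi r))]lnK ?posrE.
  apply: (@le_trans _ _ (expR (n%:R^-1 * (ln (psi r) - (s - r) * (laplace1 p r / psi r))))); last first.
    by rewrite ler_expR ler_pM2l.
  have := expR_gtangent (n%:R^-1 * (ln (psi r) - (s - r) * (laplace1 p r / psi r)))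
    (n%:R^-1 * ln (psi r)).
  apply: le_trans; rewrite -/(h r) /d le_eqVlt; apply/orP; left; apply/eqP.
  by rewrite mulrBr; ring.
- move=> r r0; apply: mulr_ge0_le0; first exact: ltW.
  apply: mulr_ge0_le0; first exact: expR_ge0.
  rewrite mulNr oppr_le0; apply: divr_ge0; first exact: l1_ge0.
  by apply: ltW; exact: psi0.
- move=> r r0; have c1 : - laplace1 p s @[s --> r] --> - laplace1 p r.
    by apply: cvgN; exact: continuous_laplace1.
  have c2 : (psi s)^-1 @[s --> r] --> (psi r)^-1.
    by apply: cvgV; [rewrite gt_eqF// psi0|exact: c_psi].
  have c3 := cvgM (c_h r r0) (cvgM c1 c2).
  by apply: cvgMl_tmp; exact: c3.
- move=> r r0; rewrite expR_ge0/= -expR0 ler_expR; apply: mulr_ge0_le0; first exact: ltW.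
  by apply: ln_le0; apply: laplace_le1; exact: ltW.
- have c1 := cvg_comp _ _ (laplace_cvg1 p) (continuous_ln (ltr01 : (0 : R) < 1)).
  have c2 : n%:R^-1 * ln (psi k.+1%:R^-1) @[k --> \oo] --> n%:R^-1 * ln 1.
    by apply: cvgMl_tmp; exact: c1.
  have := cvg_comp _ _ c2 (@continuous_expR R _).
  by rewrite ln1 mulr0 expR0.
Qed.

(** The hypothesis says that [m] is a scale mixture of symmetric Cauchy laws. *)
Theorem infinitely_divisible_laplace (m : PR) :
  (forall t, charf m t = (psi `|t|)%:C) -> infinitely_divisible m.
Proof.
move=> mE n n0; have [nu nuE] := laplace_root n0; exists nu.
apply: same_law_charf_eq => t; rewrite charf_convolution_power.
have [->|t0] := eqVneq t 0; first by rewrite !charf_at0 expr1n.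
rewrite nuE// mE -rmorphXn/= -expRM_natl mulrA divff ?mul1r; last by rewrite pnatr_eq0 -lt0n.
by rewrite lnK// posrE laplace_gt0.
Qed.

(** Conditionally on the first factor the characteristic function is [psi], a
    function of [t * x] only. *)
Lemma charf_product_laplace (q b : PR) : (forall t, charf b t = (psi `|t|)%:C) ->
  forall t, charf (product_law q b) t = (laplace (product_law q p) `|t|)%:C.
Proof.
move=> bE t.
have bC x : \int[b]_y cos (t * (x * y)) = psi `|t * x|.
  under eq_Rintegral do rewrite mulrA.
  by have := congr1 (@complex.Re R) (bE (t * x)).
have bS x : \int[b]_y sin (t * (x * y)) = 0.
  under eq_Rintegral do rewrite mulrA.
  by have := congr1 (@complex.Im R) (bE (t * x)).
rewrite /charf !Rintegral_product_law; [|exact: bsin|exact: bcos].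
under eq_Rintegral do rewrite bC.
under [X in _ +i* X]eq_Rintegral do rewrite bS.
rewrite Rintegral_prob_cst; congr (_ +i* _).
rewrite {2}/laplace Rintegral_product_law; last exact: bounded_laplace.
apply: eq_Rintegral => x _; apply: eq_Rintegral => y _.
by rewrite !normrM mulrA.
Qed.

End roots_of_laplace.

(** * Boolean stable laws of index one *)

Section index_one.
Context {R : realType}.
Notation PR := (probability (measurableTypeR R) R).
Notation Re := complex.Re.
Notation Im := complex.Im.
Implicit Types (m b : PR).

Lemma Cexp_Clog (z : R[i]) : z != 0 -> Cexp (Clog z) = z.
Proof.
move=> z0; have n0 := sqr_norm_neq0 z0.
pose r := Normc.normc z.
have rE : r = Num.sqrt (Re z ^+ 2 + Im z ^+ 2) by rewrite /r; case: z {z0 n0 r}.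
have r0 : 0 < r by rewrite rE sqrtr_gt0.
have r2 : r ^+ 2 = Re z ^+ 2 + Im z ^+ 2 by rewrite rE sqr_sqrtr// ltW.
have q2 : (Re z / r) ^+ 2 + (Im z / r) ^+ 2 = 1.
  by rewrite !expr_div_n -mulrDl -r2 divff// expf_neq0// gt_eqF.
have q1 : -1 <= Re z / r <= 1.
  rewrite -ler_norml -(@ler_pXn2r _ 2%N)// ?nnegrE// expr1n real_normK ?num_real//.
  by have := sqr_ge0 (Im z / r); lra.
have c : cos (Carg z) = Re z / r.
  by rewrite /Carg -/r; case: ifP => _; rewrite ?cosN acosK.
have s : sin (Carg z) = Im z / r.
  have -> : sin (Carg z) = if 0 <= Im z then `|Im z / r| else - `|Im z / r|.
    rewrite /Carg -/r; have -> : `|Im z / r| = sin (acos (Re z / r)).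
      by rewrite sin_acos// -q2 addrAC subrr add0r sqrtr_sqr.
    by case: ifP => // _; rewrite sinN.
  rewrite normrM normfV (gtr0_norm r0).
  case: ifP => [z1|/negbT]; first by rewrite ger0_norm.
  by rewrite -ltNge => z1; rewrite ltr0_norm// mulNr opprK.
apply/eqP; rewrite eq_complex Re_Cexp Im_Cexp/= -/r lnK ?posrE// c s.
have rn : r != 0 by rewrite gt_eqF.
by rewrite ![r * _]mulrC !divfK// !eqxx.
Qed.

Lemma Cexp_neq0 (z : R[i]) : Cexp z != 0.
Proof.
apply/eqP => E; have := congr1 (@sqnorm R) E; rewrite sqnorm_Cexp /sqnorm/= expr0n/= addr0.
by move=> /eqP; rewrite expf_eq0/= gt_eqF// expR_gt0.
Qed.

Lemma boolean_stable1P (rho : R) m : is_boolean_stable 1 rho m <->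
  (forall a y, 0 < y -> cauchy_transform m (a +i* y) =
     ((a + cos (rho * pi)) +i* (y + sin (rho * pi)))^-1).
Proof.
pose e := Cexp (0 +i* (rho * pi)).
have eE (a y : R) : (a +i* y) + e = (a + cos (rho * pi)) +i* (y + sin (rho * pi)).
  by apply/eqP; rewrite eq_complex /e Re_add Im_add Re_Cexp Im_Cexp/= expR0 !mul1r !eqxx.
have key (u : R[i]) : u != 0 ->
    (eta_transform m u^-1 = - Cpow (e * u^-1) 1%:C <-> cauchy_transform m u = (u + e)^-1).
  have e0 : e != 0 by exact: Cexp_neq0.
  clear eE; move: e e0 => e e0 u0; have eu : e * u^-1 != 0 by rewrite mulf_neq0 ?invr_eq0.
  rewrite /Cpow mul1r Cexp_Clog//.
  rewrite /eta_transform /F_transform invrK; move: (cauchy_transform m u) => G.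
  split=> [E|->].
    have : G^-1 = u + e.
      apply: (mulfI (_ : u^-1 != 0)); first by rewrite invr_eq0.
      rewrite mulrDr mulVf// [u^-1 * e]mulrC -[LHS](subKr 1) E opprK addrC //.
    by move=> <-; rewrite invrK.
  by rewrite invrK mulrDr mulVf// opprD addrA subrr add0r mulrC.
split=> [H a y y0|H z z0].
  rewrite -eE; apply/key; first by rewrite eq_complex/= negb_and orbC gt_eqF.
  apply: H; rewrite Im_inv/= mulNr oppr_lt0 divr_gt0//.
  by rewrite ltr_wpDl ?sqr_ge0// exprn_gt0.
have z1 : z != 0 by apply/eqP => E; move: z0; rewrite E/= ltxx.
rewrite -[z]invrK; apply/key; first by rewrite invr_eq0.
have n0 := sqr_norm_neq0 z1.
have y0 : 0 < Im z^-1 by rewrite Im_inv divr_gt0// oppr_gt0.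
by case: (z^-1) y0 => a y /= y0; rewrite eE; exact: H.
Qed.

Lemma charf_dirac (c t : R) :
  charf (\d_(c : measurableTypeR R) : PR) t = (cos (t * c)) +i* (sin (t * c)).
Proof.
rewrite /charf /Rintegral !integral_dirac//=; do ?by apply/measurable_EFinP; have [] := bcos t; have [] := bsin t.
by rewrite indicT !mul1r.
Qed.

Lemma bRintegral_dirac (c : R) (f : R -> R) : bounded_mfun (f : measurableTypeR R -> R) ->
  \int[(\d_(c : measurableTypeR R) : PR)]_x f x = f c.
Proof.
move=> [mf _]; rewrite /Rintegral integral_dirac//=; last exact/measurable_EFinP.
by rewrite indicT mul1r.
Qed.

Lemma exists_cauchy_law (s c : R) : 0 <= s -> exists m, forall t,
  charf m t = (expR (- (s * `|t|)) * cos (c * t)) +i* (expR (- (s * `|t|)) * sin (c * t)).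
Proof.
move=> s0.
have [nu nuE] : exists nu : PR, forall t, t != 0 -> charf nu t = (expR (- `|t|))%:C.
  apply: (@polya _ (fun r => expR (- r)) (fun r => - expR (- r))).
  - move=> r u _ _; have := expR_gtangent (- u) (- r); apply: le_trans.
    by rewrite le_eqVlt; apply/orP; left; apply/eqP; ring.
  - by move=> r _; rewrite oppr_le0 expR_ge0.
  - move=> r _; apply: (@has_derive_continuous _ _ _ (expR (- r))); diff; rewrite /=; ring.
  - by move=> r r0; rewrite expR_ge0/= -expR0 ler_expR oppr_le0 ltW.
  - have c1 : - n.+1%:R^-1 @[n --> \oo] --> - (0 : R) by apply: cvgN; exact: cvg_harmonic.
    have := cvg_comp _ _ c1 (@continuous_expR R _).
    by rewrite oppr0 expR0.
have nuE' t : charf nu t = (expR (- `|t|))%:C.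
  have [->|t0] := eqVneq t 0; last exact: nuE.
  by rewrite charf_at0 normr0 oppr0 expR0.
pose D (x : R) : PR := \d_(x : measurableTypeR R).
exists (convolution (D c) (product_law (D s) nu)) => t.
rewrite charf_convolution /D charf_dirac [c * t]mulrC -/(D s).
have -> : charf (product_law (D s) nu) t = (expR (- (s * `|t|)))%:C.
  rewrite -[in RHS](ger0_norm s0) -normrM [s * t]mulrC -nuE' /charf !Rintegral_product_law;
    [|exact: bsin|exact: bcos].
  congr (_ +i* _).
    rewrite (@bRintegral_dirac s (fun x => \int[nu]_y cos (t * (x * y)))).
      by under eq_Rintegral do rewrite mulrA.
    apply: (@bounded_mfun_Rintegral1 _ _ _ _ _ (D s) nu (fun z => cos (t * (z.1 * z.2)))).
    apply: (bounded_mfun_comp (bcos t)); exact: measurable_mul_pair.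
  rewrite (@bRintegral_dirac s (fun x => \int[nu]_y sin (t * (x * y)))).
    by under eq_Rintegral do rewrite mulrA.
  apply: (@bounded_mfun_Rintegral1 _ _ _ _ _ (D s) nu (fun z => sin (t * (z.1 * z.2)))).
  apply: (bounded_mfun_comp (bsin t)); exact: measurable_mul_pair.
by apply/eqP; rewrite eq_complex Re_mul Im_mul/= !mulr0 subr0 add0r ![_ * expR _]mulrC !eqxx.
Qed.

Lemma cauchy_law_boolean_stable (rho : R) m : 0 <= rho <= 1 ->
  (forall t, charf m t = (expR (- (sin (rho * pi) * `|t|)) * cos (- cos (rho * pi) * t)) +i*
                 (expR (- (sin (rho * pi) * `|t|)) * sin (- cos (rho * pi) * t))) ->
  is_boolean_stable 1 rho m.
Proof.
move=> /andP[r0 r1] H; apply/boolean_stable1P => a y y0.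
have s0 : 0 <= sin (rho * pi).
  by apply: sin_ge0_pi; apply/andP; split; [exact: mulr_ge0 r0 (pi_ge0 R)|exact: ler_piMl (pi_ge0 R) r1].
by rewrite (cauchy_transform_cauchy_law s0 H a y0) opprK.
Qed.

(** The law is the symmetric Cauchy law. *)
Lemma boolean_stable_half_charf b : is_boolean_stable 1 (1 / 2) b ->
  forall t, charf b t = (laplace (\d_(1 : measurableTypeR R) : PR) `|t|)%:C.
Proof.
move=> /boolean_stable1P H t.
have [m mE] := @exists_cauchy_law 1 0 ler01.
have h0 : 0 <= (1 / 2 : R) <= 1 by apply/andP; split; lra.
have ph : 1 / 2 * pi = pi / 2 :> R by rewrite mulrC mulrA mulr1.
have : is_boolean_stable 1 (1 / 2) m.
  apply: cauchy_law_boolean_stable => // u.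
  by rewrite ph sin_pihalf cos_pihalf oppr0; exact: mE.
move=> /boolean_stable1P M.
have bm : same_law b m by apply: same_law_cauchy => a y y0; rewrite H// M.
rewrite (same_law_charf bm t) mE mul0r cos0 sin0 mulr0 mulr1 mul1r.
rewrite /laplace (@bRintegral_dirac 1 (fun x => expR (- (`|t| * `|x|)))).
  by rewrite normr1 mulr1.
exact: bounded_laplace.
Qed.

End index_one.

Section zeros.
Context {R : realType}.
Notation PR := (probability (measurableTypeR R) R).
Notation Re := complex.Re.
Notation Im := complex.Im.

Lemma sqnormX (z : R[i]) n : sqnorm (z ^+ n) = sqnorm z ^+ n.
Proof.
elim: n => [|n IH]; first by rewrite !expr0 /sqnorm/= expr1n expr0n addr0.
by rewrite !exprS sqnormM IH.
Qed.

Lemma sqnorm_ge0 (z : R[i]) : 0 <= sqnorm z.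
Proof. by rewrite addr_ge0 ?sqr_ge0. Qed.

Lemma sqnorm_eq0 (z : R[i]) : (sqnorm z == 0) = (z == 0).
Proof.
apply/idP/idP => [/eqP s0|/eqP ->]; last by rewrite /sqnorm/= expr0n/= addr0.
by apply/negPn/negP => /sqr_norm_neq0; rewrite -/(sqnorm z) s0 ltxx.
Qed.

(** Cauchy-Schwarz for [cos (t X - arg)], whose square has mean [1 / 2] when
    the characteristic function vanishes at [2 t]. *)
Lemma charf_half_zero (nu : PR) t : charf nu (2 * t) = 0 -> sqnorm (charf nu t) <= 1 / 2.
Proof.
move=> z; pose C := Re (charf nu t); pose S := Im (charf nu t).
have C2 : \int[nu]_x cos (2 * t * x) = 0 by have := congr1 (@complex.Re R) z.
have S2 : \int[nu]_x sin (2 * t * x) = 0 by have := congr1 (@complex.Im R) z.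
pose q := C ^+ 2 + S ^+ 2; rewrite -[sqnorm _]/q.
pose f (x : R) := C * cos (t * x) + S * sin (t * x).
have bf : bounded_mfun (f : measurableTypeR R -> R).
  by apply: bounded_mfunD; apply: bounded_mfunM; do ?exact: bounded_mfun_cst; [exact: bcos|exact: bsin].
have If : \int[nu]_x f x = q.
  rewrite bRintegralD; last 2 first.
  - by apply: bounded_mfunM; [exact: bounded_mfun_cst|exact: bcos].
  - by apply: bounded_mfunM; [exact: bounded_mfun_cst|exact: bsin].
  rewrite !bRintegralZl; [|exact: bsin|exact: bcos].
  by rewrite /q !expr2.
have f2 (x : R) : f x * f x = q / 2 + ((C ^+ 2 - S ^+ 2) / 2 * cos (2 * t * x) + C * S * sin (2 * t * x)).
  have -> : 2 * t * x = t * x + t * x by ring.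
  rewrite cosD sinD /f /q; have cs := cos2Dsin2 (t * x).
  move: (cos (t * x)) (sin (t * x)) cs => c s cs.
  transitivity ((C ^+ 2 + S ^+ 2) / 2 * (c ^+ 2 + s ^+ 2) + ((C ^+ 2 - S ^+ 2) / 2 * (c * c - s * s) + C * S * (s * c + c * s))).
    by field.
  by rewrite cs mulr1.
have b1 : bounded_mfun (fun x : measurableTypeR R => (C ^+ 2 - S ^+ 2) / 2 * cos (2 * t * x)).
  by apply: bounded_mfunM; [exact: bounded_mfun_cst|exact: bcos].
have b2 : bounded_mfun (fun x : measurableTypeR R => C * S * sin (2 * t * x)).
  by apply: bounded_mfunM; [exact: bounded_mfun_cst|exact: bsin].
have If2 : \int[nu]_x (f x * f x) = q / 2.
  under eq_Rintegral do rewrite f2.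
  rewrite bRintegralD; [|exact: bounded_mfun_cst|exact: bounded_mfunD].
  rewrite Rintegral_prob_cst bRintegralD// !bRintegralZl; [|exact: bsin|exact: bcos].
  by rewrite C2 S2 !mulr0 !addr0.
have : 0 <= \int[nu]_x ((f x * f x - 2 * q * f x) + q ^+ 2).
  apply: Rintegral_ge0 => x _.
  have -> : (f x * f x - 2 * q * f x) + q ^+ 2 = (f x - q) ^+ 2 by ring.
  exact: sqr_ge0.
have bff : bounded_mfun (fun x : measurableTypeR R => f x * f x) by exact: bounded_mfunM.
have bqf : bounded_mfun (fun x : measurableTypeR R => 2 * q * f x).
  by apply: bounded_mfunM => //; exact: bounded_mfun_cst.
rewrite bRintegralD; [|exact: bounded_mfunB|exact: bounded_mfun_cst].
rewrite bRintegralB// (bRintegralZl nu (2 * q) bf) If If2 Rintegral_prob_cst => H.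
have q0 : 0 <= q by rewrite addr_ge0 ?sqr_ge0.
rewrite leNgt; apply/negP => q1.
have qE : q / 2 - 2 * q * q + q ^+ 2 = q * (1 / 2 - q) by field.
have qp : 0 < q by apply: lt_trans q1; rewrite divr_gt0.
by move: H; rewrite qE pmulr_rge0// subr_ge0 leNgt q1.
Qed.

(** The roots of all orders vanish at [2 t] as well, so that each is bounded at [t]
    by the same constant below [1], whose powers tend to [0]. *)
Theorem infinitely_divisible_zero (m : PR) t : infinitely_divisible m ->
  charf m (2 * t) = 0 -> charf m t = 0.
Proof.
move=> ID z; apply/eqP; rewrite -sqnorm_eq0 eq_le sqnorm_ge0 andbT.
apply: (cvgr_to_ge (@cvg_harmonic R)); apply: nearW => n.
have [nu nuE] := ID n.+1 isT; have cE := same_law_charf nuE.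
have z' : charf nu (2 * t) = 0.
  have := cE (2 * t); rewrite charf_convolution_power z => /eqP.
  by rewrite expf_eq0/= => /eqP.
have h := charf_half_zero z'.
rewrite -cE charf_convolution_power sqnormX.
apply: (@le_trans _ _ ((1 / 2) ^+ n.+1)).
  by rewrite ler_pXn2r ?nnegrE ?sqnorm_ge0// divr_ge0.
rewrite expr_div_n expr1n mul1r lef_pV2 ?posrE ?exprn_gt0//.
by rewrite -natrX ler_nat ltnW// ltn_expl.
Qed.

End zeros.

Section counterexample.
Context {R : realType}.
Notation PR := (probability (measurableTypeR R) R).

Definition abs_left_RV (z : measurableTypeR R * measurableTypeR R) : R := `|(z.1 : R)|.

Lemma measurable_abs_left_RV : measurable_fun setT abs_left_RV.
Proof. by apply: measurableT_comp; [exact: normr_measurable|exact: measurable_fst]. Qed.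

HB.instance Definition _ :=
  isMeasurableFun.Build _ _ _ _ abs_left_RV measurable_abs_left_RV.

Lemma product_law_boolean_stable_mixtures (alpha rho : R) (q b : PR) :
  is_boolean_stable alpha rho b -> exists m : PR,
  boolean_stable_mixtures alpha rho m /\
  forall f : R -> R, bounded_mfun (f : measurableTypeR R -> R) ->
    \int[m]_x f x = \int[q]_x \int[b]_y f (`|x| * y).
Proof.
move=> bst.
pose P : probability (measurableTypeR R * measurableTypeR R)%type R := (q \x b)%E.
have PAB A B : measurable A -> measurable B -> P (A `*` B) = (q A * b B)%E.
  by move=> mA mB; exact: product_measure1E.
pose Y (z : measurableTypeR R * measurableTypeR R) : measurableTypeR R :=
  abs_left_RV z * right_RV z.
have mY : measurable_fun setT Y.
  by apply: (@measurable_funM _ _ R); [exact: measurable_abs_left_RV|exact: measurable_snd].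
pose Y' : {mfun (measurableTypeR R * measurableTypeR R)%type >-> measurableTypeR R} :=
  HB.pack Y (isMeasurableFun.Build _ _ _ _ Y mY).
pose pre (A : set R) : set (measurableTypeR R) := (fun x : R => `|x|) @^-1` A.
have mpre A : measurable A -> measurable (pre A).
  by move=> mA; rewrite -[pre A]setTI; exact: (@normr_measurable R setT).
have PX A : measurable A -> P (abs_left_RV @^-1` A) = q (pre A).
  move=> mA; have -> : abs_left_RV @^-1` A = pre A `*` setT.
    by apply/seteqP; split => -[x y]//= [].
  rewrite PAB//; last exact: mpre.
  by rewrite probability_setT mule1.
have PE B : measurable B -> P (right_RV @^-1` B) = b B.
  move=> mB; have -> : right_RV @^-1` B = setT `*` B by apply/seteqP; split => -[x y]//= [].
  by rewrite PAB// probability_setT mul1e.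
exists (distribution P Y' : PR); split.
  exists b; split => //; exists _, _, P, abs_left_RV, right_RV; split.
  - move=> A B mA mB; rewrite PX// PE//.
    have -> : abs_left_RV @^-1` A `&` right_RV @^-1` B = pre A `*` B by [].
    by rewrite PAB//; exact: mpre.
  - by move=> z; exact: normr_ge0.
  - by move=> B mB; rewrite /pushforward PE.
  - by move=> A mA.
move=> f bf; rewrite Rintegral_distribution//.
rewrite (Rintegral_prod1 q b (f := fun z => f (`|z.1 : R| * z.2)))//.
exact: (bounded_mfun_comp bf mY).
Qed.

Lemma exists_two_point_law (x y w : R) : 0 <= w <= 1 ->
  exists q : PR, forall f : R -> R, bounded_mfun (f : measurableTypeR R -> R) ->
    \int[q]_x f x = w * f x + (1 - w) * f y.
Proof.
move=> /andP[w0 w1]; pose D : PR := \d_(0 : measurableTypeR R).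
have D1 (c : R) : (\int[D]_x c%:E = c%:E)%E.
  by rewrite integral_cst// [X in (_ * X)%E](probability_setT D) mule1.
have [q qE] := @exists_law R _ _ D (fun=> x) (fun=> y) (fun=> w) (fun=> 1 - w)
  (measurable_cst _) (measurable_cst _) (measurable_cst _) (measurable_cst _)
  (fun=> w0) (fun=> ltac:(by rewrite subr_ge0)) ltac:(by rewrite !D1 -EFinD addrC subrK).
by exists q => f bf; rewrite qE// !Rintegral_prob_cst [f x * _]mulrC [f y * _]mulrC.
Qed.

(** The law of [X (c + s C)], with [C] a Cauchy variable and [X] in [{1, 2}],
    has a characteristic function that vanishes at [pi / |c|] but not at half
    of it. *)
Theorem boolean_stable_not_ID (rho : R) : 0 <= rho <= 1 -> rho != 1 / 2 ->
  ~ (boolean_stable_mixtures 1 rho `<=` infinitely_divisible).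
Proof.
move=> r01 rh sub; have [/andP[r0 r1] p0] := (r01, pi_gt0 R).
pose s := sin (rho * pi); pose c := - cos (rho * pi).
have rp : 0 <= rho * pi <= pi.
  by apply/andP; split; [exact: mulr_ge0 r0 (ltW p0)|exact: ler_piMl (ltW p0) r1].
have s0 : 0 <= s by exact: sin_ge0_pi.
have c0 : c != 0.
  rewrite oppr_eq0; apply: contra rh => /eqP cz.
  have : rho * pi = pi / 2.
    by apply: (cos_inj (x := rho * pi)); rewrite ?in_itv/= ?cos_pihalf//; apply/andP; split; lra.
  by move=> rpE; apply/eqP; apply: (mulIf (lt0r_neq0 p0)); rewrite rpE; field.
have [b bE] := @exists_cauchy_law R s c s0.
have bst : is_boolean_stable 1 rho b by exact: cauchy_law_boolean_stable.
pose t0 := pi / `|c|; have nc : 0 < `|c| by rewrite normr_gt0.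
have t0p : 0 < t0 by rewrite divr_gt0.
pose E := expR (- (s * t0)); have E0 : 0 < E by exact: expR_gt0.
pose w := E / (1 + E).
have E1 : 0 < 1 + E by rewrite addr_gt0.
have w01 : 0 <= w <= 1.
  apply/andP; split; first by apply: divr_ge0; exact: ltW.
  by rewrite /w ler_pdivrMr// mul1r lerDr.
have [q qE] := exists_two_point_law 1 2 w01.
have [m [mB mE]] := product_law_boolean_stable_mixtures q bst.
have bc (f : R -> R) : bounded_mfun (f : measurableTypeR R -> R) ->
    \int[m]_x f x = w * \int[b]_y f (1 * y) + (1 - w) * \int[b]_y f (2 * y).
  move=> bf; rewrite mE// (qE (fun x => \int[b]_y f (`|x| * y))).
    by rewrite normr1 ger0_norm.
  apply: (@bounded_mfun_Rintegral1 _ _ _ _ _ q b (fun z => f (`|z.1 : R| * z.2))).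
  apply: (bounded_mfun_comp bf); apply: (@measurable_funM _ _ R); last exact: measurable_snd.
  exact: measurable_abs_left_RV.
have cE t : charf m t = w%:C * charf b t + (1 - w)%:C * charf b (2 * t).
  rewrite /charf !bc; [|exact: bsin|exact: bcos].
  have e1 (f : R -> R) : \int[b]_y f (t * (1 * y)) = \int[b]_y f (t * y).
    by apply: eq_Rintegral => y _; rewrite mul1r.
  have e2 (f : R -> R) : \int[b]_y f (t * (2 * y)) = \int[b]_y f (2 * t * y).
    by apply: eq_Rintegral => y _; rewrite mulrCA mulrA.
  rewrite (e1 cos) (e1 sin) (e2 cos) (e2 sin).
  apply/eqP; rewrite eq_complex !Re_add !Im_add !Re_mul !Im_mul/=.
  by rewrite !mul0r !subr0 !addr0 !eqxx.
have ct0 : `|c * t0| = pi by rewrite normrM (gtr0_norm t0p) mulrC divfK// gt_eqF.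
have cosc : cos (c * t0) = -1.
  have -> : cos (c * t0) = cos `|c * t0| by case: (ger0P (c * t0)) => _; rewrite ?cosN.
  by rewrite ct0 cospi.
have sinc : sin (c * t0) = 0.
  have : sin `|c * t0| = 0 by rewrite ct0 sinpi.
  by case: (ger0P (c * t0)) => _ //; rewrite sinN => /eqP; rewrite oppr_eq0 => /eqP.
have b1 : charf b t0 = (- E)%:C.
  by rewrite bE (gtr0_norm t0p) cosc sinc mulrN1 mulr0.
have b2 : charf b (2 * t0) = (E * E)%:C.
  have t2 : 0 < 2 * t0 by apply: mulr_gt0.
  rewrite bE (gtr0_norm t2).
  have -> : c * (2 * t0) = c * t0 + c * t0 by ring.
  rewrite cosD sinD cosc sinc !mulr0 !mul0r subr0 addr0 mulrNN !mulr1 mulr0 /E -expRD.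
  by congr ((expR _)%:C); ring.
have z : charf m t0 = 0.
  rewrite cE b1 b2 -!rmorphM -rmorphD /w; congr (_%:C) => //; field.
  by rewrite gt_eqF.
have := infinitely_divisible_zero (sub _ mB) (_ : charf m (2 * (t0 / 2)) = 0).
have h2 : 2 * (t0 / 2) = t0 by field.
rewrite h2 => /(_ z); rewrite cE h2 b1 bE => /(congr1 (@complex.Im R)).
rewrite Im_add !Im_mul/= !mul0r !mulr0 !addr0 => /eqP.
rewrite mulf_eq0 gt_eqF/=; last by rewrite divr_gt0.
rewrite mulf_eq0 gt_eqF ?expR_gt0//= => /eqP sh.
have := cos2Dsin2 (c * (t0 / 2)); rewrite sh expr0n/= addr0 => ch.
have : cos (c * t0) = cos (c * (t0 / 2)) ^+ 2 - sin (c * (t0 / 2)) ^+ 2.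
  by have -> : c * t0 = c * (t0 / 2) + c * (t0 / 2); [field|rewrite cosD !expr2].
by rewrite ch sh cosc expr0n/= subr0; lra.
Qed.

End counterexample.

(** * Symmetric Boolean stable laws of index below one *)

Section rotation.
Context {R : realType}.
Notation PR := (probability (measurableTypeR R) R).
Notation mu := (@lebesgue_measure R).
Notation Re := complex.Re.
Notation Im := complex.Im.
Variable (a : R).
Hypotheses (a0 : 0 < a) (a1 : a < 1).

Let th : R := a * (pi / 2).

Let th_ge0 : 0 <= th.
Proof. by rewrite /th mulr_ge0 ?ltW// divr_gt0// pi_gt0. Qed.

Let th_le : th <= pi / 2.
Proof. by rewrite /th ler_piMl ?ltW// divr_gt0// pi_gt0. Qed.

Notation den := (chden a th).

Let strip (t : R) : `|t| < (pi - th) / a -> forall v, den (v, t) != 0.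
Proof.
move=> tt v; apply: chden_neq0 => //.
by move: tt; rewrite ltr_pdivlMr// normrM (gtr0_norm a0) mulrC.
Qed.

Let strip_width : pi / 2 < (pi - th) / a.
Proof.
rewrite ltr_pdivlMr// /th; have p0 := pi_gt0 R; have b := a1.
have : a * pi < pi by rewrite gtr_pMl.
by rewrite mulrC mulrA; lra.
Qed.

(** Turning the half-line [e^v > 0] onto the imaginary half-line makes
    [e^(i tau x)] exponentially small. *)
Definition rotated (tau : R) (q : R * R) : R[i] :=
  Cexp ((0 +i* tau) * Cexp ((1 * q.1) +i* (1 * q.2))) * (den q)^-1.

Definition rotated' (tau : R) (q : R * R) : R[i] :=
  ((0 * Cexp ((1 * q.1) +i* (1 * q.2)) + (0 +i* tau) * (1%:C * Cexp ((1 * q.1) +i* (1 * q.2)))) *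
   Cexp ((0 +i* tau) * Cexp ((1 * q.1) +i* (1 * q.2)))) * (den q)^-1 +
  Cexp ((0 +i* tau) * Cexp ((1 * q.1) +i* (1 * q.2))) *
   (- (chden' a q * (den q)^-1 * (den q)^-1)).

Let holomorphic_rotated tau (v t : R) : - ((pi - th) / a) < t < (pi - th) / a ->
  holomorphic_at (rotated tau) (rotated' tau) (v, t).
Proof.
rewrite -ltr_norml => tt; apply: holomorphicM.
  apply: holomorphic_Cexp; apply: holomorphicM; first exact: holomorphic_cst.
  by apply: holomorphic_Cexp; exact: holomorphic_linear.
by apply: holomorphicV; [exact: strip|exact: holomorphic_chden].
Qed.

Let rotated_far tau (v t : R) : 0 <= tau -> 0 <= t <= pi / 2 -> 4 / a <= `|v| ->
  `|Im (rotated tau (v, t))| <= (2 / a) / `|v|.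
Proof.
move=> tau0 /andP[t0 t2] vf.
have av : 4 <= a * `|v| by move: vf; rewrite ler_pdivrMr// mulrC.
have far := chden_far th t av.
have v0 : 0 < `|v| by apply: lt_le_trans vf; rewrite divr_gt0.
have p0 := pi_gt0 R.
have s0 : 0 <= sin t by apply: sin_ge0_pi; apply/andP; split; lra.
have -> : 2 / a / `|v| = 2 / (a * `|v|) by rewrite invfM mulrA.
have r0 : 0 <= 2 / (a * `|v|) by rewrite divr_ge0// mulr_ge0// ltW.
rewrite -(@ler_pXn2r _ 2%N)// ?nnegrE//; apply: le_trans (Im_sqnorm _) _.
rewrite /rotated sqnormM sqnormV sqnorm_Cexp Re_mul Re_Cexp Im_Cexp/= !mul1r mul0r sub0r.
have e1 : expR (- (tau * (expR v * sin t))) ^+ 2 <= 1.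
  rewrite -[leRHS](expr1n _ 2) ler_pXn2r ?nnegrE ?expR_ge0//.
  by rewrite -expR0 ler_expR oppr_le0 !mulr_ge0 ?expR_ge0.
have av0 : 0 < a * `|v| by exact: mulr_gt0.
have d0 : 0 < (a * `|v|) ^+ 2 / 4 by rewrite divr_gt0// exprn_gt0.
have S0 : 0 < sqnorm (den (v, t)) by exact: lt_le_trans far.
have -> : (2 / (a * `|v|)) ^+ 2 = 1 * ((a * `|v|) ^+ 2 / 4)^-1.
  by move: (a * `|v|) av0 => x x0; field; rewrite gt_eqF.
apply: ler_pM; [by rewrite sqr_ge0|by rewrite invr_ge0 ltW|exact: e1|by rewrite lef_pV2].
Qed.

Definition rotated_density (v : R) : R := Re (den (v, pi / 2))^-1.

Let den0 (v : R) : den (v, 0) = (expR (a * v) + expR (- (a * v)) + 2 * cos th)%:C.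
Proof.
by apply/eqP; rewrite eq_complex Re_chden Im_chden/= mulr0 cos0 sin0 mulr0 mulr1 mulNr !eqxx.
Qed.

Let Re_rotated0 tau (v : R) : Re (rotated tau (v, 0)) =
  cos (tau * expR v) / (expR (a * v) + expR (- (a * v)) + 2 * cos th).
Proof.
have -> : rotated tau (v, 0) = (cos (tau * expR v) +i* sin (tau * expR v)) *
    ((expR (a * v) + expR (- (a * v)) + 2 * cos th)^-1)%:C.
  rewrite /rotated den0; congr (_ * _); last by rewrite fmorphV.
  apply/eqP; rewrite eq_complex Re_Cexp Im_Cexp Re_mul Re_Cexp Im_Cexp Im_mul Re_Cexp Im_Cexp/=.
  by rewrite !mul1r cos0 sin0 !mulr0 !mul0r !mulr1 subr0 add0r expR0 !mul1r !eqxx.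
by rewrite Re_mul/= mulr0 subr0.
Qed.

Let Re_rotated1 tau (v : R) : Re (rotated tau (v, pi / 2)) =
  expR (- (tau * expR v)) * rotated_density v.
Proof.
have -> : rotated tau (v, pi / 2) = (expR (- (tau * expR v)))%:C * (den (v, pi / 2))^-1.
  rewrite /rotated; congr (_ * _).
  apply/eqP; rewrite eq_complex Re_Cexp Im_Cexp Re_mul Re_Cexp Im_Cexp Im_mul Re_Cexp Im_Cexp/=.
  by rewrite !mul1r cos_pihalf sin_pihalf !mulr0 !mul0r !mulr1 sub0r addr0 cos0 sin0 mulr1 mulr0 !eqxx.
by rewrite Re_mul (_ : Im (expR (- (tau * expR v)))%:C = 0)// mul0r subr0.
Qed.

Let rotated_density_ge0 v : 0 <= rotated_density v.
Proof.
rewrite /rotated_density Re_inv divr_ge0//; last by rewrite addr_ge0 ?sqr_ge0.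
rewrite Re_chden; have c := chden_cos_ge0 th_ge0 th_le.
by apply: addr_ge0; rewrite mulr_ge0// addr_ge0// expR_ge0.
Qed.

Let measurable_rotated_density : measurable_fun setT rotated_density.
Proof.
have -> : rotated_density = fun v => Re (den (v, pi / 2)) /
    (Re (den (v, pi / 2)) ^+ 2 + Im (den (v, pi / 2)) ^+ 2).
  by apply/funext => v; rewrite /rotated_density Re_inv.
have me (c : R) : measurable_fun setT (fun v : R => expR (c * v)).
  by apply: measurableT_comp => //; exact: measurable_funM.
have mR : measurable_fun setT (fun v : R => Re (den (v, pi / 2))).
  under eq_fun do rewrite Re_chden.
  by apply: measurable_funD => //; apply: measurable_funM => //; exact: measurable_funD.
have mI : measurable_fun setT (fun v : R => Im (den (v, pi / 2))).
  under eq_fun do rewrite Im_chden.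
  by apply: measurable_funM => //; exact: measurable_funB.
apply: measurable_funM => //; apply: (measurableT_comp measurable_inv).
by apply: measurable_funD; exact: measurable_funX.
Qed.

Let kernel (v : R) : R := (expR (a * v) + expR (- (a * v)) + 2 * cos th)^-1.

Lemma rotation (tau : R) : 0 <= tau -> mu.-integrable setT (EFin \o kernel) ->
  (\int[mu]_v (expR (- (tau * expR v)) * rotated_density v)%:E =
   (\int[mu]_v (cos (tau * expR v) * kernel v))%:E)%E.
Proof.
move=> tau0 ik.
have ick : mu.-integrable setT (EFin \o (fun v => cos (tau * expR v) * kernel v)).
  have bc : bounded_mfun (fun v : measurableTypeR R => cos (tau * expR (v : R))).
    by apply: (bounded_mfun_cos (f := fun v => tau * expR v)); exact: measurable_funM.
  exact: (integrable_bounded_density bc ik).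
have p0 := pi_gt0 R; have p2 : 0 < pi / 2 :> R by rewrite divr_gt0.
have W := strip_width.
have W0 : - ((pi - th) / a) < 0 by rewrite oppr_lt0; exact: lt_trans W.
have c := @contour_shift_Re _ (rotated tau) (rotated' tau) _ _ 0 (pi / 2) (2 / a) (4 / a)
  W0 p2 W (holomorphic_rotated tau) (fun v t tt vf => rotated_far tau0 tt vf).
have c0 : \int[mu]_(v in `[(- n.+1%:R), n.+1%:R]) Re (rotated tau (v, 0)) @[n --> \oo]
    --> \int[mu]_v (cos (tau * expR v) * kernel v).
  have := cvg_Rintegral_symmetric ick.
  rewrite -(cvg_shiftS (fun n : nat => \int[mu]_(v in `[(- n%:R), n%:R]) _)).
  apply: cvg_ext => n; by apply: eq_Rintegral => v _; rewrite Re_rotated0.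
have c1 := cvgD c c0; rewrite add0r in c1.
pose g v := expR (- (tau * expR v)) * rotated_density v.
have mg : measurable_fun setT g.
  apply: measurable_funM => //; apply: measurableT_comp => //.
  by apply: measurableT_comp => //; exact: measurable_funM.
have g0 v : 0 <= g v by rewrite mulr_ge0 ?expR_ge0.
have bg : forall n : nat, mu.-integrable `[(- n.+1%:R), n.+1%:R] (EFin \o g).
  move=> n; apply: continuous_compact_integrable; first exact: segment_compact.
  apply: continuous_in_subspaceT => v _.
  have [d _ _ _ _] : holomorphic_at (rotated tau) (rotated' tau) (v, pi / 2).
    by apply: holomorphic_rotated; rewrite W (lt_trans W0).
  have d' : is_derive v 1 g (Re (rotated' tau (v, pi / 2))).
    have -> : g = (fun v => Re (rotated tau (v, pi / 2))).
      by apply/funext => u; rewrite Re_rotated1.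
    exact: d.
  exact: (has_derive_continuous d').
have E n : (\int[mu]_(v in `[(- n.+1%:R)%R, (n.+1%:R)%R]) (g v)%:E)%E =
   (\int[mu]_(v in `[(- n.+1%:R), n.+1%:R]) Re (rotated tau (v, pi / 2)) -
   \int[mu]_(v in `[(- n.+1%:R), n.+1%:R]) Re (rotated tau (v, 0)) +
   \int[mu]_(v in `[(- n.+1%:R), n.+1%:R]) Re (rotated tau (v, 0)))%:E.
  rewrite subrK; under eq_Rintegral do rewrite Re_rotated1.
  by rewrite fineK//; apply: integrable_fin_num (bg n); exact: measurable_itv.
have e1 := cvg_integral_symmetric mg g0.
have e2 : ((\int[mu]_(v in `[(- n.+1%:R)%R, (n.+1%:R)%R]) Re (rotated tau (v, (pi / 2)%R)) -
   \int[mu]_(v in `[(- n.+1%:R)%R, (n.+1%:R)%R]) Re (rotated tau (v, 0%R)) +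
   \int[mu]_(v in `[(- n.+1%:R)%R, (n.+1%:R)%R]) Re (rotated tau (v, 0%R)))%R%:E @[n --> \oo] -->
    (\int[mu]_v (cos (tau * expR v) * kernel v))%R%:E)%E.
  by apply: cvg_EFin; [apply: nearW|exact: c1].
move: e1; under eq_fun do rewrite E; move=> e1.
exact: (cvg_unique _ e1 e2).
Qed.

(** At [tau = 0] the rotated integral is the total mass, so that the rotated weight
    is itself the density of a law, whose Laplace transform is the characteristic
    function of [b]. *)
Lemma boolean_stable_laplace (b : PR) : is_boolean_stable a (1 / 2) b ->
  exists q : PR, forall t, charf b t = (laplace q `|t|)%:C.
Proof.
move=> bst; have p0 := pi_gt0 R.
have half : (1 / 2 : R) * pi = pi / 2 by field.
have half' : (1 - 1 / 2 : R) * pi = pi / 2 by field.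
have h01 : 0 <= (1 / 2 : R) <= 1 by apply/andP; split; lra.
have a01 : 0 < a <= 1 by rewrite a0 ltW.
have [] := boolean_stable_density bst a01 h01.
- by rewrite half; exact: th_le.
- by rewrite half'; exact: th_le.
rewrite half half' -/th => ig _ bE.
have s0 : 0 < sin th.
  apply: sin_gt0_pi; have t2 := th_le; apply/andP; split; last by lra.
  by rewrite /th mulr_gt0// divr_gt0.
pose k := pi^-1 * sin th; have k0 : 0 < k by rewrite mulr_gt0// invr_gt0.
have gE v : pi^-1 * stable_kernel a v th = k * kernel v.
  by rewrite /stable_kernel /k -mulrA.
have ik : mu.-integrable setT (EFin \o kernel).
  have -> : EFin \o kernel = fun v => (k^-1%:E * (pi^-1 * stable_kernel a v th)%:E)%E.
    by apply/funext => v; rewrite /= gE -EFinM mulrA mulVf ?mul1r// gt_eqF.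
  by apply: integrableZl => //; exact: ig.
have ick (f : R -> R) : bounded_mfun (f : measurableTypeR R -> R) -> mu.-integrable setT (EFin \o (fun v => f v * kernel v)).
  by move=> bf; exact: integrable_bounded_density.
have Eb (f : R -> R) : bounded_mfun (f : measurableTypeR R -> R) -> (forall x, f (- x) = f x) ->
    \int[b]_x f x = 2 * k * \int[mu]_v (f (expR v) * kernel v).
  move=> bf fN; rewrite bE//; under [X in _ + X]eq_Rintegral do rewrite fN.
  have E : \int[mu]_v (f (expR v) * (pi^-1 * stable_kernel a v th)) =
      k * \int[mu]_v (f (expR v) * kernel v).
    rewrite -RintegralZl//; last first.
      apply: (ick (f \o expR)); apply: (bounded_mfun_comp bf); exact: measurable_expR.
    by apply: eq_Rintegral => v _; rewrite gE mulrCA.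
  by rewrite E; ring.
pose w v := 2 * k * rotated_density v.
have k2 : 0 <= 2 * k by rewrite mulr_ge0// ltW.
have w0 v : 0 <= w v by rewrite mulr_ge0.
have mw : measurable_fun setT w by exact: measurable_funM.
have rot tau : 0 <= tau ->
    (\int[mu]_v (expR (- (tau * expR v)) * w v)%:E = (\int[b]_x cos (tau * x))%:E)%E.
  move=> tau0; rewrite (Eb (fun x => cos (tau * x))); last 2 first.
  - exact: bcos.
  - by move=> x; rewrite mulrN cosN.
  rewrite [RHS]EFinM -rotation// -ge0_integralZl//.
  - by apply: eq_integral => v _; rewrite -EFinM /w mulrCA.
  - apply/measurable_EFinP; apply: measurable_funM => //; apply: measurableT_comp => //.
    by apply: measurableT_comp => //; exact: measurable_funM.
  - by move=> v _; rewrite lee_fin mulr_ge0 ?expR_ge0.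
have tot : (\int[mu]_v (w v)%:E + \int[mu]_v (0 : R)%:E = 1)%E.
  rewrite integral0 adde0; have := rot 0 (lexx 0).
  under eq_integral do rewrite mul0r oppr0 expR0 mul1r.
  by move=> ->; under eq_Rintegral do rewrite mul0r cos0; rewrite Rintegral_prob_cst.
have [q qE] := @exists_law R _ _ mu (@expR R) (fun=> 0) w (fun=> 0)
  (@measurable_expR R) (measurable_cst _) mw (measurable_cst _) w0 (fun=> lexx 0) tot.
exists q => t.
have qL r : 0 <= r -> laplace q r = \int[b]_x cos (r * x).
  move=> r0; rewrite /laplace qE; last exact: bounded_laplace.
  under [X in _ + X]eq_Rintegral do rewrite mulr0.
  rewrite Rintegral_cst// mul0r addr0; apply: EFin_inj; rewrite -rot//.
  have wi : mu.-integrable setT (EFin \o w).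
    apply/integrableP; split; first exact/measurable_EFinP.
    under eq_integral do rewrite /= ger0_norm//.
    by move: tot; rewrite integral0 adde0 => ->; rewrite ltry.
  rewrite fineK; first by apply: eq_integral => v _; rewrite ger0_norm ?expR_ge0.
  apply: integrable_fin_num => //.
  have be : bounded_mfun (fun v : measurableTypeR R => expR (- (r * `|expR (v : R)|))).
    have me : measurable_fun setT (@expR R : measurableTypeR R -> measurableTypeR R).
      exact: measurable_expR.
    exact: (bounded_mfun_comp (bounded_laplace r0) me).
  exact: (integrable_bounded_density be wi).
rewrite qL// /charf; congr (_ +i* _).
  apply: eq_Rintegral => x _; case: (ger0P t) => _ //.
  by rewrite mulNr cosN.
rewrite bE; last exact: bsin.
under [X in _ + X]eq_Rintegral do rewrite mulrN sinN mulNr -mulN1r.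
rewrite RintegralZl//; first by rewrite mulN1r subrr.
under [X in integrable _ _ X]eq_fun do rewrite /= gE mulrCA.
have bs : bounded_mfun (fun v : measurableTypeR R => sin (t * expR (v : R))).
  by apply: (bounded_mfun_sin (f := fun v => t * expR v)); exact: measurable_funM.
under [X in integrable _ _ X]eq_fun do rewrite EFinM.
by apply: integrableZl => //; exact: (ick _ bs).
Qed.

End rotation.

(** * Products of independent variables in logarithmic coordinates *)

Section products.
Context {R : realType}.
Notation PR := (probability (measurableTypeR R) R).
Notation mu := (@lebesgue_measure R).

Lemma Rintegral_itv_shift (K : R -> R) (v1 v2 c : R) : continuous K -> v1 <= v2 ->
  \int[mu]_(u in `[v1, v2]) K (u - c) = \int[mu]_(u in `[(v1 - c), (v2 - c)]) K u.
Proof.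
move=> cK v12; rewrite /Rintegral; congr fine; apply/esym.
have dF (v : R) : is_derive v 1 (fun v : R => v - c) (1 : R).
  by diff; rewrite /= addr0.
have F1 : derive1 (fun v : R => v - c) = fun=> (1 : R).
  by apply/funext => v; rewrite derive1E; apply: derive_val.
have cF (v : R) : (fun v : R => v - c) u @[u --> v] --> v - c.
  by apply: cvgB; [exact: cvg_id|exact: cvg_cst].
rewrite (@integration_by_substitution_increasing _ (fun v : R => v - c) K v1 v2)//.
- apply: eq_integral => v _; rewrite F1 /=; congr EFin.
  by rewrite /GRing.mul_fun/= mulr1.
- by move=> x y _ _ xy; rewrite ltrD2r.
- by rewrite F1 => v _; exact: cvg_cst.
- by rewrite F1; exact: is_cvg_cst.
- by rewrite F1; exact: is_cvg_cst.
- split; first by move=> v _; have [] := dF v.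
    by apply: cvg_at_right_filter; exact: cF.
  by apply: cvg_at_left_filter; exact: cF.
- by apply: continuous_subspaceT.
Qed.

(** The law [m] has the densities [g] and [h] in the logarithmic coordinates of
    the two half-lines. *)
Definition log_law (m : PR) (g h : R -> R) := forall f : R -> R,
  bounded_mfun (f : measurableTypeR R -> R) ->
  \int[m]_x f x = \int[mu]_v (f (expR v) * g v) + \int[mu]_v (f (- expR v) * h v).

Lemma log_law_same m1 m2 g h : log_law m1 g h -> log_law m2 g h -> same_law m1 m2.
Proof. by move=> m1E m2E; apply/same_lawP => f bf; rewrite m1E// m2E. Qed.

(** Products of independent variables are convolutions in logarithmic
    coordinates. *)
Theorem product_log_law (p q : PR) (x1 w1 w2 K g1 g2 : R -> R) :
  (forall f : R -> R, bounded_mfun (f : measurableTypeR R -> R) ->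
     \int[p]_x f x = \int[mu]_v (f (expR (x1 v)) * w1 v) + \int[mu]_v (f (- expR (x1 v)) * w2 v)) ->
  log_law q K (fun=> 0) ->
  continuous K -> (forall v, 0 <= K v) -> bounded_mfun K -> mu.-integrable setT (EFin \o K) ->
  bounded_mfun g1 -> bounded_mfun g2 -> (forall v, 0 <= g1 v) -> (forall v, 0 <= g2 v) ->
  (forall u, \int[mu]_v (K (u - x1 v) * w1 v) = g1 u) ->
  (forall u, \int[mu]_v (K (u - x1 v) * w2 v) = g2 u) ->
  log_law (product_law p q) g1 g2.
Proof.
move=> pE qE' cK K0 bK iK bg1 bg2 g10 g20 g1E g2E.
have qE (f : R -> R) : bounded_mfun (f : measurableTypeR R -> R) ->
    \int[q]_x f x = \int[mu]_v (f (expR v) * K v).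
  move=> bf; rewrite qE'//; under [X in _ + X]eq_Rintegral do rewrite mulr0.
  by rewrite Rintegral_cst// mul0r addr0.
pose k (u x : R) : R := \1_(`]0, +oo[%classic : set R) x * K (u - ln x).
have kgt0 (u v : R) : k u (expR v) = K (u - v).
  by rewrite /k indicE mem_setE in_itv/= expR_gt0 mul1r expRK.
have kle0 (u x : R) : x <= 0 -> k u x = 0.
  by move=> x0; rewrite /k indicE mem_setE in_itv/= ltNge x0 mul0r.
have mul_b (f : R -> R) (x : R) : bounded_mfun (f : measurableTypeR R -> R) ->
    bounded_mfun (fun y : measurableTypeR R => f (x * y)).
  by move=> bf; exact: bounded_mfun_scale.
have inner (v1 v2 x : R) : v1 < v2 ->
    \int[q]_y window (expR v1) (expR v2) (x * y) = \int[mu]_(u in `[v1, v2]) k u x.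
  move=> v12; rewrite (qE (fun y => window (expR v1) (expR v2) (x * y))); last first.
    by apply: mul_b; exact: bounded_window.
  have [x0|x0] := leP x 0.
    have E1 y : window (expR v1) (expR v2) (x * expR y) * K y = 0.
      have xy : x * expR y <= 0 by rewrite mulr_le0_ge0// expR_ge0.
      have e1 := expR_gt0 v1.
      have a1 : x * expR y < expR v1 by apply: le_lt_trans xy _.
      rewrite /window !indicE !mem_setE !in_itv/= [_ < x * _]ltNge [_ <= x * _]leNgt.
      by rewrite a1 (ltW a1)/= addr0 !mul0r.
    under eq_Rintegral do rewrite E1.
    under [RHS]eq_Rintegral do rewrite kle0//.
    by rewrite !Rintegral_cst// !mul0r.
  have -> : x = expR (ln x) by rewrite lnK// posrE.
  move: (ln x) => c; under [RHS]eq_Rintegral do rewrite kgt0.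
  rewrite (Rintegral_itv_shift c cK (ltW v12)) -(Rintegral_window_density (v1 - c) (v2 - c) iK).
  apply: eq_Rintegral => y _; congr (_ * _).
  rewrite -expRD /window !indicE !mem_setE !in_itv/= !ltr_expR !ler_expR.
  by rewrite !ltrBlDl !lerBlDl !ltrBrDl !lerBrDl.
have bk (v1 v2 : R) (s : measurableTypeR R -> measurableTypeR R) : measurable_fun setT s ->
    bounded_mfun (fun z : measurableTypeR R * R => k z.2 (s z.1)).
  move=> ms; have msz : measurable_fun setT (fun z : measurableTypeR R * R => s z.1 : R).
    by apply: (measurableT_comp ms); exact: measurable_fst.
  apply: bounded_mfunM.
    apply: (bounded_mfun_comp (bounded_mfun_indic _) msz); exact: measurable_itv.
  apply: (bounded_mfun_comp bK (g := fun z : measurableTypeR R * R => z.2 - ln (s z.1))).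
  apply: measurable_funB; first exact: measurable_snd.
  by apply: measurableT_comp => //; exact: measurable_ln.
have bkx (u : R) (s : measurableTypeR R -> measurableTypeR R) : measurable_fun setT s ->
    bounded_mfun (fun x : measurableTypeR R => k u (s x)).
  by move=> ms; exact: (bounded_mfun_prod2 (bk 0 0 s ms) u).
have mid : measurable_fun setT (fun x : measurableTypeR R => x) by exact: measurable_id.
have mopp : measurable_fun setT (fun x : measurableTypeR R => (- (x : R)) : measurableTypeR R).
  exact: measurable_neg_fun.
have zero (w : R -> R) (F : R -> R) : (forall v, F v = 0) -> \int[mu]_v (F v * w v) = 0.
  move=> F0; under eq_Rintegral do rewrite F0 mul0r.
  by rewrite Rintegral_cst// mul0r.
have w1E u : \int[p]_x k u x = g1 u.
  rewrite (pE (k u)); last exact: (bkx u _ mid).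
  rewrite [X in _ + X](zero _ (fun v => k u (- expR (x1 v)))); last first.
    by move=> v; rewrite kle0// oppr_le0 expR_ge0.
  by rewrite addr0 -g1E; under eq_Rintegral do rewrite kgt0.
have w2E u : \int[p]_x k u (- x) = g2 u.
  rewrite (pE (fun x => k u (- x))); last exact: (bkx u _ mopp).
  rewrite [X in X + _](zero _ (fun v => k u (- expR (x1 v)))); last first.
    by move=> v; rewrite kle0// oppr_le0 expR_ge0.
  by rewrite add0r -g2E; under eq_Rintegral do rewrite opprK kgt0.
have [_ _ main] : [/\ mu.-integrable setT (EFin \o g1), mu.-integrable setT (EFin \o g2) &
   forall f : R -> R, bounded_mfun (f : measurableTypeR R -> R) ->
     \int[product_law p q]_x f x =
     \int[mu]_v (f (expR v) * g1 v) + \int[mu]_v (f (- expR v) * g2 v)]; last exact: main.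
apply: log_density => //.
- have mS : measurable ([set 0] : set (measurableTypeR R)) by exact: measurable_set1.
  have bS : bounded_mfun (\1_([set 0] : set R) : measurableTypeR R -> R).
    exact: bounded_mfun_indic.
  have in0 (x : R) : x != 0 -> \int[q]_y \1_([set 0] : set R) (x * y) = 0.
    move=> x0; rewrite (qE (fun y => \1_([set 0] : set R) (x * y))); last exact: mul_b.
    apply: zero => v; rewrite indicE memNset//= => /eqP; rewrite mulf_eq0 (negbTE x0)/=.
    by rewrite gt_eqF// expR_gt0.
  have E : \int[product_law p q]_x \1_([set 0] : set R) x = 0.
    rewrite Rintegral_product_law//.
    rewrite (pE (fun x => \int[q]_y \1_([set 0] : set R) (x * y))); last first.
      apply: (@bounded_mfun_Rintegral1 _ _ _ _ _ p q (fun z => \1_([set 0] : set R) (z.1 * z.2))).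
      by apply: (bounded_mfun_comp bS); exact: measurable_mul_pair.
    rewrite (zero _ (fun v => \int[q]_y \1_([set 0] : set R) (expR (x1 v) * y))); last first.
      by move=> v; apply: in0; rewrite gt_eqF// expR_gt0.
    rewrite (zero _ (fun v => \int[q]_y \1_([set 0] : set R) (- expR (x1 v) * y))) ?addr0//.
    by move=> v; apply: in0; rewrite oppr_eq0 gt_eqF// expR_gt0.
  have := Rintegral_indic (product_law p q) mS.
  by rewrite [X in X%:E = _]E => <-.
- move=> v1 v2 v12; rewrite Rintegral_product_law; last exact: bounded_window.
  under eq_Rintegral do rewrite inner//.
  rewrite (Rintegral_itv_swap p v1 v2 (bk v1 v2 _ mid)).
  by apply: eq_Rintegral => u _; exact: w1E.
- move=> v1 v2 v12; rewrite Rintegral_reflection; last exact: bounded_window.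
  rewrite Rintegral_product_law; last first.
    by apply: (bounded_mfun_comp (bounded_window _ _)); exact: measurable_neg_fun.
  under eq_Rintegral => x _.
    under eq_Rintegral do rewrite -mulNr.
    rewrite inner//; over.
  rewrite (Rintegral_itv_swap p v1 v2 (bk v1 v2 _ mopp)).
  by apply: eq_Rintegral => u _; exact: w2E.
Qed.

End products.

Section exponential_factor.
Context {R : realType}.
Notation PR := (probability (measurableTypeR R) R).
Notation mu := (@lebesgue_measure R).

(** The density of [ln E] for an exponential variable [E]. *)
Definition gumbel_kernel (u : R) : R := expR u * expR (- expR u).

Lemma is_derive_gumbel (u : R) : is_derive u 1 (fun u : R => - expR (- expR u)) (gumbel_kernel u).
Proof. by rewrite /gumbel_kernel; diff; rewrite /=; ring. Qed.

Lemma continuous_gumbel : continuous gumbel_kernel.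
Proof.
move=> u; apply: (@has_derive_continuous _ _ _
  (expR u * expR (- expR u) - expR u * (expR u * expR (- expR u)))).
by rewrite /gumbel_kernel; diff; rewrite /=; ring.
Qed.

Lemma gumbel_ge0 u : 0 <= gumbel_kernel u.
Proof. by rewrite mulr_ge0 ?expR_ge0. Qed.

Lemma bounded_gumbel : bounded_mfun gumbel_kernel.
Proof.
split; first by apply: continuous_measurable_fun; exact: continuous_gumbel.
exists 1 => u; rewrite ger0_norm ?gumbel_ge0// /gumbel_kernel expRN ler_pdivrMr ?expR_gt0//.
by rewrite mul1r; apply: le_trans (expR_ge1Dx _); rewrite lerDr.
Qed.

Lemma exponential_log_law : log_law (@std_exponential R) gumbel_kernel (fun=> 0) /\
  mu.-integrable setT (EFin \o gumbel_kernel).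
Proof.
have dens (f : R -> R) : bounded_mfun (f : measurableTypeR R -> R) ->
    mu.-integrable setT (EFin \o exponential_pdf 1) /\
    \int[std_exponential]_x f x = \int[mu]_x (f x * exponential_pdf 1 x).
  move=> bf; apply: (@Rintegral_density R _ _ mu _ std_exponential f) => //.
  - exact: measurable_exponential_pdf.
  - by move=> x; apply: exponential_pdf_ge0.
have [ip _] := dens _ (bounded_window 0 1).
have [? ? ?] : [/\ mu.-integrable setT (EFin \o gumbel_kernel),
    mu.-integrable setT (EFin \o (fun=> 0 : R)) & log_law (@std_exponential R) gumbel_kernel (fun=> 0)];
  last by [].
apply: log_density => //.
- exact: bounded_gumbel.
- exact: bounded_mfun_cst.
- exact: gumbel_ge0.
- have mS : measurable ([set 0] : set (measurableTypeR R)) by exact: measurable_set1.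
  have bS : bounded_mfun (\1_([set 0] : set R) : measurableTypeR R -> R).
    exact: bounded_mfun_indic.
  have E : \int[std_exponential]_x \1_([set 0] : set R) x = 0.
    by rewrite (dens _ bS).2 Rintegral_indic_density// Rintegral_set1.
  have := Rintegral_indic (@std_exponential R) mS.
  by rewrite [X in X%:E = _]E => <-.
- move=> v1 v2 v12; rewrite (dens _ (bounded_window _ _)).2 Rintegral_window_mul//.
  have ev : expR v1 < expR v2 by rewrite ltr_expR.
  have e1 := expR_gt0 v1.
  transitivity (- expR (- expR v2) - - expR (- expR v1)); last first.
    apply/esym; apply: (@Rintegral_FTC _ gumbel_kernel (fun u => - expR (- expR u))) => //.
      by move=> u _; exact: continuous_gumbel.
    by move=> u _; exact: is_derive_gumbel.
  transitivity (\int[mu]_(x in `[(expR v1), (expR v2)]) expR (- x)).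
    apply: eq_Rintegral => x; rewrite inE/= in_itv/= => /andP[x1 _].
    rewrite exponential_pdfE; last by apply: le_trans x1; exact: ltW.
    by rewrite mul1r mulN1r.
  have dF (x : R) : is_derive x 1 (fun x : R => - expR (- x)) (expR (- x)).
    by diff; rewrite /=; ring.
  apply: (@Rintegral_FTC _ (fun x => expR (- x)) (fun x => - expR (- x))) => //.
  move=> x _; have c (y : R) : {for y, continuous (fun x : R => expR (- x))}.
    by apply: (@has_derive_continuous _ _ _ (- expR (- y))); diff; rewrite /=; ring.
  exact: c.
- move=> v1 v2 v12; rewrite Rintegral_reflection; last exact: bounded_window.
  rewrite (dens (fun x => window (expR v1) (expR v2) (- x)) _).2; last first.
    by apply: (bounded_mfun_comp (bounded_window _ _)); exact: measurable_neg_fun.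
  rewrite [RHS]Rintegral_cst//= mul0r.
  have E x : window (expR v1) (expR v2) (- x) * exponential_pdf 1 x = 0.
    have [x0|x0] := ltP x 0; first by rewrite lt0_exponential_pdf// mulr0.
    have a1 : - x < expR v1 by apply: (@le_lt_trans _ _ 0); rewrite ?oppr_le0// expR_gt0.
    rewrite /window !indicE !mem_setE !in_itv/= [_ < - x]ltNge [_ <= - x]leNgt.
    by rewrite a1 (ltW a1)/= addr0 !mul0r.
  by under eq_Rintegral do rewrite E; rewrite Rintegral_cst//= mul0r.
Qed.

(** Up to the factor [pi], the density of the logarithm of a quotient of two
    independent Gamma variables of index [1 / 2]. *)
Definition half_sech (x : R) : R := (expR (x / 2) + expR (- (x / 2)))^-1.

Lemma half_sech_ge0 x : 0 <= half_sech x.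
Proof. by rewrite invr_ge0 addr_ge0 ?expR_ge0. Qed.

Lemma half_sechN x : half_sech (- x) = half_sech x.
Proof. by rewrite /half_sech mulNr opprK addrC. Qed.

Lemma is_derive_half_sech (x : R) : is_derive x 1 (fun x : R => 2 * atan (expR (x / 2))) (half_sech x).
Proof.
diff; rewrite /= /half_sech expRN; have e0 := expR_gt0 (x / 2); field.
by rewrite !gt_eqF//= ?addr_gt0// ?mulr_gt0// ?exprn_gt0//= ltr_wpDr ?sqr_ge0.
Qed.

Lemma continuous_half_sech : continuous half_sech.
Proof.
move=> x; have e0 := expR_gt0 (x / 2); have e1 := expR_gt0 (- (x / 2)).
apply: (@has_derive_continuous _ _ _
  (- (expR (x / 2) + expR (- (x / 2))) ^- 2 * (expR (x / 2) * 2^-1 - expR (- (x / 2)) * 2^-1))).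
rewrite /half_sech; apply: has_derive_inv; first by rewrite gt_eqF// addr_gt0.
by diff; rewrite /=; field.
Qed.

Lemma bounded_half_sech : bounded_mfun half_sech.
Proof.
split; first by apply: continuous_measurable_fun; exact: continuous_half_sech.
exists 1 => x; rewrite ger0_norm ?half_sech_ge0// invf_le1 ?addr_gt0 ?expR_gt0//.
by have e1 := expR_ge1Dx (x / 2); have e2 := expR_ge1Dx (- (x / 2)); lra.
Qed.

Lemma Rintegral_itv_half_sech (n : nat) (u : R) :
  \int[mu]_(v in `[(- n.+1%:R), n.+1%:R]) half_sech (v - u) =
  2 * atan (expR ((n.+1%:R - u) / 2)) - 2 * atan (expR ((- n.+1%:R - u) / 2)).
Proof.
have n0 : - n.+1%:R < n.+1%:R :> R by apply: (@lt_trans _ _ 0); rewrite ?oppr_lt0.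
rewrite Rintegral_itv_shift//; [|exact: continuous_half_sech|exact: ltW].
apply: (@Rintegral_FTC _ half_sech (fun x => 2 * atan (expR (x / 2)))).
- by rewrite ltrD2r.
- by move=> v _; exact: continuous_half_sech.
- by move=> v _; exact: is_derive_half_sech.
Qed.

Lemma integrable_half_sech : mu.-integrable setT (EFin \o half_sech).
Proof.
apply: (@integrable_ge0_sup _ _ (2 * pi)); [exact: bounded_half_sech|exact: half_sech_ge0|].
move=> n; have := @Rintegral_itv_half_sech n 0.
under eq_Rintegral do rewrite subr0.
move=> ->; have a1 := atan_ltpi2 (expR ((n.+1%:R - 0) / 2 : R)).
have a2 := atan_gtNpi2 (expR ((- n.+1%:R - 0) / 2 : R)).
by move: (atan _) (atan _) a1 a2 => p q; lra.
Qed.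

Lemma cvg_half_sech (u : R) :
  \int[mu]_(v in `[(- n.+1%:R), n.+1%:R]) half_sech (v - u) @[n --> \oo] --> (pi : R).
Proof.
under eq_fun do rewrite Rintegral_itv_half_sech.
have h : (n.+1%:R : R) @[n --> \oo] --> +oo.
  by have := @cvgr_idn R; rewrite -(cvg_shiftS (fun n => n%:R : R)).
have -> : (pi : R) = 2 * (pi / 2) - 2 * atan 0 by rewrite atan0; field.
have y1 : (n.+1%:R - u) / 2 @[n --> \oo] --> +oo.
  apply/cvgryPge => A; near=> n; rewrite ler_pdivlMr// lerBrDr.
  by near: n; move/cvgryPge : h; exact.
have y2 : expR ((n.+1%:R - u) / 2) @[n --> \oo] --> +oo.
  apply/cvgryPge => A; near=> n; apply: (@le_trans _ _ (1 + (n.+1%:R - u) / 2)); last exact: expR_ge1Dx.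
  by rewrite -lerBlDl; near: n; move/cvgryPge : y1; exact.
have y3 : expR ((- n.+1%:R - u) / 2) @[n --> \oo] --> (0 : R).
  have c : expR (- ((n.+1%:R + u) / 2)) @[n --> \oo] --> (0 : R).
    have y4 : (n.+1%:R + u) / 2 @[n --> \oo] --> +oo.
      apply/cvgryPge => A; near=> n; rewrite ler_pdivlMr// -lerBlDr.
      by near: n; move/cvgryPge : h; exact.
    exact: (cvg_comp _ _ y4 (@cvgr_expR R)).
  by apply: cvg_ext c => n; congr expR; field.
apply: cvgB; apply: cvgMl_tmp.
  exact: (cvg_comp _ _ y2 (@cvgy_atan R)).
exact: (cvg_comp _ _ y3 (@continuous_atan R 0)).
Unshelve. all: by end_near. Qed.

Lemma Rintegral_half_sech : \int[mu]_v half_sech v = pi.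
Proof.
have c := cvg_Rintegral_symmetric integrable_half_sech.
move: c; rewrite -(cvg_shiftS (fun n : nat => \int[mu]_(v in `[(- n%:R), n%:R]) _)) => c.
have E (n : nat) : \int[mu]_(v in `[(- n.+1%:R), n.+1%:R]) half_sech (v - 0) =
    \int[mu]_(v in `[(- n.+1%:R), n.+1%:R]) half_sech v.
  by apply: eq_Rintegral => v _; rewrite subr0.
exact: (cvg_unique _ c (cvg_ext E (cvg_half_sech 0))).
Qed.

End exponential_factor.

(** * A quotient of Gamma variables *)

Section gamma_quotient.
Context {R : realType}.
Notation PR := (probability (measurableTypeR R) R).
Notation mu := (@lebesgue_measure R).

(** Up to a constant, the density of [- ln G] for a Gamma variable [G] of index
    [1 / 2]. *)
Definition gamma_kernel (y : R) : R := expR (- (y / 2)) * expR (- expR (- y)).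

Lemma gamma_kernel_ge0 y : 0 <= gamma_kernel y.
Proof. by rewrite mulr_ge0 ?expR_ge0. Qed.

Lemma continuous_gamma_kernel : continuous gamma_kernel.
Proof.
move=> y; apply: (@has_derive_continuous _ _ _
  (expR (- (y / 2)) * (expR (- y) * expR (- expR (- y))) - expR (- (y / 2)) / 2 * expR (- expR (- y)))).
by rewrite /gamma_kernel; diff; rewrite /=; field.
Qed.

Lemma gamma_kernel_le y : gamma_kernel y <= half_sech y.
Proof.
rewrite /gamma_kernel /half_sech [expR (- expR (- y))]expRN.
have -> : expR (y / 2) + expR (- (y / 2)) = expR (y / 2) * (1 + expR (- y)).
  by rewrite mulrDr mulr1 -expRD; congr (_ + expR _); field.
rewrite invfM -[(expR (y / 2))^-1]expRN; apply: ler_wpM2l; first exact: expR_ge0.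
by rewrite lef_pV2 ?posrE ?expR_gt0 ?addr_gt0 ?expR_gt0//; exact: expR_ge1Dx.
Qed.

Lemma measurable_gamma_kernel : measurable_fun setT gamma_kernel.
Proof. by apply: continuous_measurable_fun; exact: continuous_gamma_kernel. Qed.

Lemma bounded_gamma_kernel : bounded_mfun gamma_kernel.
Proof.
split; first exact: measurable_gamma_kernel.
have [_ [M HM]] := @bounded_half_sech R; exists M => y.
rewrite ger0_norm ?gamma_kernel_ge0// (le_trans (gamma_kernel_le y))//.
exact: le_trans (ler_norm _) (HM y).
Qed.

Lemma integrable_le_half_sech (f : R -> R) : measurable_fun setT f ->
  (forall v, `|f v| <= half_sech v) -> mu.-integrable setT (EFin \o f).
Proof.
move=> mf fC; apply: (@le_integrable _ _ _ mu setT measurableT _ (EFin \o half_sech)).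
- exact/measurable_EFinP.
- by move=> v _ /=; rewrite lee_fin (le_trans (fC v))// ler_norm.
- exact: integrable_half_sech.
Qed.

Lemma integrable_gamma_kernel : mu.-integrable setT (EFin \o gamma_kernel).
Proof.
apply: integrable_le_half_sech; first exact: measurable_gamma_kernel.
by move=> v; rewrite ger0_norm ?gamma_kernel_ge0 ?gamma_kernel_le.
Qed.

Lemma integrable_gamma_kernelN : mu.-integrable setT (EFin \o (fun y => gamma_kernel (- y))).
Proof.
apply: integrable_le_half_sech.
  by apply: (measurableT_comp measurable_gamma_kernel); exact: oppr_measurable.
by move=> v; rewrite ger0_norm ?gamma_kernel_ge0// -half_sechN gamma_kernel_le.
Qed.

Lemma half_sech_shift_le (u v : R) : half_sech (v - u) <= expR (`|u| / 2) * half_sech v.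
Proof.
have d1 : 0 < expR ((v - u) / 2) + expR (- ((v - u) / 2)) by rewrite addr_gt0 ?expR_gt0.
have d2 : 0 < expR (v / 2) + expR (- (v / 2)) by rewrite addr_gt0 ?expR_gt0.
rewrite /half_sech ler_pdivlMr// mulrC ler_pdivrMr// mulrDr -!expRD.
have n1 := ler_norm u; have n2 : - u <= `|u| by rewrite -normrN ler_norm.
by apply: lerD; rewrite ler_expR; lra.
Qed.

Definition gamma_mass := \int[mu]_y gamma_kernel y.

Lemma gamma_mass_gt0 : 0 < gamma_mass.
Proof.
apply: (@lt_le_trans _ _ (\int[mu]_(v in `[(0 : R), 1]) (expR (- (1 / 2)) * expR (- 1)))).
  rewrite Rintegral_cst//= lebesgue_measure_itv/= lte_fin ltr01/= subr0 mulr1.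
  by rewrite mulr_gt0 ?expR_gt0.
have i := integrable_gamma_kernel.
apply: (@le_trans _ _ (\int[mu]_(v in `[0, 1]) gamma_kernel v)).
  apply: le_Rintegral => //=.
  - apply: bounded_mfun_integrable_itv; exact: bounded_mfun_cst.
  - exact: integrableS i.
  - move=> v; rewrite in_itv/= => /andP[v0 v1]; rewrite /gamma_kernel.
    apply: ler_pM; rewrite ?expR_ge0// ler_expR lerN2.
      by rewrite ler_pM2r// invr_gt0.
    by rewrite -[leRHS]expR0 ler_expR oppr_le0.
apply: fine_le; [exact: (integrable_fin_num _ (integrableS _ _ _ i))|exact: integrable_fin_num|].
apply: ge0_subset_integral => //; first by case/integrableP: i.
by move=> v _; rewrite lee_fin gamma_kernel_ge0.
Qed.

Lemma Rintegral_scaled_gumbel (c : R) : 0 < c ->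
  mu.-integrable setT (EFin \o (fun y => expR (- y) * expR (- (c * expR (- y))))) ->
  \int[mu]_y (expR (- y) * expR (- (c * expR (- y)))) = c^-1.
Proof.
move=> c0 i; have c1 := cvg_Rintegral_symmetric i.
move: c1; rewrite -(cvg_shiftS (fun n : nat => \int[mu]_(v in `[(- n%:R), n%:R]) _)) => c1.
have dF (y : R) : is_derive y 1 (fun y : R => c^-1 * expR (- (c * expR (- y))))
    (expR (- y) * expR (- (c * expR (- y)))).
  by diff; rewrite /=; field; rewrite gt_eqF.
have cf (y : R) : {for y, continuous (fun y : R => expR (- y) * expR (- (c * expR (- y))))}.
  apply: (@has_derive_continuous _ _ _ (expR (- y) * (c * expR (- y) * expR (- (c * expR (- y))))
    - expR (- y) * expR (- (c * expR (- y))))).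
  by diff; rewrite /=; ring.
have E (n : nat) : \int[mu]_(y in `[(- n.+1%:R), n.+1%:R]) (expR (- y) * expR (- (c * expR (- y)))) =
    c^-1 * expR (- (c * expR (- n.+1%:R))) - c^-1 * expR (- (c * expR (- - n.+1%:R))).
  apply: (@Rintegral_FTC _ _ (fun y => c^-1 * expR (- (c * expR (- y))))).
  - by apply: (@lt_trans _ _ 0); rewrite ?oppr_lt0.
  - by move=> y _; exact: cf.
have h1 : expR (- (c * expR (- n.+1%:R))) @[n --> \oo] --> (1 : R).
  have h : - (c * expR (- n.+1%:R)) @[n --> \oo] --> (0 : R).
    rewrite -[X in _ --> X]oppr0 -[X in _ --> - X](mulr0 c).
    by apply: cvgN; apply: cvgMl_tmp; exact: cvg_expRN.
  by have := cvg_comp _ _ h (@continuous_expR R 0); rewrite expR0.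
have h2 : expR (- (c * expR (- - n.+1%:R))) @[n --> \oo] --> (0 : R).
  have y4 : c * expR (- - n.+1%:R) @[n --> \oo] --> +oo.
    apply/cvgryPge => A; near=> n.
    rewrite opprK mulrC -ler_pdivrMr//; apply: ltW; near: n; exact: expR_succ_cvgy.
  exact: (cvg_comp _ _ y4 (@cvgr_expR R)).
have c2 : c^-1 * expR (- (c * expR (- n.+1%:R))) - c^-1 * expR (- (c * expR (- - n.+1%:R)))
    @[n --> \oo] --> c^-1 * 1 - c^-1 * 0.
  by apply: cvgB; apply: cvgMl_tmp.
have := cvg_unique _ (cvg_ext E c1) c2.
by rewrite mulr1 mulr0 subr0 => ->.
Unshelve. all: by end_near. Qed.

Let pi_neq0 : (pi : R) != 0.
Proof. by rewrite gt_eqF ?pi_gt0. Qed.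

Let cancel_factors (p e T : R) : p != 0 -> e != 0 -> p * e^-1 * (p^-1 * e * T) = T.
Proof. by move=> ? ?; field; apply/andP. Qed.

(** A quotient of two independent Gamma variables of index [1 / 2] is an
    exponential mixture: the numerator is the product of an arcsine and an
    exponential variable. *)
Theorem half_sech_exponential : exists q r : PR,
  same_law q (product_law r std_exponential) /\
  log_law q (fun u => pi^-1 * half_sech u) (fun=> 0).
Proof.
have p0 := @pi_gt0 R; have G0 := gamma_mass_gt0.
have ih := @integrable_half_sech R; have [el ik] := @exponential_log_law R.
have zero0 : (\int[mu]_x (0 : R)%:E = 0)%E by rewrite integral0.
have mc0 : measurable_fun setT ((fun=> 0 : R) : R -> R) by exact: measurable_cst.
have b00 : bounded_mfun ((fun=> 0 : R) : R -> R) by exact: bounded_mfun_cst.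
have int1 (w : R -> R) c : mu.-integrable setT (EFin \o w) -> \int[mu]_x w x = c -> c != 0 ->
    (\int[mu]_x (c^-1 * w x)%:E + \int[mu]_x (0 : R)%:E = 1)%E.
  move=> iw wc c0; rewrite zero0 adde0.
  under eq_integral do rewrite EFinM.
  rewrite integralZl//; have wf := integrable_fin_num measurableT iw.
  rewrite -[X in (_ * X)%E](fineK wf) -EFinM; congr EFin.
  by move: wc; rewrite /Rintegral => ->; rewrite mulVf.
have msech : measurable_fun setT (fun v : R => pi^-1 * half_sech v).
  by apply: measurable_funM => //; case: (@bounded_half_sech R).
have me : measurable_fun setT (fun v : R => expR (v - ln (1 + expR v))).
  apply: measurableT_comp => //; apply: measurable_funB => //.
  by apply: measurableT_comp => //; exact: measurable_funD.
have sech0 (v : R) : 0 <= pi^-1 * half_sech v.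
  by apply: mulr_ge0; [rewrite invr_ge0; exact: ltW|exact: half_sech_ge0].
have gam0 (v : R) : 0 <= gamma_mass^-1 * gamma_kernel v.
  by apply: mulr_ge0; [rewrite invr_ge0; exact: ltW|exact: gamma_kernel_ge0].
have meN (x : R -> R) : measurable_fun setT x -> measurable_fun setT (fun v => - x v).
  by move=> mx; exact: measurableT_comp.
have [beta betaE] := @exists_law R _ _ mu (fun v => expR (v - ln (1 + expR v)))
  (fun v => - expR (v - ln (1 + expR v))) (fun v => pi^-1 * half_sech v) (fun=> 0)
  me (meN _ me) msech mc0 sech0
  (fun=> lexx 0) (int1 _ _ ih (@Rintegral_half_sech R) pi_neq0).
have [iota iotaE] := @exists_law R _ _ mu (@expR R)
  (fun v => - expR v) (fun v => gamma_mass^-1 * gamma_kernel v) (fun=> 0)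
  (@measurable_expR R) (meN _ (@measurable_expR R))
  (measurable_funM (measurable_cst _) measurable_gamma_kernel) mc0
  gam0
  (fun=> lexx 0) (int1 _ _ integrable_gamma_kernel erefl (lt0r_neq0 G0)).
pose K (u : R) := pi^-1 * gamma_mass * gamma_kernel (- u).
have c0 : 0 <= pi^-1 * gamma_mass by rewrite mulr_ge0 ?invr_ge0// ltW.
have K0 u : 0 <= K u by rewrite mulr_ge0 ?gamma_kernel_ge0.
have cK : continuous K.
  move=> u; apply: cvgMl_tmp.
  by apply: continuous_comp; [exact: opp_continuous|exact: continuous_gamma_kernel].
have bK : bounded_mfun K.
  apply: bounded_mfunM; first exact: bounded_mfun_cst.
  by apply: (bounded_mfun_comp bounded_gamma_kernel); exact: oppr_measurable.
have iK : mu.-integrable setT (EFin \o K).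
  under [X in integrable _ _ X]eq_fun do rewrite /= EFinM.
  by apply: integrableZl => //; exact: integrable_gamma_kernelN.
have zint (f : R -> R) : \int[mu]_v (f v * 0) = 0.
  by under eq_Rintegral do rewrite mulr0; rewrite Rintegral_cst// mul0r.
have gam : log_law (product_law beta std_exponential) K (fun=> 0).
  apply: (product_log_law betaE el) => //.
  - exact: continuous_gumbel.
  - exact: gumbel_ge0.
  - exact: bounded_gumbel.
  - move=> u.
    have E v : gumbel_kernel (u - (v - ln (1 + expR v))) * (pi^-1 * half_sech v) =
        pi^-1 * (expR (u / 2) * expR (- expR u)) * gamma_kernel (v - u).
      have v1 : 0 < 1 + expR v by rewrite addr_gt0 ?expR_gt0.
      have ex : expR (u - (v - ln (1 + expR v))) = expR u + expR (u - v).
        have -> : u - (v - ln (1 + expR v)) = (u - v) + ln (1 + expR v) by ring.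
        by rewrite expRD lnK ?posrE// mulrDr mulr1 -expRD subrK addrC.
      rewrite /gumbel_kernel ex /half_sech /gamma_kernel opprD (expRD (- expR u)) opprB.
      have -> : (expR (v / 2) + expR (- (v / 2)))^-1 = expR (v / 2) / (expR v + 1).
        have -> : expR v = expR (v / 2) * expR (v / 2) by rewrite -expRD; congr expR; field.
        rewrite expRN; have e0 := expR_gt0 (v / 2); field.
        by rewrite !gt_eqF//= ltr_wpDl ?mulr_ge0 ?ltW.
      have -> : expR u + expR (u - v) = expR (u - v) * (expR v + 1).
        by rewrite mulrDr mulr1 -expRD subrK.
      have -> : expR (u - v) = expR (u / 2) * expR (- ((v - u) / 2)) * expR (- (v / 2)).
        by rewrite -!expRD; congr expR; field.
      rewrite [expR (- (v / 2))]expRN; have e0 := expR_gt0 (v / 2).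
      have v2 : 0 < expR v + 1 by rewrite addrC.
      move: (expR (- expR u)) (expR (- (expR (u / 2) * expR (- ((v - u) / 2)) / expR (v / 2)))).
      by move: (pi^-1) => ip A B; field; rewrite !gt_eqF.
    under eq_Rintegral do rewrite E.
    have ig : mu.-integrable setT (EFin \o (fun v => gamma_kernel (v - u))).
      apply: (@le_integrable _ _ _ mu setT measurableT _
        (EFin \o (fun v => (expR (`|u| / 2)) * half_sech v))).
      - apply/measurable_EFinP; apply: (measurableT_comp measurable_gamma_kernel).
        by apply: measurable_funB.
      - move=> v _ /=; rewrite lee_fin ger0_norm ?gamma_kernel_ge0// ger0_norm; last first.
          by rewrite mulr_ge0 ?expR_ge0 ?half_sech_ge0.
        by apply: le_trans (gamma_kernel_le _) _; exact: half_sech_shift_le.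
      - under [X in integrable _ _ X]eq_fun do rewrite /= EFinM.
        by apply: integrableZl.
    rewrite RintegralZl// (integral_translation (- u) continuous_gamma_kernel gamma_kernel_ge0).
    rewrite -/gamma_mass /K /gamma_kernel mulNr !opprK.
    by move: (pi^-1) gamma_mass => ip G; ring.
exists (product_law iota (product_law beta std_exponential)), (product_law iota beta); split.
  exact: product_lawA.
apply: (product_log_law iotaE gam) => //.
- by apply: bounded_mfunM; [exact: bounded_mfun_cst|exact: bounded_half_sech].
- move=> u; have u1 : 0 < 1 + expR u by rewrite addr_gt0 ?expR_gt0.
  have E y : K (u - y) * (gamma_mass^-1 * gamma_kernel y) =
      pi^-1 * expR (u / 2) * (expR (- y) * expR (- ((1 + expR u) * expR (- y)))).
    rewrite /K /gamma_kernel.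
    have -> : expR (- (- (u - y) / 2)) = expR (u / 2) * expR (- (y / 2)).
      by rewrite -expRD; congr expR; field.
    have -> : expR (- ((1 + expR u) * expR (- y))) = expR (- expR (- y)) * expR (- expR (- - (u - y))).
      rewrite opprK mulrDl mul1r opprD [LHS]expRD; congr (_ * expR (- _)).
      by rewrite -expRD.
    have -> : expR (- y) = expR (- (y / 2)) * expR (- (y / 2)).
      by rewrite -expRD; congr expR; field.
    move: (expR (- (y / 2))) (expR (- expR (- - (u - y)))) => A B.
    have G1 : gamma_mass != 0 by rewrite gt_eqF.
    by move: (pi^-1) gamma_mass G1 => ip G G1; field.
  have iE : mu.-integrable setT (EFin \o (fun y => expR (- y) * expR (- ((1 + expR u) * expR (- y))))).
    have -> : (fun y => expR (- y) * expR (- ((1 + expR u) * expR (- y)))) =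
        (fun y => (pi * expR (- (u / 2)) * gamma_mass^-1 * K (u - y)) * gamma_kernel y).
      apply/funext => y.
      transitivity (pi * expR (- (u / 2)) * (K (u - y) * (gamma_mass^-1 * gamma_kernel y))).
        rewrite E [expR (- (u / 2))]expRN cancel_factors//.
        by rewrite gt_eqF// expR_gt0.
      by move: (pi * _) (K _) (gamma_mass^-1) (gamma_kernel _) => x y' z w; ring.
    have bb : bounded_mfun (fun y : measurableTypeR R => pi * expR (- (u / 2)) * gamma_mass^-1 * K (u - (y : R))).
      apply: bounded_mfunM; first exact: bounded_mfun_cst.
      apply: (bounded_mfun_comp bK (g := fun y : measurableTypeR R => u - (y : R))).
      exact: measurable_funB.
    exact: (integrable_bounded_density bb integrable_gamma_kernel).
  under eq_Rintegral do rewrite E.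
  rewrite RintegralZl// Rintegral_scaled_gumbel//.
  rewrite /half_sech -mulrA; congr (_ * _).
  have -> : expR u = expR (u / 2) * expR (u / 2) by rewrite -expRD; congr expR; field.
  rewrite expRN; have e0 := expR_gt0 (u / 2); field.
  by rewrite !gt_eqF//= ltr_wpDl ?mulr_ge0 ?ltW.
Qed.

End gamma_quotient.

(** * Hyperbolic sines in the strip *)

Section complex_sinh.
Context {R : realType}.
Notation mu := (@lebesgue_measure R).
Notation Re := complex.Re.
Notation Im := complex.Im.

Lemma Re_scale_Cexp (c : R) (z : R[i]) : Re (c%:C * Cexp z) = c * (expR (Re z) * cos (Im z)).
Proof. by rewrite Re_mul Re_Cexp mul0r subr0. Qed.

Lemma Im_scale_Cexp (c : R) (z : R[i]) : Im (c%:C * Cexp z) = c * (expR (Re z) * sin (Im z)).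
Proof. by rewrite Im_mul Im_Cexp mul0r addr0. Qed.

(** [2 sinh (k (xi - u))], with [xi] as in [chden]. *)
Definition csinh (k u : R) (q : R * R) : R[i] :=
  (expR (- k * u))%:C * Cexp ((k * q.1) +i* (k * q.2)) +
  (- expR (k * u))%:C * Cexp ((- k * q.1) +i* (- k * q.2)).

Definition csinh' (k u : R) (q : R * R) : R[i] :=
  0 * Cexp ((k * q.1) +i* (k * q.2)) +
    (expR (- k * u))%:C * (k%:C * Cexp ((k * q.1) +i* (k * q.2))) +
  (0 * Cexp ((- k * q.1) +i* (- k * q.2)) +
    (- expR (k * u))%:C * ((- k)%:C * Cexp ((- k * q.1) +i* (- k * q.2)))).

Lemma holomorphic_csinh k u p : holomorphic_at (csinh k u) (csinh' k u) p.
Proof.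
apply: holomorphicD; apply: holomorphicM; try exact: holomorphic_cst;
  by apply: holomorphic_Cexp; exact: holomorphic_linear.
Qed.

Lemma Re_csinh (k u v t : R) : Re (csinh k u (v, t)) =
  (expR (k * (v - u)) - expR (- (k * (v - u)))) * cos (k * t).
Proof.
rewrite /csinh Re_add !Re_scale_Cexp/= [- k * t]mulNr cosN.
have -> : expR (k * (v - u)) = expR (- k * u) * expR (k * v).
  by rewrite -expRD; congr expR; ring.
have -> : expR (- (k * (v - u))) = expR (k * u) * expR (- k * v).
  by rewrite -expRD; congr expR; ring.
by ring.
Qed.

Lemma Im_csinh (k u v t : R) : Im (csinh k u (v, t)) =
  (expR (k * (v - u)) + expR (- (k * (v - u)))) * sin (k * t).
Proof.
rewrite /csinh Im_add !Im_scale_Cexp/= [- k * t]mulNr sinN.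
have -> : expR (k * (v - u)) = expR (- k * u) * expR (k * v).
  by rewrite -expRD; congr expR; ring.
have -> : expR (- (k * (v - u))) = expR (k * u) * expR (- k * v).
  by rewrite -expRD; congr expR; ring.
by ring.
Qed.

Lemma sqnorm_csinh (k u v t : R) : sqnorm (csinh k u (v, t)) =
  (expR (k * (v - u)) - expR (- (k * (v - u)))) ^+ 2 + 4 * sin (k * t) ^+ 2.
Proof.
rewrite /sqnorm Re_csinh Im_csinh expRN; have e0 := expR_gt0 (k * (v - u)).
have := cos2Dsin2 (k * t); move: (expR _) (cos _) (sin _) e0 => x c s x0 cs.
have x1 : x != 0 by rewrite gt_eqF.
have xx : x * x^-1 = 1 by rewrite mulfV.
have E (y : R) : x * y = 1 -> ((x - y) * c) ^+ 2 + ((x + y) * s) ^+ 2 = (x - y) ^+ 2 + 4 * s ^+ 2.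
  move=> xy; have -> : 4 * s ^+ 2 = 4 * (x * y) * s ^+ 2 by rewrite xy mulr1.
  have -> : (x - y) ^+ 2 = (x - y) ^+ 2 * (c ^+ 2 + s ^+ 2) by rewrite cs mulr1.
  by ring.
exact: E.
Qed.

Lemma sqnorm_csinh_le (k u v t : R) : sqnorm (csinh k u (v, t)) <= 4 * expR (`|k * (v - u)|) ^+ 2.
Proof.
rewrite sqnorm_csinh; have s1 : sin (k * t) ^+ 2 <= 1.
  by rewrite -(cos2Dsin2 (k * t)) lerDr sqr_ge0.
move: (k * (v - u)) => y.
have [e1 e2] : expR y <= expR `|y| /\ expR (- y) <= expR `|y|.
  by rewrite !ler_expR ler_norm -normrN ler_norm.
have e3 := expR_gt0 y; have e4 := expR_gt0 (- y).
have xy : expR y * expR (- y) = 1 by rewrite -expRD subrr expR0.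
move: (expR y) (expR (- y)) (expR `|y|) (sin _ ^+ 2) xy e1 e2 e3 e4 s1 => x z E s xz xE zE x0 z0 s1.
have a1 : x ^+ 2 <= E ^+ 2 by rewrite ler_pXn2r// nnegrE; lra.
have a2 : z ^+ 2 <= E ^+ 2 by rewrite ler_pXn2r// nnegrE; lra.
have -> : (x - z) ^+ 2 = x ^+ 2 + z ^+ 2 - 2 * (x * z) by ring.
rewrite xz; have a3 : 0 <= (x - z) ^+ 2 by exact: sqr_ge0.
have a4 : (x - z) ^+ 2 = x ^+ 2 + z ^+ 2 - 2 * (x * z) by ring.
rewrite xz in a4; lra.
Qed.

(** [|y| <= |2 sinh (y + i t / 2)|], with [y = (v - u) / 2]. *)
Lemma sqnorm_csinh_ge (u v t : R) : (v - u) ^+ 2 / 4 <= sqnorm (csinh (1 / 2) u (v, t)).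
Proof.
rewrite sqnorm_csinh; apply: (@le_trans _ _ ((expR (1 / 2 * (v - u)) - expR (- (1 / 2 * (v - u)))) ^+ 2)); last first.
  by rewrite lerDl mulr_ge0// sqr_ge0.
have -> : (v - u) ^+ 2 / 4 = (1 / 2 * (v - u)) ^+ 2 by field.
move: (1 / 2 * (v - u)) => y.
wlog y0 : y / 0 <= y => [W|].
  have [y0|y0] := leP 0 y; first exact: W.
  have := W (- y); rewrite opprK sqrrN -[(expR (- y) - expR y) ^+ 2]sqrrN opprB; apply; lra.
have e1 := expR_ge1Dx y; have e2 : expR (- y) <= 1 by rewrite -expR0 ler_expR; lra.
by rewrite ler_pXn2r// ?nnegrE; lra.
Qed.

Lemma csinh_gt0 (u v t : R) : 0 < t < 2 * pi -> 0 < sqnorm (csinh (1 / 2) u (v, t)).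
Proof.
move=> /andP[t0 t1]; rewrite sqnorm_csinh ltr_wpDl ?sqr_ge0// mulr_gt0// exprn_gt0//.
by apply: sin_gt0_pi; apply/andP; split; lra.
Qed.

Lemma csinh_neq0 (u v t : R) : 0 < t < 2 * pi -> csinh (1 / 2) u (v, t) != 0.
Proof.
move=> /(csinh_gt0 u v) s; apply/eqP => E; move: s.
by rewrite E /sqnorm/= expr0n/= addr0 ltxx.
Qed.

(** The pole of the Poisson kernel is that of the inverse of the second
    hyperbolic sine; the first one compensates it, uniformly up to the real line. *)
Lemma sqnorm_csinh_mono (a u v t : R) : 0 < a <= 1 -> 0 < t < pi ->
  sqnorm (csinh (a / 2) u (v, t)) <= sqnorm (csinh (1 / 2) u (v, t)).
Proof.
move=> /andP[a0 a1] /andP[t0 t1]; rewrite !sqnorm_csinh; apply: lerD.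
  move: (v - u) => y; wlog y0 : y / 0 <= y => [W|].
    have [y0|y0] := leP 0 y; first exact: W.
    have := W (- y); rewrite !mulrN !opprK.
    rewrite -[(expR (- (a / 2 * y)) - _) ^+ 2]sqrrN opprB.
    rewrite -[(expR (- (1 / 2 * y)) - _) ^+ 2]sqrrN opprB; apply; lra.
  have ay : a / 2 * y <= 1 / 2 * y by apply: ler_wpM2r => //; lra.
  have ay0 : 0 <= a / 2 * y by apply: mulr_ge0 => //; lra.
  have e0 : expR (- (a / 2 * y)) <= expR (a / 2 * y) by rewrite ler_expR; lra.
  have e1 : expR (a / 2 * y) <= expR (1 / 2 * y) by rewrite ler_expR.
  have e2 : expR (- (1 / 2 * y)) <= expR (- (a / 2 * y)) by rewrite ler_expR; lra.
  by rewrite ler_pXn2r// ?nnegrE; lra.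
rewrite ler_pM2l//.
have h1 : 0 <= a / 2 * t by apply: mulr_ge0; lra.
have h2 : a / 2 * t <= 1 / 2 * t by apply: ler_wpM2r; lra.
rewrite ler_pXn2r// ?nnegrE.
- have [->//|ne] := eqVneq (a / 2 * t) (1 / 2 * t).
  have s1 : a / 2 * t \in `[(- (pi / 2)), (pi / 2)] by rewrite in_itv/=; apply/andP; split; lra.
  have s2 : 1 / 2 * t \in `[(- (pi / 2)), (pi / 2)] by rewrite in_itv/=; apply/andP; split; lra.
  by apply: ltW; rewrite ltr_sin// lt_neqAle ne.
- by apply: sin_ge0_pi; apply/andP; split; lra.
- by apply: sin_ge0_pi; apply/andP; split; lra.
Qed.

(** [cosh A - cosh B] is [2 sinh ((A - B) / 2) sinh ((A + B) / 2)]; the first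
    factor vanishes at the pole [u] of the Poisson kernel. *)
Lemma chden_csinh (a th u v t : R) :
  chden a th (v, t) - (expR (a * u) + expR (- (a * u)) + 2 * cos th)%:C =
  csinh (a / 2) u (v, t) * csinh (a / 2) (- u) (v, t).
Proof.
have at2 : a * t = a / 2 * t + a / 2 * t by field.
have cat : cos (a * t) = cos (a / 2 * t) ^+ 2 - sin (a / 2 * t) ^+ 2.
  by rewrite at2 cosD !expr2.
have sat : sin (a * t) = 2 * (sin (a / 2 * t) * cos (a / 2 * t)) by rewrite at2 sinD; ring.
have cs := cos2Dsin2 (a / 2 * t).
have xp : expR (a / 2 * (v - - u)) = expR (a / 2 * v) * expR (a / 2 * u).
  by rewrite -expRD; congr expR; ring.
have xm : expR (a / 2 * (v - u)) = expR (a / 2 * v) / expR (a / 2 * u).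
  by rewrite -expRN -expRD; congr expR; ring.
have ev : expR (a * v) = expR (a / 2 * v) ^+ 2.
  by rewrite expr2 -expRD; congr expR; field.
have eu : expR (a * u) = expR (a / 2 * u) ^+ 2.
  by rewrite expr2 -expRD; congr expR; field.
have e1 := expR_gt0 (a / 2 * v); have e2 := expR_gt0 (a / 2 * u).
apply/eqP; rewrite eq_complex Re_add Im_add Re_opp Im_opp Re_mul Im_mul !Re_csinh !Im_csinh.
rewrite Re_chden Im_chden/= [- a * v]mulNr !(expRN (a * _)) !(expRN (a / 2 * _)) xp xm ev eu cat sat.
move: (expR (a / 2 * v)) (expR (a / 2 * u)) e1 e2 => x y x0 y0.
move: (cos (a / 2 * t)) (sin (a / 2 * t)) (cos th) cs => c s C cs {cat sat at2 xp xm ev eu}.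
apply/andP; split; apply/eqP; last by field; rewrite !gt_eqF.
transitivity ((x ^+ 2 + x ^- 2) * (c ^+ 2 - s ^+ 2) - (y ^+ 2 + y ^- 2) * (c ^+ 2 + s ^+ 2)).
  by rewrite cs; ring.
by field; rewrite !gt_eqF.
Qed.

End complex_sinh.

(** * The Poisson formula of the strip *)

Section punctured.
Context {R : realType}.
Notation mu := (@lebesgue_measure R).

(** Bounded convergence off one point. *)
Lemma punctured_cvg_Rintegral_itv (p q u M : R) (f_ : nat -> R -> R) :
  (forall n, measurable_fun setT (f_ n)) ->
  (forall n x, p <= x <= q -> `|f_ n x| <= M) ->
  (forall x, x != u -> f_ n x @[n --> \oo] --> 0) ->
  \int[mu]_(x in `[p, q]) f_ n x @[n --> \oo] --> 0.
Proof.
move=> mf fM fc; have mD : measurable (`[p, q]%classic : set R) by exact: measurable_itv.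
have [] := @dominated_convergence _ _ _ mu `[p, q]%classic mD (fun n x => (f_ n x)%:E)
  (fun=> 0%E) (fun=> M%:E).
- move=> n; apply/measurable_EFinP; first [exact: (measurable_funTS (mf n))|apply: (measurable_funS measurableT) => //; exact: mf].
- exact: measurable_cst.
- exists [set u]; split; [exact: measurable_set1|exact: lebesgue_measure_set1|].
  move=> x /= nx; apply: contrapT => xu; apply: nx => _.
  by apply: cvg_EFin; [exact: nearW|apply: fc; exact/eqP].
- by apply: bounded_mfun_integrable_itv; exact: bounded_mfun_cst.
- by apply/aeW => x n xD /=; rewrite lee_fin fM.
- by move=> _ _; rewrite integral0 => c; apply: fine_cvg.
Qed.

End punctured.

Section poisson.
Context {R : realType}.
Notation mu := (@lebesgue_measure R).
Notation Re := complex.Re.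
Notation Im := complex.Im.
Variables (a th u : R).
Hypotheses (a0 : 0 < a) (a2 : a <= 1 / 2) (th0 : 0 <= th) (th2 : th <= pi / 2).
Hypothesis ath : a * pi < pi - th.

Notation den := (chden a th).
Let c : R := expR (a * u) + expR (- (a * u)) + 2 * cos th.

Let c_gt0 : 0 < c.
Proof.
rewrite /c ltr_wpDr ?mulr_ge0 ?chden_cos_ge0//.
by rewrite addr_gt0 ?expR_gt0.
Qed.

(** On the real line [1 / den] takes the value [1 / c] at [u], so that the
    singularity at [u] is removable. *)
Definition pole_free (q : R * R) : R[i] :=
  ((den q)^-1 + (- c^-1)%:C) * (csinh (1 / 2) u q)^-1.

Definition pole_free' (q : R * R) : R[i] :=
  (- (chden' a q * (den q)^-1 * (den q)^-1) + 0) * (csinh (1 / 2) u q)^-1 +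
  ((den q)^-1 + (- c^-1)%:C) *
  - (csinh' (1 / 2) u q * (csinh (1 / 2) u q)^-1 * (csinh (1 / 2) u q)^-1).

Let holomorphic_pole_free_at p : den p != 0 -> csinh (1 / 2) u p != 0 ->
  holomorphic_at pole_free pole_free' p.
Proof.
move=> d0 s0.
have hd := holomorphicV d0 (holomorphic_chden a th p).
have hs := holomorphicV s0 (holomorphic_csinh (1 / 2) u p).
exact: (holomorphicM (holomorphicD hd (holomorphic_cst (- c^-1)%:C p)) hs).
Qed.

Let width : R := Num.min ((pi - th) / a) (2 * pi).

Let width_gt : pi < width.
Proof.
rewrite /width lt_min ltr_pdivlMr// [pi * a]mulrC ath/=.
by have p0 := pi_gt0 R; lra.
Qed.

Let den_neq0 (v t : R) : 0 <= t < width -> den (v, t) != 0.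
Proof.
rewrite /width lt_min => /and3P[t0 t1 _]; apply: chden_neq0 => //.
by rewrite ger0_norm ?mulr_ge0 ?(ltW a0)// mulrC -ltr_pdivlMr.
Qed.

Let holomorphic_pole_free (v t : R) : 0 < t < width ->
  holomorphic_at pole_free pole_free' (v, t).
Proof.
move=> /andP[t0 t1]; apply: holomorphic_pole_free_at.
  by apply: den_neq0; rewrite (ltW t0).
by apply: csinh_neq0; move: t1; rewrite t0 /width lt_min => /andP[].
Qed.

Let sqnorm_pole_free (v t : R) : den (v, t) != 0 ->
  sqnorm (pole_free (v, t)) =
  sqnorm (csinh (a / 2) u (v, t)) * sqnorm (csinh (a / 2) (- u) (v, t)) *
  (sqnorm (den (v, t)))^-1 * (c^-1) ^+ 2 * (sqnorm (csinh (1 / 2) u (v, t)))^-1.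
Proof.
move=> d0; rewrite /pole_free sqnormM sqnormV; congr (_ * _).
have C0 : c%:C != 0 :> R[i] by rewrite eq_complex/= eqxx andbT gt_eqF.
have -> : (den (v, t))^-1 + (- c^-1)%:C = - ((den (v, t) - c%:C) * (den (v, t))^-1 * (c%:C)^-1).
  have -> : (- c^-1)%:C = - (c%:C)^-1 :> R[i] by rewrite rmorphN fmorphV.
  by move: (den _) (c%:C) d0 C0 => x y x0 y0; field; apply/andP.
have sN (z : R[i]) : sqnorm (- z) = sqnorm z by rewrite /sqnorm Re_opp Im_opp !sqrrN.
rewrite sN chden_csinh !sqnormM !sqnormV; congr (_ * _).
by rewrite /sqnorm/= expr0n/= addr0 exprVn.
Qed.

(** The difference [1 / den - 1 / c] has a factor that compensates the pole at
    [u]; the other factors are bounded for bounded [v], so that the contour can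
    be lowered to the real line by bounded convergence. *)
Let pole_free_near (N v t : R) : `|v| <= N -> 0 < t <= 1 ->
  `|Im (pole_free (v, t))| <= 2 * expR (N + `|u|) / c.
Proof.
move=> vN /andP[t0 t1]; have p2 := pi_ge2 R.
have tw : 0 <= t < width by rewrite ltW//=; apply: lt_trans width_gt; lra.
have r0 : 0 <= 2 * expR (N + `|u|) / c by rewrite divr_ge0 ?mulr_ge0 ?expR_ge0// ltW.
rewrite -(@ler_pXn2r _ 2%N)// ?nnegrE//; apply: le_trans (Im_sqnorm _) _.
rewrite sqnorm_pole_free; last exact: den_neq0.
have a01 : 0 < a <= 1 by rewrite a0/=; have := a2; lra.
have tpi : 0 < t < pi by rewrite t0/=; lra.
have m1 := sqnorm_csinh_mono u v a01 tpi.
have t2pi : 0 < t < 2 * pi by rewrite t0/=; lra.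
have s0 := csinh_gt0 u v t2pi.
have m2 := sqnorm_csinh_le (a / 2) (- u) v t.
have m2' : sqnorm (csinh (a / 2) (- u) (v, t)) <= 4 * expR (N + `|u|) ^+ 2.
  apply: le_trans m2 _; rewrite ler_pM2l// ler_pXn2r ?nnegrE ?expR_ge0// ler_expR opprK normrM.
  have h1 : `|a / 2| <= 1 by rewrite ger0_norm; have := a2; have := a0; lra.
  have h2 := ler_normD v u; have h3 := normr_ge0 (v + u).
  apply: (@le_trans _ _ (1 * `|v + u|)); first exact: ler_wpM2r.
  by rewrite mul1r (le_trans h2)// lerD2r.
have m3 : 1 <= sqnorm (den (v, t)).
  have at0 : 0 < a * t by exact: mulr_gt0.
  have at1 : a * t <= 1 / 2.
    by apply: le_trans a2; rewrite ger_pMr.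
  have cos1 := one_minus_cos_le at0.
  have at2 : (a * t) ^+ 2 <= (1 / 2) ^+ 2 by rewrite ler_pXn2r// nnegrE; lra.
  have cos2 : 1 / 2 <= cos (a * t) by rewrite expr2 in at2; lra.
  have r1 : 1 <= Re (den (v, t)).
    rewrite Re_chden; have := chden_cos_ge0 th0 th2; move: (cos th) => C C0.
    have ee : expR (a * v) * expR (- a * v) = 1 by rewrite -expRD mulNr subrr expR0.
    have e0 := expR_gt0 (a * v); have e1 := expR_gt0 (- a * v).
    move: (expR (a * v)) (expR (- a * v)) (cos (a * t)) ee e0 e1 cos2 => x y z xy x0 y0 z0.
    have s2 : 2 <= x + y.
      rewrite -(@ler_pXn2r _ 2%N)// ?nnegrE//; last lra.
      have -> : (x + y) ^+ 2 = (x - y) ^+ 2 + 4 * (x * y) by ring.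
      by rewrite xy; have := sqr_ge0 (x - y); lra.
    have : 2 * (1 / 2) <= (x + y) * z by apply: ler_pM => //; lra.
    by lra.
  apply: le_trans (Re_sqnorm _); rewrite ger0_norm; last lra.
  by rewrite -[leLHS](expr1n _ 2) ler_pXn2r// nnegrE; lra.
have -> : (2 * expR (N + `|u|) / c) ^+ 2 = 1 * (4 * expR (N + `|u|) ^+ 2) * 1 * c^-1 ^+ 2.
  by field; rewrite gt_eqF.
have sq0 z : 0 <= sqnorm z by rewrite addr_ge0 ?sqr_ge0.
have -> (w x y z k : R) : w * x * y * z * k = (w * k) * x * y * z by ring.
set s := sqnorm (csinh (1 / 2) u (v, t)) in s0 m1 *.
have d0 : 0 < sqnorm (den (v, t)) by apply: lt_le_trans m3.
have q1 : sqnorm (csinh (a / 2) u (v, t)) / s <= 1 by rewrite ler_pdivrMr// mul1r.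
have q3 : (sqnorm (den (v, t)))^-1 <= 1 by rewrite invf_le1.
have q0 : 0 <= sqnorm (csinh (a / 2) u (v, t)) / s by apply: divr_ge0; [exact: sq0|exact: ltW].
have q4 : 0 <= (sqnorm (den (v, t)))^-1 by rewrite invr_ge0; exact: ltW.
apply: ler_wpM2r; first exact: sqr_ge0.
apply: ler_pM; [by apply: mulr_ge0; [exact: q0|exact: sq0]|exact: q4| |exact: q3].
by apply: ler_pM; [exact: q0|exact: sq0|exact: q1|exact: m2'].
Qed.

Let pole_free_far (v t : R) : 0 < t <= pi -> 4 / a + 2 * `|u| <= `|v| ->
  `|Re (pole_free (v, t))| <= (4 * (1 + c^-1)) / `|v|.
Proof.
move=> /andP[t0 t1] vf; have p2 := pi_ge2 R; have w := width_gt.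
have u0 := normr_ge0 u; have a4 : 0 < 4 / a by rewrite divr_gt0.
have v0 : 0 < `|v| by lra.
have av : 4 <= a * `|v| by rewrite mulrC -ler_pdivrMr//; lra.
have far := chden_far th t av.
have far2 : 1 <= sqnorm (den (v, t)) by apply: le_trans far; nra.
have sh := sqnorm_csinh_ge u v t.
have c1 : 0 < c^-1 by rewrite invr_gt0.
have r0 : 0 <= 4 * (1 + c^-1) / `|v| by rewrite divr_ge0 ?mulr_ge0 ?addr_ge0 ?ltW.
rewrite -(@ler_pXn2r _ 2%N)// ?nnegrE//; apply: le_trans (Re_sqnorm _) _.
rewrite /pole_free sqnormM [sqnorm (csinh _ _ _)^-1]sqnormV.
have h1 : sqnorm ((den (v, t))^-1 + (- c^-1)%:C) <= (1 + c^-1) ^+ 2.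
  have e1 : sqnorm (den (v, t))^-1 <= 1.
    by rewrite sqnormV invf_le1//; apply: lt_le_trans far2.
  move: ((den (v, t))^-1) (c^-1) c1 e1 => [x y] k k0; rewrite /sqnorm/= addr0 => e1.
  have x1 : - 1 <= x by rewrite leNgt; apply/negP => xx; nra.
  have xk : 0 <= (x + 1) * k by apply: mulr_ge0; [lra|exact: ltW].
  have -> : (x - k) ^+ 2 + y ^+ 2 = x ^+ 2 + y ^+ 2 - 2 * ((x + 1) * k) + 2 * k + k ^+ 2 by ring.
  have -> : (1 + k) ^+ 2 = 1 + 2 * k + k ^+ 2 by ring.
  by lra.
have vu : `|v| / 2 <= `|v - u| by have := lerB_dist v u; lra.
have h2 : `|v| ^+ 2 / 16 <= sqnorm (csinh (1 / 2) u (v, t)).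
  apply: le_trans sh; rewrite -[(v - u) ^+ 2]real_normK ?num_real//.
  have : (`|v| / 2) ^+ 2 <= `|v - u| ^+ 2 by rewrite ler_pXn2r// nnegrE; lra.
  by rewrite expr_div_n; lra.
have vv : 0 < `|v| ^+ 2 / 16 by rewrite divr_gt0// exprn_gt0.
have -> : (4 * (1 + c^-1) / `|v|) ^+ 2 = (1 + c^-1) ^+ 2 * (`|v| ^+ 2 / 16)^-1.
  by move: (`|v|) v0 (c^-1) => x x0 k; field; rewrite gt_eqF.
apply: ler_pM => //; first by rewrite addr_ge0 ?sqr_ge0.
  by rewrite invr_ge0 addr_ge0 ?sqr_ge0.
by rewrite lef_pV2// posrE; apply: lt_le_trans h2.
Qed.

Let Im_pole_free0 (v : R) : Im (pole_free (v, 0)) = 0.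
Proof.
have d : Im (den (v, 0))^-1 = 0 by rewrite Im_inv Im_chden mulr0 sin0 mulr0 oppr0 mul0r.
have s : Im (csinh (1 / 2) u (v, 0))^-1 = 0.
  by rewrite Im_inv Im_csinh mulr0 sin0 mulr0 oppr0 mul0r.
by rewrite /pole_free Im_mul Im_add d s (_ : Im (- c^-1)%:C = 0)// addr0 mul0r mulr0 addr0.
Qed.

Definition poisson_weight (v : R) : R := Re (den (v, pi))^-1.

Let Im_pole_free_pi (v : R) :
  Im (pole_free (v, pi)) = c^-1 * half_sech (v - u) - poisson_weight v * half_sech (v - u).
Proof.
have cp : cos (1 / 2 * pi) = 0 :> R by rewrite mul1r mulrC cos_pihalf.
have sp : sin (1 / 2 * pi) = 1 :> R by rewrite mul1r mulrC sin_pihalf.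
have h0 : half_sech (v - u) != 0.
  by rewrite /half_sech invr_eq0 gt_eqF// addr_gt0 ?expR_gt0.
have R0 : Re (csinh (1 / 2) u (v, pi)) = 0 by rewrite Re_csinh cp mulr0.
have I0 : Im (csinh (1 / 2) u (v, pi)) = (half_sech (v - u))^-1.
  by rewrite Im_csinh sp mulr1 /half_sech invrK mul1r [2^-1 * _]mulrC.
rewrite /pole_free Im_mul Re_add [Re (csinh _ _ _)^-1]Re_inv [Im (csinh _ _ _)^-1]Im_inv R0 I0.
rewrite /poisson_weight (_ : Re (- c^-1)%:C = - c^-1)//.
rewrite mul0r mulr0 addr0; move: (Re (den (v, pi))^-1) c^-1 (half_sech (v - u)) h0 => x k h h0.
by field.
Qed.

Let continuous_Im_pole_free (t : R) : 0 < t < width ->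
  continuous (fun v => Im (pole_free (v, t))).
Proof. by move=> tw v; have [_ d _ _ _] := holomorphic_pole_free v tw; exact: has_derive_continuous d. Qed.

Let cvg_Im_pole_free (n : nat) :
  \int[mu]_(v in `[(- n.+1%:R), n.+1%:R]) Im (pole_free (v, j.+1%:R^-1)) @[j --> \oo] --> 0.
Proof.
have j01 (j : nat) : 0 < (j.+1%:R^-1 : R) <= 1 by rewrite invr_gt0 ltr0Sn/= invf_le1// ler1n.
have w := width_gt; have p2 := pi_ge2 R.
apply: (@punctured_cvg_Rintegral_itv _ _ _ u (2 * expR (n.+1%:R + `|u|) / c)).
- move=> j; apply: continuous_measurable_fun; apply: continuous_Im_pole_free.
  by have /andP[h0 h1] := j01 j; rewrite h0/= (le_lt_trans h1)// (lt_trans _ w)//; lra.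
- by move=> j v; rewrite -ler_norml => vn; exact: pole_free_near.
- move=> v vu.
  have d0 : den (v, 0) != 0.
    by apply: den_neq0; rewrite lexx/= (lt_trans _ w)// pi_gt0.
  have s0 : csinh (1 / 2) u (v, 0) != 0.
    have sq : 0 < (v - u) ^+ 2 / 4 by rewrite divr_gt0// exprn_even_gt0//= subr_eq0.
    apply/eqP => E; have := sqnorm_csinh_ge u v 0; rewrite E /sqnorm/= expr0n/= addr0.
    by rewrite leNgt sq.
  have [_ _ _ d _] := holomorphic_pole_free_at d0 s0.
  have cd := has_derive_continuous d.
  rewrite -[X in _ --> X](Im_pole_free0 v).
  exact: (cvg_comp _ _ (@cvg_harmonic R) cd).
Qed.

Let cvg_Im_pole_free_pi :
  \int[mu]_(v in `[(- n.+1%:R), n.+1%:R]) Im (pole_free (v, pi)) @[n --> \oo] --> 0.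
Proof.
pose K := 4 * (1 + c^-1); pose N0 := 4 / a + 2 * `|u|.
have c1 : 0 < c^-1 by rewrite invr_gt0.
have w := width_gt; have p2 := pi_ge2 R; have p0 := pi_gt0 R.
have K0 : 0 <= K by rewrite /K; lra.
have b (n : nat) : N0 <= n.+1%:R ->
    `|\int[mu]_(v in `[(- n.+1%:R), n.+1%:R]) Im (pole_free (v, pi))| <= 2 * K * n.+1%:R^-1 * pi.
  move=> nN; set J := \int[mu]_(v in _) _.
  have cj : J - \int[mu]_(v in `[(- n.+1%:R), n.+1%:R]) Im (pole_free (v, j.+1%:R^-1))
      @[j --> \oo] --> J.
    by rewrite -[X in _ --> X]subr0; apply: cvgB; [exact: cvg_cst|exact: cvg_Im_pole_free].
  have {}cj : `|J - \int[mu]_(v in `[(- n.+1%:R), n.+1%:R]) Im (pole_free (v, j.+1%:R^-1))|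
      @[j --> \oo] --> `|J| by exact: cvg_norm.
  apply: (cvgr_to_le cj); apply: nearW => j.
  have j0 : 0 < j.+1%:R^-1 :> R by rewrite invr_gt0.
  have j1 : j.+1%:R^-1 <= 1 :> R by rewrite invf_le1// ler1n.
  have jp : (j.+1%:R^-1 : R) < pi by apply: le_lt_trans j1 _; apply: lt_le_trans p2; rewrite ltr1n.
  apply: (@le_trans _ _ (2 * K * n.+1%:R^-1 * (pi - j.+1%:R^-1))).
    apply: (contour_bound_Im j0 jp w holomorphic_pole_free _ nN) => v t /andP[t0 t1].
    by apply: pole_free_far; rewrite t1 (lt_le_trans j0).
  apply: ler_wpM2l; last by rewrite lerBlDr lerDl ltW.
  by apply: divr_ge0 => //; exact: mulr_ge0.
have K' : 2 * K * n.+1%:R^-1 * pi @[n --> \oo] --> (0 : R).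
  rewrite -[X in _ --> X](mul0r pi); apply: cvgMr_tmp.
  by rewrite -[X in _ --> X](mulr0 (2 * K)); apply: cvgMl_tmp; exact: cvg_harmonic.
apply/cvgrPdist_le => e e0; near=> n; rewrite sub0r normrN.
apply: (@le_trans _ _ (2 * K * n.+1%:R^-1 * pi)).
  apply: b; apply: (@le_trans _ _ n%:R); last by rewrite ler_nat.
  by near: n; exact: nbhs_infty_ger.
by near: n; exact: (cvgr_le _ K').
Unshelve. all: by end_near. Qed.

Lemma poisson_weight_ge0 v : 0 <= poisson_weight v.
Proof.
rewrite /poisson_weight Re_inv divr_ge0//; last by rewrite addr_ge0 ?sqr_ge0.
have p0 := pi_gt0 R; have h1 : 0 <= a * pi by rewrite mulr_ge0 ?ltW.
have h2 : a * pi <= 1 / 2 * pi by rewrite ler_pM2r.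
have c1 : 0 <= cos (a * pi) by apply: chden_cos_ge0 => //; lra.
have c2 := chden_cos_ge0 th0 th2.
by rewrite Re_chden; apply: addr_ge0; apply: mulr_ge0 => //; rewrite addr_ge0 ?expR_ge0.
Qed.

Lemma continuous_poisson_weight : continuous poisson_weight.
Proof.
move=> v; have p0 := pi_gt0 R.
have d0 : den (v, pi) != 0 by apply: den_neq0; rewrite width_gt ltW.
have [d _ _ _ _] := holomorphicV d0 (holomorphic_chden a th (v, pi)).
exact: has_derive_continuous d.
Qed.

(** On the lower edge [1 / den] is real, so that the imaginary part of
    [pole_free] vanishes there, and its integral over the upper edge vanishes as
    well. There the inverse of the hyperbolic sine is purely imaginary and equal
    to [half_sech] up to a unit. *)
Theorem poisson_formula :
  (\int[mu]_v (poisson_weight v * half_sech (v - u))%:E = (pi / c)%:E)%E.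
Proof.
have ch : continuous (fun v => half_sech (v - u)).
  move=> v; apply: (@continuous_comp _ _ _ (fun v => v - u) half_sech).
    by apply: cvgB; [exact: cvg_id|exact: cvg_cst].
  exact: continuous_half_sech.
have cW : continuous (fun v => poisson_weight v * half_sech (v - u)).
  by move=> v; apply: cvgM; [exact: continuous_poisson_weight|exact: ch].
have cint (f : R -> R) (n : nat) : continuous f -> mu.-integrable `[(- n.+1%:R), n.+1%:R] (EFin \o f).
  move=> cf; apply: continuous_compact_integrable; first exact: segment_compact.
  exact: continuous_subspaceT.
have E (n : nat) : (\int[mu]_(v in `[(- n.+1%:R)%R, (n.+1%:R)%R]) (poisson_weight v * half_sech (v - u))%:E)%E =
   (c^-1 * \int[mu]_(v in `[(- n.+1%:R), n.+1%:R]) half_sech (v - u) -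
   \int[mu]_(v in `[(- n.+1%:R), n.+1%:R]) Im (pole_free (v, pi)))%:E.
  under [X in (_ - X)%:E]eq_Rintegral do rewrite Im_pole_free_pi.
  rewrite RintegralB//; [|by apply: cint => v; apply: cvgMl_tmp; exact: ch|exact: cint].
  rewrite RintegralZl//; last exact: cint.
  rewrite opprB addrC subrK fineK//.
  by apply: (integrable_fin_num _ (cint _ n cW)); exact: measurable_itv.
have mW : measurable_fun setT (fun v => poisson_weight v * half_sech (v - u)).
  exact: continuous_measurable_fun.
have W0 v : 0 <= poisson_weight v * half_sech (v - u).
  by rewrite mulr_ge0 ?poisson_weight_ge0 ?half_sech_ge0.
have e1 := cvg_integral_symmetric mW W0.
have cl : c^-1 * \int[mu]_(v in `[(- n.+1%:R), n.+1%:R]) half_sech (v - u) -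
   \int[mu]_(v in `[(- n.+1%:R), n.+1%:R]) Im (pole_free (v, pi)) @[n --> \oo] --> pi / c.
  rewrite -[X in _ --> X]subr0 [pi / c]mulrC; apply: cvgB; last exact: cvg_Im_pole_free_pi.
  by apply: cvgMl_tmp; exact: cvg_half_sech.
have e2 : ((c^-1 * \int[mu]_(v in `[(- n.+1%:R)%R, (n.+1%:R)%R]) half_sech (v - u) -
   \int[mu]_(v in `[(- n.+1%:R)%R, (n.+1%:R)%R]) Im (pole_free (v, pi%R)))%R%:E @[n --> \oo] -->
    (pi / c)%R%:E)%E.
  by apply: cvg_EFin; [apply: nearW|exact: cl].
move: e1; under eq_fun do rewrite E; move=> e1.
exact: (cvg_unique _ e1 e2).
Qed.

End poisson.

(** * The exponential factor of a Boolean stable law *)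

Section exponential_factorisation.
Context {R : realType}.
Notation PR := (probability (measurableTypeR R) R).
Notation mu := (@lebesgue_measure R).

(** Tonelli: convolution with a probability density preserves the total mass. *)
Lemma half_sech_mass (w g : R -> R) : continuous w -> (forall v, 0 <= w v) ->
  (forall u, (\int[mu]_v (w v * (pi^-1 * half_sech (u - v)))%:E = (g u)%:E)%E) ->
  (\int[mu]_v (w v)%:E = \int[mu]_u (g u)%:E)%E.
Proof.
move=> cw w0 wg; have p0 := pi_gt0 R.
have ipi : 0 <= pi^-1 :> R by rewrite invr_ge0 ltW.
have inner v : (\int[mu]_u (w v * (pi^-1 * half_sech (u - v)))%:E = (w v)%:E)%E.
  have ih : mu.-integrable setT (EFin \o (fun u => half_sech (u - v))).
    apply: (@le_integrable _ _ _ mu setT measurableT _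
      (EFin \o (fun u => expR (`|v| / 2) * half_sech u))).
    - apply/measurable_EFinP; have [mh _] := @bounded_half_sech R.
      by apply: (measurableT_comp mh); exact: measurable_funB.
    - move=> u _ /=; rewrite lee_fin (ger0_norm (half_sech_ge0 _)).
      by apply: le_trans (ler_norm _); exact: half_sech_shift_le.
    - under [X in integrable _ _ X]eq_fun do rewrite /= EFinM.
      by apply: integrableZl => //; exact: integrable_half_sech.
  have H : \int[mu]_u half_sech (u - v) = pi.
    rewrite (integral_translation (- v) (@continuous_half_sech R) (@half_sech_ge0 R)).
    exact: Rintegral_half_sech.
  have H' : (\int[mu]_u (half_sech (u - v))%:E = (pi : R)%:E)%E.
    by rewrite -H /Rintegral fineK//; exact: (integrable_fin_num _ ih).
  under eq_integral do rewrite mulrA EFinM.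
  rewrite (integralZl measurableT ih) H' -EFinM -mulrA mulVf ?mulr1//.
  by rewrite gt_eqF.
under [RHS]eq_integral do rewrite -wg.
under [LHS]eq_integral do rewrite -inner.
have mw : measurable_fun setT w by exact: continuous_measurable_fun.
have [mh _] := @bounded_half_sech R.
apply: (@fubini_tonelli _ _ (measurableTypeR R) (measurableTypeR R) R mu mu
  (fun z => (w z.1 * (pi^-1 * half_sech (z.2 - z.1)))%:E)).
  apply/measurable_EFinP; apply: measurable_funM.
    by apply: (measurableT_comp mw); exact: measurable_fst.
  apply: measurable_funM => //; apply: (measurableT_comp mh).
  by apply: measurable_funB; [exact: measurable_snd|exact: measurable_fst].
by move=> z; rewrite lee_fin mulr_ge0 ?w0// mulr_ge0 ?half_sech_ge0.
Qed.

(** The bound [a <= 1 / 2] makes the weight nonnegative. *)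
Lemma poisson_stable_kernel (a th : R) : 0 < a -> a <= 1 / 2 -> 0 <= th -> th <= pi / 2 ->
  a * pi < pi - th ->
  exists w : R -> R, [/\ continuous w, forall v, 0 <= w v &
    forall u, (\int[mu]_v (w v * (pi^-1 * half_sech (u - v)))%:E =
               (pi^-1 * stable_kernel a u th)%:E)%E].
Proof.
move=> a0 a2 th0 th2 ath; have p0 := pi_gt0 R.
have s0 : 0 <= sin th by apply: sin_ge0_pi; apply/andP; split; lra.
have ipi : 0 <= pi^-1 :> R by rewrite invr_ge0 ltW.
have W0 v : 0 <= poisson_weight a th v by exact: poisson_weight_ge0.
have k0 : 0 <= sin th * pi^-1 by exact: mulr_ge0.
exists (fun v => sin th * pi^-1 * poisson_weight a th v); split.
- move=> v; apply: cvgMl_tmp; exact: continuous_poisson_weight.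
- by move=> v; exact: mulr_ge0.
move=> u; have F := poisson_formula u a0 a2 th0 th2 ath.
transitivity (\int[mu]_v ((sin th * pi^-1 * pi^-1)%:E *
    (poisson_weight a th v * half_sech (v - u))%:E))%E.
  apply: eq_integral => v _; rewrite -EFinM; congr EFin.
  rewrite -(half_sechN (v - u)) opprB.
  by move: (pi^-1) (poisson_weight _ _ _) (half_sech _) => p x y; ring.
rewrite ge0_integralZl_EFin//.
- rewrite F -EFinM; congr EFin; rewrite /stable_kernel.
  have pn : (pi : R) != 0 by rewrite gt_eqF.
  by move: (pi : R) pn (_ + 2 * cos th)^-1 => p pn x; field.
- by move=> v _; rewrite lee_fin; apply: mulr_ge0; [exact: W0|exact: half_sech_ge0].
- apply/measurable_EFinP; apply: measurable_funM.
    by apply: continuous_measurable_fun; exact: continuous_poisson_weight.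
  have [mh _] := @bounded_half_sech R.
  by apply: (measurableT_comp mh); exact: measurable_funB.
- exact: mulr_ge0.
Qed.

Lemma Rintegral_product_dirac (x : R) (q : PR) (f : R -> R) :
  bounded_mfun (f : measurableTypeR R -> R) ->
  \int[product_law (\d_(x : measurableTypeR R) : PR) q]_z f z = \int[q]_y f (x * y).
Proof.
move=> bf; rewrite Rintegral_product_law//.
rewrite (bRintegral_dirac x (f := fun x => \int[q]_y f (x * y)))//.
apply: (@bounded_mfun_Rintegral1 _ _ _ _ _ q q (fun z => f (z.1 * z.2))).
by apply: (bounded_mfun_comp bf); exact: measurable_mul_pair.
Qed.

(** The weights given by the Poisson formula have total mass [1] and describe the
    other factor. The formula degenerates when a zero of the denominator reaches
    height [pi], which is the case [a = 1 / 2] with [rho] equal to [0] or [1]; the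
    law is then, up to a sign, the quotient of Gamma variables itself. *)
Lemma boolean_stable_half_sech_factor (a rho : R) (b q : PR) :
  0 < a -> a <= 1 / 2 -> 0 <= rho -> rho <= 1 -> is_boolean_stable a rho b ->
  log_law q (fun u => pi^-1 * half_sech u) (fun=> 0) ->
  exists p : PR, same_law b (product_law p q).
Proof.
move=> a0 a2 r0 r1 bst qL; have p0 := pi_gt0 R.
have pi_ge0 : 0 <= pi :> R by exact: ltW.
have api : a * pi <= 1 / 2 * pi by rewrite ler_pM2r.
have rpi : a * (rho * pi) + a * ((1 - rho) * pi) = a * pi by ring.
have r1' : 0 <= 1 - rho by rewrite subr_ge0.
have th10 : 0 <= a * (rho * pi) by apply: mulr_ge0; [exact: ltW|exact: mulr_ge0].
have th20 : 0 <= a * ((1 - rho) * pi) by apply: mulr_ge0; [exact: ltW|exact: mulr_ge0].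
have a01 : 0 < a <= 1 by rewrite a0/=; lra.
have r01 : 0 <= rho <= 1 by rewrite r0.
move: (a * (rho * pi)) (a * ((1 - rho) * pi)) rpi th10 th20
  (@boolean_stable_density R a rho b bst a01 r01) => th1 th2 rpi th10 th20 dens.
have th12 : th1 <= pi / 2 by lra.
have th22 : th2 <= pi / 2 by lra.
have [ig ih bE] := dens th12 th22.
have ipi : 0 <= pi^-1 :> R by rewrite invr_ge0 ltW.
have [/andP[ath1 ath2]|] := boolP ((a * pi < pi - th1) && (a * pi < pi - th2)).
  have [w1 [cw1 w10 w1E]] := poisson_stable_kernel a0 a2 th10 th12 ath1.
  have [w2 [cw2 w20 w2E]] := poisson_stable_kernel a0 a2 th20 th22 ath2.
  have b1 : bounded_mfun ((fun=> 1) : measurableTypeR R -> R) by exact: bounded_mfun_cst.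
  have tot : (\int[mu]_v (w1 v)%:E + \int[mu]_v (w2 v)%:E = 1)%E.
    rewrite (half_sech_mass cw1 w10 w1E) (half_sech_mass cw2 w20 w2E).
    have := bE _ b1; rewrite Rintegral_prob_cst => E1.
    have f1 := integrable_fin_num measurableT ig; have f2 := integrable_fin_num measurableT ih.
    rewrite -[X in (X + _)%E](fineK f1) -[X in (_ + X)%E](fineK f2) -EFinD; congr EFin.
    by rewrite E1; congr (_ + _); apply: eq_Rintegral => v _; rewrite mul1r.
  have mw1 : measurable_fun setT w1 by exact: continuous_measurable_fun.
  have mw2 : measurable_fun setT w2 by exact: continuous_measurable_fun.
  have mN : measurable_fun setT (fun v : R => - expR v) by exact: measurableT_comp.
  have [p pE] := @exists_law R _ _ mu (@expR R) (fun v => - expR v) w1 w2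
    (@measurable_expR R) mN mw1 mw2 w10 w20 tot.
  exists p; apply: (@log_law_same _ _ _ _ _ bE).
  have bk th : 0 <= th -> th <= pi / 2 -> bounded_mfun (fun v => pi^-1 * stable_kernel a v th).
    move=> t0 t2; apply: bounded_mfunM; first exact: bounded_mfun_cst.
    split; first exact: measurable_stable_kernel.
    by exists 1 => v; apply: stable_kernel_bound; exact: chden_cos_ge0.
  have k0 th v : 0 <= th -> th <= pi / 2 -> 0 <= pi^-1 * stable_kernel a v th.
    by move=> t0 t2; apply: mulr_ge0 => //; apply: stable_kernel_ge0; rewrite t0.
  apply: (product_log_law pE qL).
  - move=> v; apply: cvgMl_tmp; exact: continuous_half_sech.
  - by move=> v; apply: mulr_ge0 => //; exact: half_sech_ge0.
  - by apply: bounded_mfunM; [exact: bounded_mfun_cst|exact: bounded_half_sech].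
  - under [X in integrable _ _ X]eq_fun do rewrite /= EFinM.
    by apply: integrableZl => //; exact: integrable_half_sech.
  - exact: bk.
  - exact: bk.
  - by move=> v; exact: k0.
  - by move=> v; exact: k0.
  - by move=> u; rewrite /Rintegral; under eq_integral do rewrite mulrC; rewrite w1E.
  - by move=> u; rewrite /Rintegral; under eq_integral do rewrite mulrC; rewrite w2E.
(* The remaining case is [a = 1 / 2] with the whole mass on one half-line. *)
have sech v : pi^-1 * stable_kernel (1 / 2) v (pi / 2) = pi^-1 * half_sech v.
  rewrite /stable_kernel sin_pihalf cos_pihalf mulr0 addr0 !mul1r /half_sech.
  by rewrite [2^-1 * v]mulrC.
have zero c v : pi^-1 * stable_kernel c v 0 = 0 by rewrite /stable_kernel sin0 mul0r mulr0.
have zint (f : R -> R) : \int[mu]_v (f v * 0) = 0.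
  by under eq_Rintegral do rewrite mulr0; rewrite Rintegral_cst// mul0r.
have half : a * pi = pi / 2 -> a = 1 / 2.
  by move=> e; apply: (mulIf (lt0r_neq0 p0)); rewrite e mul1r mulrC.
have bf1 (f : R -> R) (x : R) : bounded_mfun (f : measurableTypeR R -> R) ->
    bounded_mfun (fun y : measurableTypeR R => f (x * y)).
  by move=> bf; exact: bounded_mfun_scale.
rewrite negb_and -!leNgt => /orP[h|h].
  have e1 : th1 = pi / 2 by lra.
  have e2 : th2 = 0 by lra.
  have ae : a = 1 / 2 by apply: half; lra.
  exists (\d_(1 : measurableTypeR R) : PR); apply/same_lawP => f bf.
  rewrite Rintegral_product_dirac// bE// (qL (fun y => f (1 * y))); last exact: bf1.
  rewrite e1 e2 ae; congr (_ + _); apply: eq_Rintegral => v _.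
    by rewrite sech mul1r.
  by rewrite zero !mulr0.
have e1 : th2 = pi / 2 by lra.
have e2 : th1 = 0 by lra.
have ae : a = 1 / 2 by apply: half; lra.
exists (\d_(-1 : measurableTypeR R) : PR); apply/same_lawP => f bf.
rewrite Rintegral_product_dirac// bE// (qL (fun y => f (-1 * y))); last exact: bf1.
rewrite e1 e2 ae addrC; congr (_ + _); apply: eq_Rintegral => v _.
  by rewrite sech mulN1r.
by rewrite zero !mulr0.
Qed.

Theorem boolean_stable_exponential (a rho : R) (b : PR) :
  0 < a -> a <= 1 / 2 -> 0 <= rho -> rho <= 1 -> is_boolean_stable a rho b ->
  exists p : PR, same_law b (product_law p std_exponential).
Proof.
move=> a0 a2 r0 r1 bst; have [q [r [qr qL]]] := @half_sech_exponential R.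
have [p bp] := boolean_stable_half_sech_factor a0 a2 r0 r1 bst qL.
exists (product_law p r); apply: (same_law_trans bp).
exact: (same_law_trans (product_law_ext p qr) (product_lawA _ _ _)).
Qed.

End exponential_factorisation.

Theorem theorem4p18 (R : realType) :
  [/\ (forall alpha rho : R, 0 < alpha <= 1 / 2 -> 0 <= rho <= 1 ->
         boolean_stable_mixtures alpha rho `<=` exponential_mixtures),
      (forall alpha : R, 0 < alpha <= 1 ->
         boolean_stable_mixtures alpha (1 / 2) `<=` infinitely_divisible)
    & (forall rho : R, 0 <= rho <= 1 -> rho != 1 / 2 ->
         ~ (boolean_stable_mixtures 1 rho `<=` infinitely_divisible))].
Proof.
split.
- move=> a rho /andP[a0 a2] /andP[r0 r1] m /boolean_stable_mixtures_product_law[b [p [bst mE _]]].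
  have [r bE] := boolean_stable_exponential a0 a2 r0 r1 bst.
  apply: (@exponential_mixtures_product_law _ _ (product_law p r)); apply: (same_law_trans mE).
  exact: (same_law_trans (product_law_ext p bE) (product_lawA _ _ _)).
- move=> a /andP[a0 a1] m /boolean_stable_mixtures_product_law[b [p [bst mE _]]].
  have [q qE] : exists q : probability (measurableTypeR R) R, forall t, charf b t = (laplace q `|t|)%:C.
    move: a1 bst; rewrite le_eqVlt => /orP[/eqP -> bst|a1 bst].
      by exists (\d_(1 : measurableTypeR R) : probability (measurableTypeR R) R) => t; exact: boolean_stable_half_charf bst t.
    exact: (boolean_stable_laplace a0 a1 bst).
  apply: (@infinitely_divisible_laplace _ (product_law p q)) => t.
  by rewrite (same_law_charf mE) (charf_product_laplace _ qE).
- by move=> rho r01 rh; exact: boolean_stable_not_ID.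
Qed.
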